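(* Let $\mathcal O$ be a cohomogeneity-two nilpotent orbit in a complex classical Lie algebra ($\mathfrak{sl}(n,\mathbb C)$, $\mathfrak{so}(n,\mathbb C)$ or $\mathfrak{sp}(n,\mathbb C)$). For $X\in\mathcal O$ put $c_1=c_1(X)=\operatorname{Tr}XX^*$ and $c_2=c_2(X)=\operatorname{Tr}YY^*$, where $Y=[X,X^*]$. Then the hyperKähler potential $\rho$ of the canonical hyperKähler structure on $\mathcal O$ is given by $$\rho^2=4\kappa c_1+4\kappa\sqrt{2c_1^2-\kappa c_2},$$ where $\kappa=1$ for $\mathfrak{sl}(n,\mathbb C)$ and $\mathfrak{sp}(n,\mathbb C)$, and $\kappa=2$ for $\mathfrak{so}(n,\mathbb C)$.
   Context: Cohomogeneity. The cohomogeneity of a complex adjoint orbit $\mathcal O\subset\mathfrak g^{\mathbb C}$ is the codimension in $\mathcal O$ of the generic orbits of the compact group $G$ (compact real form) acting on $\mathcal O$. (It is known that the cohomogeneity-two nilpotent orbits in classical Lie algebras are those of Jordan type $(2^2,1^{n-4})$ in $\mathfrak{sl}(n,\mathbb C)$, $(3,1^{n-3})$ and $(2^4,1^{n-8})$ in $\mathfrak{so}(n,\mathbb C)$, and $(2^2,1^{2n-4})$ in $\mathfrak{sp}(n,\mathbb C)$.) Matrix conventions. $\mathfrak{sl}(n,\mathbb C)$ acts on $\mathbb C^N$ with $N=n$; $\mathfrak{so}(n,\mathbb C)$ acts on $\mathbb C^N$, $N=n$, preserving a non-degenerate symmetric bilinear form; $\mathfrak{sp}(n,\mathbb C)$ acts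 on $\mathbb C^N$, $N=2n$, preserving a non-degenerate skew bilinear form. $\mathbb C^N$ carries a Hermitian inner product, compatible with the bilinear form when there is one: in some orthonormal basis the bilinear form has as matrix the identity (symmetric case) or $\begin{pmatrix}0&\mathbf 1\\-\mathbf 1&0\end{pmatrix}$ (skew case). $X^*$ denotes the Hermitian adjoint. HyperKähler potential. A hyperKähler manifold is a Riemannian manifold with complex structures $I,J,K$ satisfying $IJ=K=-JI$, for each of which $g$ is Hermitian, and such that $\omega_I(X,Y)=g(X,IY)$, $\omega_J$, $\omega_K$ are closed. A real function $\rho$ is a hyperKähler potential if it is simultaneously a Kähler potential for $(\omega_I,I)$, $(\omega_J,J)$, $(\omega_K,K)$, normalised so that on a flat quaternionic vector space with norm $r$ the potential is $r^2$; that is, $\omega_A=\tfrac14\,d(d\rho\circ A)$ for $A=I,J,K$, with the usual exterior derivative. Canonical hyperKähler structure and its potential. Let $\mathcal O$ be the orbit of a nilpotent $A$ with $A^{k}=0$, $A^{k-1}\neq0$. Let $V_i$ ($0\le i\le k$) be Hermitian vector spaces with $\dim V_i=\operatorname{rank}A^{k-i}$, $V_0=0$, $V_k=\mathbb C^N$, and let $W=\bigoplus_{i=0}^{k-1}\bigl(\operatorname{Hom}(V_i,V_{i+1})\oplus\operatorname{Hom}(V_{i+1},V_i)\bigr)$, with elements $(\alpha_i,\beta_i)_i$, $\alpha_i:V_i\to V_{i+1}$, $\beta_i:V_{i+1}\to V_i$, norm $r^2=\sum_{i=1}^{k-1}\operatorname{Tr}(\alpha_i^*\alpha_i+\beta_i\beta_i^*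 )$, $I$ being multiplication by $\sqrt{-1}$ and $J$ being $(\alpha_i,\beta_i)\mapsto(-\beta_i^*,\alpha_i^* )$. For $\mathfrak{sl}(n,\mathbb C)$ use $W$ with the natural action of $H=U(V_1)\times\dots\times U(V_{k-1})$. For $\mathfrak{so}(n,\mathbb C)$ (put $\delta=0$) or $\mathfrak{sp}(n,\mathbb C)$ (put $\delta=1$), equip each $V_i$ with a non-degenerate bilinear form $\omega_i$ with $\omega_i(X,Y)=(-1)^{k-i+\delta}\omega_i(Y,X)$, compatible with the Hermitian product on $V_i$ in the sense that in some orthonormal basis of $V_i$ the form $\omega_i$ has as matrix the identity (if $\omega_i$ is symmetric) or $\begin{pmatrix}0&\mathbf 1\\-\mathbf 1&0\end{pmatrix}$ (if $\omega_i$ is skew), and equal to the given form on $V_k$; let $\dagger$ denote adjoint with respect to the $\omega_i$; replace $W$ by its quaternionic subspace $W^+=\{\beta_i=\alpha_i^\dagger,\ i=1,\dots,k-1\}$ and $H$ by $\prod_{i=1}^{k-1}H_i$, $H_i=\{A\in U(V_i):A^\dagger A=\mathrm{Id}\}$. The zero set $\mu^{-1}(0)$ of the hyperKähler moment map is given by the equations, for $i=0,\dots,k-2$, $$\alpha_i\beta_i=\beta_{i+1}\alpha_{i+1},\qquad \alpha_i\alpha_i^*-\beta_i^*\beta_i+\beta_{i+1}\beta_{i+1}^*-\alpha_{i+1}^*\alpha_{i+1}=0 .$$ On the open subset of $\mu^{-1}(0)$ where all $\alpha_i$ are injective and all $\beta_i$ surjective, the map $\psi(\dots,\alpha_i,\beta_i,\dots)=\alpha_{k-1}\beta_{k-1}$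 induces a diffeomorphism from the quotient by $H$ onto the orbit of $A$ under $GL(n,\mathbb C)$, $O(n,\mathbb C)$ or $Sp(n,\mathbb C)$ respectively. The hyperKähler quotient structure transported to the orbit is the canonical hyperKähler structure, and its hyperKähler potential is the function induced by $r^2$: $\rho(X)=r^2(\alpha,\beta)$ for any point $(\alpha,\beta)$ of this subset with $\alpha_{k-1}\beta_{k-1}=X$. (When the adjoint orbit is only a connected component of this larger orbit, restrict.) *)

(* Defs.v *)
From HB Require Import structures.
From mathcomp Require Import all_boot all_order all_algebra.
From mathcomp Require Import complex.
From mathcomp Require Import classical_sets reals.

Set Implicit Arguments.
Unset Strict Implicit.
Unset Printing Implicit Defensive.

Import Order.TTheory GRing.Theory Num.Theory.

Local Open Scope ring_scope.
Local Open Scope complex_scope.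
Local Open Scope sesquilinear_scope.
Local Open Scope classical_set_scope.

(* Matrices act on column vectors: M : 'M_(m, n) is the map v |-> M *m v from
   C^n to C^m.  The Hermitian product on each C^n is the standard one, so the
   Hermitian adjoint of M is M ^t* . *)

Section Forms.
Variable R : realType.
Local Notation C := R[i].

(* The columns of U form an orthonormal basis of C^n. *)
Definition orthonormal_basis (n p : nat) (U : 'M[C]_(n, p)) : Prop :=
  U ^t* *m U = 1%:M /\ U *m U ^t* = 1%:M.

(* The bilinear form (u, v) |-> u^T *m F *m v is skew (skew = true) or
   symmetric (skew = false), and compatible with the Hermitian product. *)
Definition compatible_form (skew : bool) (n : nat) (F : 'M[C]_n) : Prop :=
  if skew then
    exists (m : nat) (U : 'M[C]_(n, m + m)),
      orthonormal_basis U /\ U^T *m F *m U = block_mx 0 1%:M (- 1%:M) 0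
  else
    exists U : 'M[C]_n, orthonormal_basis U /\ U^T *m F *m U = 1%:M.

(* Adjoint V -> U of a map a : U -> V with respect to forms P on U and Q on V:
   Q (a u, v) = P (u, dagger P Q a v). *)
Definition dagger (m n : nat) (P : 'M[C]_m) (Q : 'M[C]_n) (a : 'M[C]_(n, m)) :
  'M[C]_(m, n) := invmx P *m a^T *m Q.

End Forms.

Section Classical.
Variables (R : realType) (N : nat).
Local Notation C := R[i].

Inductive classical_type :=
  | Sl
  | So of 'M[C]_N
  | Sp of 'M[C]_N.

Implicit Types (g : classical_type) (X Y B : 'M[C]_N) (O : set 'M[C]_N).

Definition ambient_form g : Prop :=
  match g with
  | Sl => True
  | So F => compatible_form false F
  | Sp F => compatible_form true F
  end.

Definition complex_group g : set 'M[C]_N :=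
  match g with
  | Sl => [set B | \det B = 1]
  | So F => [set B | B^T *m F *m B = F /\ \det B = 1]
  | Sp F => [set B | B^T *m F *m B = F]
  end.

Definition complex_algebra g : set 'M[C]_N :=
  match g with
  | Sl => [set B | \tr B = 0]
  | So F | Sp F => [set B | B^T *m F + F *m B = 0]
  end.

(* Lie algebra of the compact group complex_group g `&` U(N). *)
Definition compact_algebra g : set 'M[C]_N :=
  [set B | complex_algebra g B /\ B ^t* = - B].

Definition lie_bracket X Y : 'M[C]_N := X *m Y - Y *m X.

Definition adjoint_orbit g X : set 'M[C]_N :=
  [set B *m X *m invmx B | B in complex_group g].

(* S is a real vector subspace of dimension d. *)
Definition real_dim (S : set 'M[C]_N) (d : nat) : Prop :=
  exists e : 'I_d -> 'M[C]_N,
    S = [set \sum_(i < d) (r i)%:C *: e i | r in [set: 'I_d -> R]] /\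
    forall r : 'I_d -> R, \sum_(i < d) (r i)%:C *: e i = 0 ->
      forall i, r i = 0.

(* For h the Lie algebra of a Lie group H, this is the tangent space at X of
   the adjoint orbit of X under H. *)
Definition orbit_tangent (h : set 'M[C]_N) X : set 'M[C]_N :=
  [set lie_bracket B X | B in h].

(* The orbit of X under the compact group has real codimension c in the orbit
   of X under the complex group. *)
Definition compact_orbit_codim g X (c : nat) : Prop :=
  exists dO dG : nat,
    [/\ real_dim (orbit_tangent (complex_algebra g) X) dO,
        real_dim (orbit_tangent (compact_algebra g) X) dG
      & dO = (dG + c)%N].

(* Generic orbits of the compact group are those of maximal dimension, that
   is, of minimal codimension in O. *)
Definition cohomogeneity g O (c : nat) : Prop :=
  (exists2 X, O X & compact_orbit_codim g X c) /\
  (forall X c', O X -> compact_orbit_codim g X c' -> (c <= c')%N).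

Definition nilpotency_degree X (k : nat) : Prop :=
  X ^+ k = 0 /\ X ^+ k.-1 <> 0.

Definition kappa g : R := if g is So _ then 2 else 1.

Definition c1 X : R := complex.Re (\tr (X *m X ^t*)).

Definition c2 X : R :=
  let Y := lie_bracket X (X ^t*) in complex.Re (\tr (Y *m Y ^t*)).

(* The spaces V_0 = 0, ..., V_k = C^N are numbered from the top: index j
   stands for V_(k - j), so that V_k is C^N by definition.  Consequently
   alpha j : V_(k-j-1) -> V_(k-j) is the map usually called alpha_(k-1-j),
   and beta j, in the opposite direction, is beta_(k-1-j). *)
Definition vdim (A : 'M[C]_N) (j : nat) : nat :=
  if j is 0%N then N else \rank (A ^+ j).

Section Quiver.
Variables (A : 'M[C]_N) (k : nat).

(* Only the indices j < k matter; when A ^+ k = 0 the spaces beyond are 0. *)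
Record quiver_rep := QuiverRep {
  alpha : forall j, 'M[C]_(vdim A j, vdim A j.+1);
  beta : forall j, 'M[C]_(vdim A j.+1, vdim A j)
}.

Implicit Types (p : quiver_rep) (W : forall j, 'M[C]_(vdim A j)).

(* W j is the matrix of the form on V_(k-j), whose sign is (-1)^(j + delta);
   there are no forms in the case of Sl. *)
Definition quiver_forms g W : Prop :=
  match g with
  | Sl => True
  | So F => W 0%N = F /\ forall j, (j <= k)%N -> compatible_form (odd j) (W j)
  | Sp F => W 0%N = F /\ forall j, (j <= k)%N -> compatible_form (~~ odd j) (W j)
  end.

(* The space W for Sl, and its subspace W^+ otherwise. *)
Definition flat_space g W : set quiver_rep :=
  match g with
  | Sl => [set: quiver_rep]
  | So _ | Sp _ =>
      [set p | forall j, (j.+1 < k)%N ->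
                 beta p j = dagger (W j.+1) (W j) (alpha p j)]
  end.

Definition moment_zero : set quiver_rep :=
  [set p | forall j, (j.+1 < k)%N ->
     alpha p j.+1 *m beta p j.+1 = beta p j *m alpha p j /\
     alpha p j.+1 *m (alpha p j.+1) ^t* - (beta p j.+1) ^t* *m beta p j.+1
       + beta p j *m (beta p j) ^t* - (alpha p j) ^t* *m alpha p j = 0].

Definition regular : set quiver_rep :=
  [set p | forall j, (j < k)%N ->
     injective (fun v : 'cV[C]_(vdim A j.+1) => alpha p j *m v) /\
     (forall w : 'cV[C]_(vdim A j.+1),
        exists v : 'cV[C]_(vdim A j), beta p j *m v = w)].

Definition psi p : 'M[C]_N := alpha p 0 *m beta p 0.

Definition norm_sq p : R :=
  complex.Re (\sum_(j < k.-1)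
    \tr ((alpha p j) ^t* *m alpha p j + beta p j *m (beta p j) ^t*)).

Definition hk_fibre g W (X : 'M[C]_N) : set quiver_rep :=
  [set p | [/\ flat_space g W p, moment_zero p, regular p & psi p = X]].

(* The hyperKaehler potential of the canonical structure on the orbit of A:
   the function induced on the quotient by norm_sq.  (Since psi identifies
   the orbit with the quotient by the isometry group H, norm_sq takes exactly
   one value on each fibre over the orbit.) *)
Definition hk_potential g W (X : 'M[C]_N) : R :=
  xget 0 [set norm_sq p | p in hk_fibre g W X].

End Quiver.
End Classical.

Arguments Sl {R N}.

(* Main.v *)
From HB Require Import structures.
Require Import Defs.
From mathcomp Require Import all_boot all_order all_algebra.
From mathcomp Require Import complex ring lra zify.
From mathcomp Require Import classical_sets reals.

(** Two things have to be known about an orbit of cohomogeneity two: that its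
    elements X are small, and what the squared norm r^2 is on the fibre over X.

    Smallness.  Let H be a Hermitian matrix of the complex Lie algebra g that
    is trace orthogonal to the centraliser of X.  Then [B, X] |-> Re tr(H B) is
    a well defined functional on the tangent space [g, X] of the complex orbit,
    and it kills the tangent space [k, X] of the compact orbit because k is
    skew Hermitian.  If the compact orbit has codimension c, such H therefore
    depend on at most c real parameters, and the matrices M of g orthogonal to
    the centraliser of X and to its adjoint on at most c complex ones
    (codim_functionals).  If X is too big, more than two parameters are found:
    X is put in normal form by the singular value, Takagi or Youla
    decomposition, and matrices m acting on its range are counted.  Diagonal m
    bound the rank (special_linear_rank_bound, diagonal_family_bound); other
    families show that X squares to zero in the extreme rank
    (special_linear_rank_two_sq0, orthogonal_rank_four_sq0).  In sl and sp this
    leaves rank at most 2 and X^2 = 0; in so it leaves rank at most 4 and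
    X^2 = 0, or else rank at most 2 (codim_two_type).  These bounds
    admit some smaller orbits too, and the formula holds on them as well.

    The norm when X^2 = 0.  Only a = alpha_(k-1) and b = beta_(k-1) survive,
    and the moment map equation b b^* = a^* a gives (a a^* )^2 = X X^* when
    a b = X.  Positive square roots being unique, r^2 is twice the sum of the
    singular values of X (two_step_norm).  For at most two numbers the sum
    is determined by the sums of the second and of the fourth powers
    (two_power_sums), which c_1 and c_2 are up to a factor.  In so the singular
    values come in equal pairs, which is where kappa = 2 comes from.

    The norm when X^2 <> 0.  Then g = so(N), X has rank 2 and k = 3.  The space
    V_(k-1) is a plane with a skew form, and on a plane the adjoint of M for a
    skew form is tr M - M.  This turns the moment map equations into
    a^* a = a_1 a_1^* + c, with a_1 = alpha_(k-2), so that r^2, c_1 and c_2 are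
    polynomials in the two numbers |a_1|^2 and c (three_step_traces), and
    the formula becomes an identity between them (three_step_norm).

    In each case the fibre has to be shown nonempty, for which the same normal
    forms provide explicit maps (form_two_step_fibre, three_step_data). *)

Set Implicit Arguments.
Unset Strict Implicit.
Unset Printing Implicit Defensive.

Import Order.TTheory GRing.Theory Num.Theory.

Local Open Scope ring_scope.
Local Open Scope sesquilinear_scope.

(** * Hermitian adjoints *)

Section Adjoint.
Variable C : numClosedFieldType.

Lemma adjointM m n p (A : 'M[C]_(m, n)) (B : 'M[C]_(n, p)) :
  (A *m B) ^t* = B ^t* *m A ^t*.
Proof. by rewrite trmx_mul map_mxM. Qed.

Lemma adjointD m n (A B : 'M[C]_(m, n)) : (A + B) ^t* = A ^t* + B ^t*.
Proof. by rewrite linearD /= map_mxD. Qed.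

Lemma adjointN m n (A : 'M[C]_(m, n)) : (- A) ^t* = - A ^t*.
Proof. by rewrite linearN /= map_mxN. Qed.

Lemma adjointB m n (A B : 'M[C]_(m, n)) : (A - B) ^t* = A ^t* - B ^t*.
Proof. by rewrite adjointD adjointN. Qed.

Lemma adjointZ m n (a : C) (A : 'M[C]_(m, n)) : (a *: A) ^t* = a^* *: A ^t*.
Proof. by rewrite linearZ /= map_mxZ. Qed.

Lemma adjoint0 m n : (0 : 'M[C]_(m, n)) ^t* = 0.
Proof. by rewrite trmx0 map_mx0. Qed.

Lemma adjoint1 n : (1%:M : 'M[C]_n) ^t* = 1%:M.
Proof. by rewrite trmx1 map_mx1. Qed.

Lemma adjoint_row_mx m n p (A : 'M[C]_(m, n)) (B : 'M[C]_(m, p)) :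
  (row_mx A B) ^t* = col_mx (A ^t*) (B ^t*).
Proof. by rewrite tr_row_mx map_col_mx. Qed.

Lemma adjoint_diag n (d : 'rV[C]_n) :
  (diag_mx d) ^t* = diag_mx (map_mx Num.conj d).
Proof. by rewrite tr_diag_mx map_diag_mx. Qed.

Lemma mxtrace_adjoint n (A : 'M[C]_n) : \tr (A ^t*) = (\tr A)^*.
Proof. by rewrite /mxtrace rmorph_sum /=; apply: eq_bigr => i _; rewrite !mxE. Qed.

Lemma mxtrace_gram m n (A : 'M[C]_(m, n)) :
  \tr (A ^t* *m A) = \sum_j \sum_i `|A i j| ^+ 2.
Proof.
apply: eq_bigr => j _; rewrite mxE; apply: eq_bigr => i _.
by rewrite !mxE normCK mulrC.
Qed.

Lemma mxtrace_gram_ge0 m n (A : 'M[C]_(m, n)) : 0 <= \tr (A ^t* *m A).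
Proof.
by rewrite mxtrace_gram; apply: sumr_ge0 => j _; apply: sumr_ge0 => i _;
  rewrite exprn_ge0.
Qed.

Lemma mxtrace_gram_eq0 m n (A : 'M[C]_(m, n)) : \tr (A ^t* *m A) = 0 -> A = 0.
Proof.
have ge0 j i : 0 <= `|A i j| ^+ 2 by rewrite exprn_ge0.
rewrite mxtrace_gram => /eqP; rewrite psumr_eq0; last first.
  by move=> j _; apply: sumr_ge0.
move=> /allP H; apply/matrixP => i j; rewrite mxE.
have /eqP := H j (mem_index_enum j).
move=> /eqP; rewrite /= psumr_eq0 // => /allP /(_ i (mem_index_enum i)) /=.
by rewrite expf_eq0 /= normr_eq0 => /eqP.
Qed.

Lemma gram_eq0 m n (A : 'M[C]_(m, n)) : A ^t* *m A = 0 -> A = 0.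
Proof. by move=> h; apply: mxtrace_gram_eq0; rewrite h mxtrace0. Qed.

End Adjoint.

(** * Singular values, Takagi and Youla normal forms *)

Section SingularValues.
Variable C : numClosedFieldType.

Lemma hermitian_eigenpair n (H : 'M[C]_n) : H ^t* = H -> H != 0 ->
  exists2 a : C, a != 0 & exists2 v : 'cV[C]_n, v ^t* *m v = 1%:M & H *m v = a *: v.
Proof.
move=> hH H0; have /orthomx_spectralP eH : H \is normalmx.
  by apply/normalmxP; rewrite hH.
set P := spectralmx H in eH; set d := spectral_diag H in eH.
have uP : P \is unitarymx by apply: spectral_unitarymx.
have /rV0Pn[i di] : d != 0.
  by apply: contra_neq H0 => d0; rewrite eH d0 linear0 mulmx0 mul0mx.
have PP : P *m P ^t* = 1%:M by apply/unitarymxP.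
exists (d 0 i) => //; exists ((row i P) ^t*).
  rewrite trmxCK rowE adjointM mulmxA -(mulmxA _ P) PP mulmx1.
  apply/matrixP => a b; rewrite !ord1 trmx_delta map_delta_mx mul_delta_mx.
  by rewrite !mxE !eqxx.
rewrite rowE adjointM eH invmx_unitary // -!mulmxA (mulmxA P) PP mul1mx.
rewrite scalemxAr; congr (_ *m _); apply/matrixP => a b.
rewrite mul_diag_mx !mxE; have [->//|ne] := eqVneq a i.
by rewrite /= andbF mulr0n conjC0 !mulr0.
Qed.

Definition unit_vec n (v : 'cV[C]_n) := v ^t* *m v = 1%:M.

Lemma unit_vec_neq0 n (v : 'cV[C]_n) : unit_vec v -> v != 0.
Proof.
rewrite /unit_vec => h; apply/eqP => v0; move/matrixP: h => /(_ 0 0).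
by rewrite v0 mulmx0 !mxE => /eqP; rewrite eq_sym oner_eq0.
Qed.

Lemma normalize_vec n (v : 'cV[C]_n) : v != 0 ->
  exists2 a : C, 0 < a & unit_vec (a *: v).
Proof.
move=> v0; pose t := \tr (v ^t* *m v).
have tgt : 0 < t.
  rewrite lt_def mxtrace_gram_ge0 andbT; apply: contra_neq v0.
  exact: mxtrace_gram_eq0.
exists (sqrtC t)^-1; first by rewrite invr_gt0 sqrtC_gt0.
rewrite /unit_vec adjointZ -scalemxAl -scalemxAr scalerA.
have -> : v ^t* *m v = t%:M by rewrite /t [v ^t* *m v]mx11_scalar mxtrace_scalar.
rewrite -mul_scalar_mx -scalar_mxM; congr (_%:M).
rewrite geC0_conj ?invr_ge0 ?sqrtC_ge0 ?ltW // -expr2 exprVn sqrtCK mulVf //.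
by rewrite gt_eqF.
Qed.

(** An eigenvector of T^* T for a nonzero eigenvalue, which exists by the
    spectral theorem, gives the pair of singular vectors. *)
Lemma singular_triple m n (T : 'M[C]_(m, n)) : T != 0 ->
  exists (s : C) (u : 'cV[C]_m) (v : 'cV[C]_n),
    [/\ 0 < s, unit_vec u, unit_vec v, T *m v = s *: u & T ^t* *m u = s *: v].
Proof.
move=> T0.
have [||a a0 [v hv eHv]] := @hermitian_eigenpair _ (T ^t* *m T).
- by rewrite adjointM trmxCK.
- by apply: contra_neq T0 => /gram_eq0.
have Tv0 : T *m v != 0.
  apply/eqP => h; move: eHv; rewrite -mulmxA h mulmx0 => /esym/eqP.
  by rewrite scaler_eq0 (negPf a0) (negPf (unit_vec_neq0 hv)).
have [b b0 hb] := normalize_vec Tv0.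
have ab : b ^+ 2 * a = 1.
  move: hb; rewrite /unit_vec adjointZ -scalemxAl -scalemxAr scalerA.
  rewrite adjointM -mulmxA [T ^t* *m _]mulmxA eHv -scalemxAr hv scalerA.
  rewrite geC0_conj ?ltW // -expr2 => /matrixP/(_ 0 0).
  by rewrite !mxE mulr1.
have b0' : b != 0 by rewrite gt_eqF.
exists b^-1, (b *: (T *m v)), v; split => //; first by rewrite invr_gt0.
  by rewrite scalerA mulVf // scale1r.
rewrite -scalemxAr mulmxA eHv scalerA; congr (_ *: _).
by apply: (mulfI b0'); rewrite mulfV // mulrA -expr2.
Qed.

End SingularValues.

Notation "M ^c" := (map_mx Num.conj M) : ring_scope.

Section Decompositions.
Variable C : numClosedFieldType.

Definition positive_row n (d : 'rV[C]_n) := forall i, 0 < d 0 i.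
Definition isometry_mx m n (P : 'M[C]_(m, n)) := P ^t* *m P = 1%:M.

Lemma adjointC m n (A : 'M[C]_(m, n)) : (A^c) ^t* = A^T.
Proof. by rewrite map_trmx map_mxCK. Qed.

Lemma conj_adjoint m n (A : 'M[C]_(m, n)) : (A ^t*)^c = A^T.
Proof. by rewrite map_mxCK. Qed.

Lemma isometry_conj m n (P : 'M[C]_(m, n)) : isometry_mx P -> P^T *m P^c = 1%:M.
Proof.
by move=> h; rewrite -[P^T]conj_adjoint -map_mxM h map_mx1.
Qed.

Lemma diag_unit n (d : 'rV[C]_n) : positive_row d -> diag_mx d \in unitmx.
Proof.
move=> d0; rewrite unitmxE det_diag unitfE; apply/prodf_neq0 => i _.
by rewrite gt_eqF.
Qed.

Lemma deflation_rank m n (T T' : 'M[C]_(m, n)) (v : 'cV[C]_n) :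
  (T' <= T)%MS -> T *m v != 0 -> T' *m v = 0 -> (\rank T' < \rank T)%N.
Proof.
move=> sub Tv T'v; rewrite ltn_neqAle mxrankS // andbT.
rewrite (mxrank_leqif_sup sub); apply: contra Tv => /submxP[K ->].
by rewrite -mulmxA T'v mulmx0.
Qed.

Lemma positive_row_mx n (s : C) (d : 'rV[C]_n) : 0 < s -> positive_row d ->
  positive_row (row_mx s%:M d).
Proof.
move=> s0 d0 k; rewrite -[k]splitK; case: split => j /=.
  by rewrite row_mxEl !ord1 mxE eqxx.
by rewrite row_mxEr.
Qed.

Lemma isometry_row_mx m n p (P : 'M[C]_(m, n)) (Q : 'M[C]_(m, p)) :
  isometry_mx P -> isometry_mx Q -> P ^t* *m Q = 0 -> isometry_mx (row_mx P Q).
Proof.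
rewrite /isometry_mx => hP hQ hPQ; rewrite adjoint_row_mx mul_col_row hP hQ hPQ.
by rewrite -[Q ^t* *m P]trmxCK adjointM trmxCK hPQ adjoint0 -scalar_mx_block.
Qed.

Lemma isometry_row_mxP m n p (P : 'M[C]_(m, n)) (Q : 'M[C]_(m, p)) :
  isometry_mx (row_mx P Q) -> [/\ isometry_mx P, isometry_mx Q & P ^t* *m Q = 0].
Proof.
by rewrite /isometry_mx adjoint_row_mx mul_col_row scalar_mx_block => /eq_block_mx[].
Qed.

Lemma diag_row_mx11 n (s : C) (d : 'rV[C]_n) :
  diag_mx (row_mx s%:M d) = block_mx s%:M 0 0 (diag_mx d).
Proof.
rewrite diag_mx_row; congr block_mx; apply/matrixP => i j.
by rewrite !ord1 !mxE.
Qed.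

(** Subtracting the rank one matrix of a singular triple lowers the rank, and
    what is left is orthogonal to the triple on both sides.  Only nonzero
    singular values occur, so r is the rank of T. *)
Lemma svd m n (T : 'M[C]_(m, n)) :
  exists r (P : 'M[C]_(m, r)) (Q : 'M[C]_(n, r)) (d : 'rV[C]_r),
    [/\ isometry_mx P, isometry_mx Q, positive_row d & T = P *m diag_mx d *m Q ^t*].
Proof.
have [k] := ubnP (\rank T); elim: k T => // k IH T lek.
have [-> | T0] := eqVneq T 0.
  exists 0%N, 0, 0, 0; split; last by rewrite !mul0mx.
  - by apply/matrixP => -[].
  - by apply/matrixP => -[].
  - by case.
have [s [u [v [s0 hu hv Tv Tu]]]] := singular_triple T0.
pose T' := T - s *: (u *m v ^t*).
have uT : u ^t* *m T = s *: v ^t*.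
  rewrite -[T in LHS]trmxCK -adjointM Tu adjointZ geC0_conj ?ltW //.
have T'v : T' *m v = 0.
  by rewrite mulmxBl Tv -scalemxAl -mulmxA hv mulmx1 subrr.
have uT' : u ^t* *m T' = 0.
  by rewrite mulmxBr uT -scalemxAr mulmxA hu mul1mx subrr.
have lt : (\rank T' < k)%N.
  move: lek; rewrite ltnS; apply: leq_trans; apply: (@deflation_rank _ _ _ _ v) => //.
  - rewrite addmx_sub ?submx_refl // -scaleN1r scalemx_sub // scalemxAr -uT mulmxA.
    exact: submxMl.
  - by rewrite Tv scaler_eq0 negb_or (unit_vec_neq0 hu) gt_eqF.
have [r [P [Q [d [hP hQ d0 eT']]]]] := IH _ lt.
have du := diag_unit d0.
have uP : u ^t* *m P = 0.
  have -> : P = T' *m Q *m invmx (diag_mx d).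
    by rewrite eT' -(mulmxA _ (Q ^t*)) hQ mulmx1 mulmxK.
  by rewrite !mulmxA uT' !mul0mx.
have vQ : v ^t* *m Q = 0.
  have -> : Q = T' ^t* *m P *m invmx (diag_mx d) ^t*.
    rewrite eT' !adjointM trmxCK -!mulmxA (mulmxA _ P) hP mul1mx.
    by rewrite -adjointM mulVmx // adjoint1 mulmx1.
  by rewrite !mulmxA -adjointM T'v adjoint0 !mul0mx.
exists (1 + r)%N, (row_mx u P), (row_mx v Q), (row_mx s%:M d); split.
- exact: isometry_row_mx.
- exact: isometry_row_mx.
- exact: positive_row_mx.
rewrite diag_row_mx11 mul_row_block !mulmx0 addr0 add0r adjoint_row_mx mul_row_col.
by rewrite -eT' mul_mx_scalar -scalemxAl addrC subrK.
Qed.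

(** The antilinear map w |-> T w^c exchanges the vectors u and v^c of a
    singular pair, up to the factor s, so it has the eigenvector u + v^c,
    unless this vanishes, and then 'i u is one. *)
Lemma takagi_vec n (T : 'M[C]_n) : T^T = T -> T != 0 ->
  exists (s : C) (w : 'cV[C]_n), [/\ 0 < s, unit_vec w & T *m w^c = s *: w].
Proof.
move=> sT T0; have [s [u [v [s0 hu hv Tv Tu]]]] := singular_triple T0.
have Tuc : T *m u^c = s *: v^c.
  have : (T ^t* *m u)^c = (s *: v)^c by rewrite Tu.
  by rewrite map_mxM map_mxCK sT map_mxZ /= geC0_conj ?ltW.
suff [y y0 hy] : exists2 y : 'cV[C]_n, y != 0 & T *m y^c = s *: y.
  have [a a0 ha] := normalize_vec y0; exists s, (a *: y); split=> //.
  by rewrite map_mxZ /= geC0_conj ?ltW // -scalemxAr hy !scalerA mulrC.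
have [e | ne] := eqVneq (u + v^c) 0; last first.
  exists (u + v^c) => //.
  by rewrite map_mxD map_mxCK mulmxDr Tuc Tv -scalerDr addrC.
exists ('i *: u).
  by rewrite scaler_eq0 negb_or neq0Ci (unit_vec_neq0 hu).
have vu : v^c = - u by apply/eqP; rewrite -addr_eq0 addrC e.
rewrite map_mxZ /= conjCi -scalemxAr Tuc vu !scalerA scalerN mulNr scaleNr opprK.
by rewrite mulrC.
Qed.

(** Normal form of symmetric matrices under unitary congruence, by the
    deflation used for singular values but with the eigenvectors of w |-> T
    w^c. *)
Lemma takagi n (T : 'M[C]_n) : T^T = T ->
  exists r (P : 'M[C]_(n, r)) (d : 'rV[C]_r),
    [/\ isometry_mx P, positive_row d & T = P *m diag_mx d *m P^T].
Proof.
have [k] := ubnP (\rank T); elim: k T => // k IH T lek sT.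
have [-> | T0] := eqVneq T 0.
  exists 0%N, 0, 0; split; last by rewrite !mul0mx.
  - by apply/matrixP => -[].
  - by case.
have [s [w [s0 hw Tw]]] := takagi_vec sT T0.
pose T' := T - s *: (w *m w^T).
have sT' : T'^T = T' by rewrite linearB /= linearZ /= trmx_mul trmxK sT.
have wT' : w^T *m w^c = 1%:M by apply: isometry_conj.
have T'w : T' *m w^c = 0.
  by rewrite mulmxBl Tw -scalemxAl -mulmxA wT' mulmx1 subrr.
have lt : (\rank T' < k)%N.
  move: lek; rewrite ltnS; apply: leq_trans; apply: (@deflation_rank _ _ _ _ (w^c)) => //.
  - rewrite addmx_sub ?submx_refl // -scaleN1r scalemx_sub //.
    have -> : s *: (w *m w^T) = w *m (w ^t* *m T).
      rewrite scalemxAr; congr (_ *m _); apply: trmx_inj.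
      by rewrite trmx_mul sT linearZ /= trmxK -Tw map_trmx trmxK.
    by rewrite mulmxA submxMl.
  - by rewrite Tw scaler_eq0 negb_or (unit_vec_neq0 hw) gt_eqF.
have [r [P [d [hP d0 eT']]]] := IH _ lt sT'.
have du := diag_unit d0.
have wP : w ^t* *m P = 0.
  have -> : P = T' *m P^c *m invmx (diag_mx d).
    by rewrite eT' -!mulmxA (mulmxA P^T) isometry_conj // mul1mx mulmxV // mulmx1.
  have : w ^t* *m T' = 0.
    by apply: trmx_inj; rewrite trmx_mul sT' map_trmx trmxK T'w trmx0.
  by rewrite !mulmxA => ->; rewrite !mul0mx.
exists (1 + r)%N, (row_mx w P), (row_mx s%:M d); split.
- exact: isometry_row_mx.
- exact: positive_row_mx.
rewrite diag_row_mx11 mul_row_block !mulmx0 addr0 add0r tr_row_mx mul_row_col.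
by rewrite -eT' mul_mx_scalar -scalemxAl addrC subrK.
Qed.

Lemma antisym_mx11 (A : 'M[C]_1) : A^T = - A -> A = 0.
Proof.
move=> /matrixP/(_ 0 0); rewrite !mxE => /eqP; rewrite -addr_eq0 -mulr2n.
by rewrite mulrn_eq0 /= => /eqP e; apply/matrixP => i j; rewrite !ord1 e mxE.
Qed.

Lemma antisym_quadric n (T : 'M[C]_n) (x : 'cV[C]_n) : T^T = - T ->
  x^T *m T *m x = 0.
Proof.
move=> aT; apply: antisym_mx11.
by rewrite !trmx_mul trmxK aT mulNmx mulmxN mulmxA.
Qed.

(** For antisymmetric T the two singular vectors of a triple, one of them
    conjugated, are orthogonal because the quadratic form of T vanishes; so
    they span a plane. *)
Lemma youla_vec n (T : 'M[C]_n) : T^T = - T -> T != 0 ->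
  exists (s : C) (u w : 'cV[C]_n),
    [/\ 0 < s, isometry_mx (row_mx u w), T *m w^c = - (s *: u) & T *m u^c = s *: w].
Proof.
move=> aT T0; have [s [w [v [s0 hw hv Tv Tw]]]] := singular_triple T0.
have sN0 : s != 0 by rewrite gt_eqF.
have hvc : isometry_mx v^c by rewrite /isometry_mx adjointC isometry_conj.
exists s, v^c, w; split; rewrite ?map_mxCK //.
  apply: isometry_row_mx => //; rewrite adjointC; apply: (scalerI sN0).
  by rewrite scaler0 scalemxAr -Tv mulmxA antisym_quadric.
have : (T ^t* *m w)^c = (s *: v)^c by rewrite Tw.
rewrite map_mxM map_mxCK aT map_mxZ /= geC0_conj ?ltW // mulNmx.
by move=> <-; rewrite opprK.
Qed.

(** Normal form of antisymmetric matrices under unitary congruence, by removing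
    the planes of youla_vec one by one. *)
Lemma youla n (T : 'M[C]_n) : T^T = - T ->
  exists r (U W : 'M[C]_(n, r)) (d : 'rV[C]_r),
    [/\ isometry_mx (row_mx U W), positive_row d &
        T = W *m diag_mx d *m U^T - U *m diag_mx d *m W^T].
Proof.
have [k] := ubnP (\rank T); elim: k T => // k IH T lek aT.
have [-> | T0] := eqVneq T 0.
  exists 0%N, 0, 0, 0; split; last by rewrite !mul0mx subrr.
  - by apply/matrixP => -[].
  - by case.
have [s [u [w [s0 huw Tw Tu]]]] := youla_vec aT T0.
have [hu hw uw] := isometry_row_mxP huw.
have wu : w ^t* *m u = 0 by rewrite -[u]trmxCK -adjointM uw adjoint0.
have sN0 : s != 0 by rewrite gt_eqF.
pose T' := T - s *: (w *m u^T - u *m w^T).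
have aT' : T'^T = - T'.
  rewrite /T' linearB /= linearZ /= linearB /= !trmx_mul !trmxK aT.
  by rewrite -[in LHS]scalerN !opprB addrC.
have trc (x y : 'cV[C]_n) : x ^t* *m y = 0 -> y^T *m x^c = 0.
  by move=> h; apply: trmx_inj; rewrite trmx_mul trmxK map_trmx h trmx0.
have T'w : T' *m w^c = 0.
  rewrite mulmxBl Tw -scalemxAl mulmxBl -!mulmxA (isometry_conj hw).
  by rewrite (trc _ _ wu) mulmx0 mulmx1 sub0r scalerN subrr.
have T'u : T' *m u^c = 0.
  rewrite mulmxBl Tu -scalemxAl mulmxBl -!mulmxA (isometry_conj hu).
  by rewrite (trc _ _ uw) mulmx0 mulmx1 subr0 subrr.
have adjT' (x : 'cV[C]_n) : T' *m x^c = 0 -> x ^t* *m T' = 0.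
  move=> h; apply: trmx_inj; rewrite trmx_mul aT' map_trmx trmxK mulNmx h.
  by rewrite oppr0 trmx0.
have lt : (\rank T' < k)%N.
  move: lek; rewrite ltnS; apply: leq_trans; apply: (@deflation_rank _ _ _ _ (w^c)) => //.
    have uT : s *: u^T = w ^t* *m T.
      apply: trmx_inj; rewrite trmx_mul aT linearZ /= trmxK map_trmx trmxK.
      by rewrite mulNmx Tw opprK.
    have wT : - (s *: w^T) = u ^t* *m T.
      apply: trmx_inj; rewrite trmx_mul aT linearN linearZ /= trmxK map_trmx trmxK.
      by rewrite mulNmx Tu.
    rewrite addmx_sub ?submx_refl // -scaleN1r scalemx_sub // scalerBr.
    rewrite !scalemxAr uT -mulmxN wT !mulmxA -mulmxDl submxMl //.
  by rewrite Tw oppr_eq0 scaler_eq0 negb_or (unit_vec_neq0 hu) gt_eqF.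
have [r [U [W [d [hUW d0 eT']]]]] := IH _ lt aT'.
have [hU hW UW] := isometry_row_mxP hUW.
have WU : W ^t* *m U = 0 by rewrite -[U]trmxCK -adjointM UW adjoint0.
have du := diag_unit d0.
have eW : W = T' *m U^c *m invmx (diag_mx d).
  rewrite eT' mulmxBl -[_ *m U^T *m U^c]mulmxA isometry_conj //.
  rewrite -[_ *m W^T *m U^c]mulmxA -[W^T]conj_adjoint -map_mxM WU map_mx0 mulmx0.
  by rewrite subr0 mulmx1 mulmxK.
have eU : U = - (T' *m W^c *m invmx (diag_mx d)).
  rewrite eT' mulmxBl -[_ *m W^T *m W^c]mulmxA isometry_conj //.
  rewrite -[_ *m U^T *m W^c]mulmxA -[U^T]conj_adjoint -map_mxM UW map_mx0 mulmx0.
  by rewrite sub0r mulNmx opprK mulmx1 mulmxK.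
have perp (x : 'cV[C]_n) : T' *m x^c = 0 -> x ^t* *m W = 0 /\ x ^t* *m U = 0.
  move=> /adjT' h; rewrite eW eU mulmxN !mulmxA h !mul0mx oppr0.
  by split.
have [wW wU] := perp w T'w; have [uW uU] := perp u T'u.
exists (1 + r)%N, (row_mx u U), (row_mx w W), (row_mx s%:M d); split.
- apply: isometry_row_mx; try exact: isometry_row_mx.
  rewrite adjoint_row_mx mul_col_row uw uW UW -[U ^t* *m w]trmxCK adjointM trmxCK.
  by rewrite wU adjoint0 block_mx0.
- exact: positive_row_mx.
rewrite diag_row_mx11 !mul_row_block !mulmx0 !addr0 !add0r !tr_row_mx !mul_row_col.
by rewrite !mul_mx_scalar -!scalemxAl opprD addrACA -eT' -scalerBr addrC subrK.
Qed.

End Decompositions.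

Section SkewUnit.
Variable C : numClosedFieldType.

(** The matrix of the standard symplectic form. *)
Definition skew_unit m : 'M[C]_(m + m) := block_mx 0 1%:M (- 1%:M) 0.

Lemma tr_skew_unit m : (skew_unit m)^T = - skew_unit m.
Proof.
by rewrite tr_block_mx opp_block_mx !trmx0 linearN /= trmx1 !oppr0 opprK.
Qed.

Lemma skew_unit_sq m : skew_unit m *m skew_unit m = - 1%:M.
Proof.
rewrite mulmx_block !mul0mx !mulmx0 !mulmxN !mul1mx !mulmx1 !add0r !addr0.
by rewrite [in RHS]scalar_mx_block opp_block_mx !oppr0.
Qed.

Lemma adjoint_skew_unit m : (skew_unit m) ^t* = - skew_unit m.
Proof.
rewrite tr_skew_unit map_mxN map_block_mx !map_mx0 map_mxN map_mx1.
by [].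
Qed.

End SkewUnit.

Lemma adjoint_positive_diag (C : numClosedFieldType) r (d : 'rV[C]_r) : positive_row d ->
  (diag_mx d) ^t* = diag_mx d.
Proof.
move=> d0; rewrite adjoint_diag; congr diag_mx; apply/rowP => i.
by rewrite mxE geC0_conj // ltW.
Qed.

Lemma diag_sqrt (C : numClosedFieldType) r (d : 'rV[C]_r) : positive_row d ->
  exists2 s, positive_row s & diag_mx d = diag_mx s *m diag_mx s.
Proof.
move=> d0; exists (map_mx sqrtC d); first by move=> i; rewrite mxE sqrtC_gt0.
by rewrite mulmx_diag; congr diag_mx; apply/rowP => i; rewrite !mxE -expr2 sqrtCK.
Qed.

(** * Square roots, linear systems and nilpotent matrices *)

Section LinearAlgebra.
Variable C : numClosedFieldType.

(** For E = S - T one has E S + T E = 0, and the traces of E S E and of E T E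
    are nonnegative with sum zero; so S and T both kill E. *)
Lemma psd_sqrt_unique n p q (a : 'M[C]_(n, p)) (b : 'M[C]_(n, q)) :
  let S := a *m a ^t* in let T := b *m b ^t* in S *m S = T *m T -> S = T.
Proof.
move=> S T h; pose E := S - T.
have hE : E ^t* = E by rewrite adjointB !adjointM !trmxCK.
have e0 : E *m S + T *m E = 0.
  by rewrite mulmxBl mulmxBr h addrA subrK subrr.
have eS : \tr (E *m S *m E) = \tr ((a ^t* *m E) ^t* *m (a ^t* *m E)).
  by rewrite adjointM trmxCK hE !mulmxA.
have eT : \tr (E *m T *m E) = \tr ((b ^t* *m E) ^t* *m (b ^t* *m E)).
  by rewrite adjointM trmxCK hE !mulmxA.
have : \tr (E *m S *m E) + \tr (E *m T *m E) = 0.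
  rewrite [\tr (E *m S *m E)]mxtrace_mulC -[E *m T *m E]mulmxA.
  by rewrite -mxtraceD -mulmxDr e0 mulmx0 mxtrace0.
move=> /eqP; rewrite eS eT paddr_eq0 ?mxtrace_gram_ge0 // => /andP[/eqP hS /eqP hT].
have SE : S *m E = 0 by rewrite -mulmxA (mxtrace_gram_eq0 hS) mulmx0.
have TE : T *m E = 0 by rewrite -mulmxA (mxtrace_gram_eq0 hT) mulmx0.
apply/eqP; rewrite -subr_eq0 -/E; apply/eqP/gram_eq0.
by rewrite hE mulmxBl SE TE subrr.
Qed.

(** Every family of normal directions is obtained by counting unknowns against
    linear equations. *)
Lemma nontrivial_solution (V W : vectType C) (f : V -> W) :
  linear f -> (dim W < dim V)%N -> exists2 v, v != 0 & f v = 0.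
Proof.
move=> lf lt; pose fL := GRing.isLinear.Build C V W *:%R f lf.
pose g : {linear V -> W} := HB.pack f fL; pose h := linfun g.
have : (lker h != 0)%VS.
  apply/eqP => h0; have := limg_ker_dim h fullv.
  rewrite h0 capv0 dimv0 add0n => e.
  move: lt; rewrite -!dimvf -e ltnNge => /negP; apply.
  by rewrite dimvS ?subvf.
move=> hk; exists (vpick (lker h)); first by rewrite vpick0.
by have := memv_pick (lker h); rewrite memv_ker lfunE => /eqP.
Qed.

(** On an eigenspace of M with nonzero eigenvalue, X is nilpotent, and
    injective since M vanishes on the kernel of X. *)
Lemma commuting_eigenvector n (X M : 'M[C]_n) (k : nat) (p : 'cV[C]_n) (t : C) :
  X ^+ k = 0 -> M *m X = X *m M -> (forall v : 'cV[C]_n, X *m v = 0 -> M *m v = 0) ->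
  M *m p = t *: p -> t != 0 -> p = 0.
Proof.
move=> Xk cM ker Mp t0.
suff H j : X ^+ j *m p = 0 -> p = 0 by apply: (H k); rewrite Xk mul0mx.
elim: j p Mp => [|j IH] q Mq; first by rewrite expr0 mul1mx.
rewrite exprSr -mulmxA => h; have : X *m q = 0.
  by apply: IH h; rewrite mulmxA cM -mulmxA Mq scalemxAr.
by move=> /ker; rewrite Mq => /eqP; rewrite scaler_eq0 (negPf t0) => /eqP.
Qed.

End LinearAlgebra.

Lemma mulmx_expS (C : pzRingType) n (A : 'M[C]_n) k : A ^+ k.+1 = A ^+ k *m A.
Proof. by rewrite exprSr. Qed.

Section Nilpotent.
Variable C : numClosedFieldType.

Lemma compress_nilpotent n r k (X : 'M[C]_n) (Q : 'M[C]_(n, r)) (M : 'M[C]_r) :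
  isometry_mx Q -> X *m Q = Q *m M -> X ^+ k = 0 -> M ^+ k = 0.
Proof.
move=> hQ XQ Xk; have h j : X ^+ j *m Q = Q *m M ^+ j.
  elim: j => [|j IH]; first by rewrite !expr0 mul1mx mulmx1.
  by rewrite !mulmx_expS -mulmxA XQ mulmxA IH -mulmxA.
have := h k; rewrite Xk mul0mx => /(congr1 (mulmx (Q ^t*))).
by rewrite mulmx0 mulmxA hQ mul1mx.
Qed.

Lemma nilpotent_not_unit n k (M : 'M[C]_n.+1) : M ^+ k = 0 -> M \notin unitmx.
Proof. by move=> Mk; apply/negP => uM; have := unitrX k uM; rewrite Mk unitr0. Qed.

End Nilpotent.

Local Open Scope complex_scope.
Local Open Scope sesquilinear_scope.

(** * Compact codimension and normal directions *)

Section RealPart.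
Variable R : realType.
Implicit Types z w : R[i].

Lemma ReD z w : complex.Re (z + w) = complex.Re z + complex.Re w.
Proof. by case: z => a b; case: w. Qed.

Lemma ReZ (r : R) z : complex.Re (r%:C * z) = r * complex.Re z.
Proof. by case: z => a b /=; rewrite mul0r subr0. Qed.

Lemma Re_sum I (s : seq I) (F : I -> R[i]) :
  complex.Re (\sum_(i <- s) F i) = \sum_(i <- s) complex.Re (F i).
Proof. exact: (big_morph (@complex.Re R) ReD). Qed.

Lemma Re_conj z : complex.Re z^* = complex.Re z.
Proof. by case: z. Qed.

Lemma Re_eq0_sum z : z + z^* = 0 -> complex.Re z = 0.
Proof.
move=> /(congr1 (@complex.Re R)); rewrite ReD Re_conj /= => /eqP.
by rewrite -mulr2n mulrn_eq0 /= => /eqP.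
Qed.

Lemma Re_ge0_eq0 z : 0 <= z -> complex.Re z = 0 -> z = 0.
Proof. by move=> /ger0_Im; case: z => a b /= -> ->. Qed.
End RealPart.

(** The adjoint of Z satisfies the conjugate transposed equation, with F
    replaced by plus or minus its inverse. *)
Lemma adjoint_form_algebra (C : numClosedFieldType) N (F Z : 'M[C]_N) :
  F^T = F \/ F^T = - F -> F *m F ^t* = 1%:M ->
  Z^T *m F + F *m Z = 0 -> (Z ^t*)^T *m F + F *m Z ^t* = 0.
Proof.
move=> sF FF hZ; have FF' : F ^t* *m F = 1%:M by apply: mulmx1C.
have eFc : F ^t* = F^c \/ F ^t* = - F^c.
  by case: sF => ->; [left | right; rewrite map_mxN].
have : (Z^T *m F + F *m Z)^c = 0 by rewrite hZ map_mx0.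
rewrite map_mxD !map_mxM => h.
have {}h : Z ^t* *m F ^t* + F ^t* *m Z^c = 0.
  by case: eFc => -> //; rewrite mulmxN mulNmx -opprD h oppr0.
have := congr1 (fun A => F *m A *m F) h.
rewrite mulmxDr mulmxDl !mulmxA FF mul1mx -!mulmxA FF' mulmx1 mul0mx mulmx0.
by rewrite map_trmx trmxK addrC.
Qed.

Section Forms.
Variables (R : realType) (N : nat).
Local Notation C := R[i].
Implicit Types (F X Z B : 'M[C]_N) (g : classical_type R N).

Lemma compatible_formE (skew : bool) n (F : 'M[C]_n) : compatible_form skew F ->
  [/\ F^T = (-1) ^+ skew *: F, F ^t* *m F = 1%:M & F *m F ^t* = 1%:M].
Proof.
have mk m (U : 'M[C]_(n, m)) (K : 'M[C]_m) : orthonormal_basis U -> 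
   U^T *m F *m U = K -> K^T = (-1) ^+ skew *: K -> K ^t* *m K = 1%:M ->
   [/\ F^T = (-1) ^+ skew *: F, F ^t* *m F = 1%:M & F *m F ^t* = 1%:M].
  move=> [U1 U2] eK sK uK.
  have U2c : U^c *m U^T = 1%:M by rewrite -[U^T]conj_adjoint -map_mxM U2 map_mx1.
  have U1c : U^T *m U^c = 1%:M by rewrite -[U^T]conj_adjoint -map_mxM U1 map_mx1.
  have eF : F = U^c *m K *m U ^t*.
    by rewrite -eK !mulmxA U2c mul1mx -mulmxA U2 mulmx1.
  have FF : F ^t* *m F = 1%:M.
    rewrite eF !adjointM trmxCK adjointC -!mulmxA (mulmxA U^T) U1c mul1mx.
    by rewrite (mulmxA _ K) uK mul1mx U2.
  split=> //; last exact: mulmx1C.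
  rewrite [in LHS]eF !trmx_mul map_trmx trmxK sK -scalemxAl -scalemxAr.
  by rewrite [in RHS]eF mulmxA map_trmx.
case: skew mk => mk [m].
  move=> [U [hU eK]]; apply: (mk _ U _ hU eK).
    by rewrite [LHS]tr_skew_unit expr1 scaleN1r.
  by rewrite [_ ^t*]adjoint_skew_unit mulNmx [_ *m _]skew_unit_sq opprK.
move=> [hU eK]; apply: (mk _ m _ hU eK); rewrite ?expr0 ?scale1r ?trmx1 //.
by rewrite map_mx1 mulmx1.
Qed.

(** Symmetric and skew forms are treated together wherever the sign does not
    matter. *)
Definition form_of g : option 'M[C]_N :=
  match g with Sl => None | So F | Sp F => Some F end.

Lemma ambient_formE g F : ambient_form g -> form_of g = Some F ->
  [/\ F^T = F \/ F^T = - F, F ^t* *m F = 1%:M & F *m F ^t* = 1%:M].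
Proof.
case: g => // G /compatible_formE[sF h1 h2] [<-]; split=> //.
  by left; rewrite sF expr0 scale1r.
by right; rewrite sF expr1 scaleN1r.
Qed.

Section AlgebraClosure.
Variables (g : classical_type R N) (Hg : ambient_form g).

Lemma complex_algebraD B Z : complex_algebra g B -> complex_algebra g Z ->
  complex_algebra g (B + Z).
Proof.
case: g => [|F|F] /= h1 h2; first by rewrite mxtraceD h1 h2 addr0.
  by rewrite linearD /= mulmxDl mulmxDr addrACA h1 h2 addr0.
by rewrite linearD /= mulmxDl mulmxDr addrACA h1 h2 addr0.
Qed.

Lemma complex_algebraZ (a : C) B : complex_algebra g B ->
  complex_algebra g (a *: B).
Proof.
case: g => [|F|F] /= h; first by rewrite mxtraceZ h mulr0.
  by rewrite linearZ /= -scalemxAl -scalemxAr -scalerDr h scaler0.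
by rewrite linearZ /= -scalemxAl -scalemxAr -scalerDr h scaler0.
Qed.

Lemma complex_algebra0 : complex_algebra g 0.
Proof. by case: g => [|F|F] /=; rewrite ?mxtrace0 // trmx0 mul0mx mulmx0 addr0. Qed.

Lemma complex_algebra_sum n (r : 'I_n -> C) (B : 'I_n -> 'M[C]_N) :
  (forall i, complex_algebra g (B i)) -> complex_algebra g (\sum_i r i *: B i).
Proof.
move=> h; elim/big_ind: _ => [|x y|i _]; first exact: complex_algebra0.
  exact: complex_algebraD.
exact: complex_algebraZ.
Qed.

Lemma complex_algebra_adjoint B : complex_algebra g B -> complex_algebra g (B ^t*).
Proof.
case: g Hg => [|F|F] hg /= h.
- by rewrite mxtrace_adjoint h conjC0.
- have [sF _ FF] := @ambient_formE (So F) F hg erefl.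
  exact: adjoint_form_algebra.
- have [sF _ FF] := @ambient_formE (Sp F) F hg erefl.
  exact: adjoint_form_algebra.
Qed.

End AlgebraClosure.

Lemma lie_bracketBl B1 B2 X :
  lie_bracket (B1 - B2) X = lie_bracket B1 X - lie_bracket B2 X.
Proof.
rewrite /lie_bracket mulmxBl mulmxBr !opprB addrACA [RHS]addrACA.
by congr (_ + _); rewrite addrC.
Qed.

Lemma lie_bracket_sum n (r : 'I_n -> C) (B : 'I_n -> 'M[C]_N) X :
  lie_bracket (\sum_i r i *: B i) X = \sum_i r i *: lie_bracket (B i) X.
Proof.
rewrite /lie_bracket mulmx_suml mulmx_sumr -sumrB; apply: eq_bigr => i _.
by rewrite -scalemxAl -scalemxAr scalerBr.
Qed.

Section Codimension.
Variables (g : classical_type R N) (Hg : ambient_form g) (X : 'M[C]_N).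

(** By nondegeneracy of the trace form on g these are the elements of the
    intersection of [g, X] and [g, X^*]. *)
Definition normal_direction M :=
  complex_algebra g M /\ forall Z, complex_algebra g Z -> Z *m X = X *m Z ->
    \tr (M *m Z) = 0 /\ \tr (M *m Z ^t*) = 0.

Lemma normal_direction_adjoint M :
  normal_direction M -> normal_direction (M ^t*).
Proof.
move=> [gM h]; split=> [|Z gZ cZ]; first exact: complex_algebra_adjoint.
have [h1 h2] := h Z gZ cZ.
split; rewrite -[M ^t* *m _]trmxCK mxtrace_adjoint adjointM ?trmxCK mxtrace_mulC.
  by rewrite h2 conjC0.
by rewrite h1 conjC0.
Qed.

Lemma normal_directionD M M' :
  normal_direction M -> normal_direction M' -> normal_direction (M + M').
Proof.
move=> [gM h] [gM' h']; split=> [|Z gZ cZ]; first exact: complex_algebraD.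
have [h1 h2] := h Z gZ cZ; have [h1' h2'] := h' Z gZ cZ.
by rewrite !mulmxDl !mxtraceD h1 h2 h1' h2' addr0.
Qed.

Lemma normal_directionZ a M : normal_direction M -> normal_direction (a *: M).
Proof.
move=> [gM h]; split=> [|Z gZ cZ]; first exact: complex_algebraZ.
have [h1 h2] := h Z gZ cZ.
by rewrite -!scalemxAl !mxtraceZ h1 h2 mulr0.
Qed.

Lemma trace_hermitian_skew (H K : 'M[C]_N) : H ^t* = H -> K ^t* = - K ->
  complex.Re (\tr (H *m K)) = 0.
Proof.
move=> hH hK; apply: Re_eq0_sum; rewrite -mxtrace_adjoint adjointM hH hK.
by rewrite mulNmx linearN /= mxtrace_mulC subrr.
Qed.

Lemma Re_trace_comb (H : 'M[C]_N) n (r : 'I_n -> R) (B : 'I_n -> 'M[C]_N) :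
  complex.Re (\tr (H *m \sum_j (r j)%:C *: B j)) =
  \sum_j r j * complex.Re (\tr (H *m B j)).
Proof.
rewrite mulmx_sumr (raddf_sum (@mxtrace C N)) Re_sum; apply: eq_bigr => j _.
by rewrite /= -scalemxAr mxtraceZ ReZ.
Qed.

(** Write l_j for Re tr(H B_j), where the [B_j, X] form a basis of [g, X].
    Since H is orthogonal to the centraliser of X, Re tr(H Z) depends on [Z, X]
    only, so it is the pairing of l with the coordinates of [Z, X].  The rows
    of A are the coordinates of a basis of [k, X], and they pair to zero with
    l.  The c rows of a complement of A give the functionals E: if l is killed
    by them too, then l = 0, and Z = H gives tr(H H) = 0. *)
Lemma codim_functionals_hermitian c : compact_orbit_codim g X c ->
  exists2 E : 'I_c -> 'M[C]_N, (forall i, complex_algebra g (E i)) &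
    forall H, H ^t* = H -> complex_algebra g H ->
      (forall Z, complex_algebra g Z -> Z *m X = X *m Z -> \tr (H *m Z) = 0) ->
      (forall i, complex.Re (\tr (H *m E i)) = 0) -> H = 0.
Proof.
move=> [dO [dG [[e [eS _]] [f [fS f_free]] edim]]].
have delta_mem d (b : 'I_d -> 'M[C]_N) i :
    exists r : 'I_d -> R, \sum_(j < d) (r j)%:C *: b j = b i.
  exists (fun j => (j == i)%:R); rewrite (bigD1 i) //= eqxx scale1r big1 ?addr0 //.
  by move=> j /negPf ->; rewrite scale0r.
have eB j : exists B, complex_algebra g B /\ lie_bracket B X = e j.
  have : orbit_tangent (complex_algebra g) X (e j).
    by rewrite eS /=; have [r er] := delta_mem _ e j; exists r.
  by case=> B gB eB; exists B.
have {eB} /fin_all_exists[B /all_and2[gB eB]] := eB.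
have fK i : exists k, compact_algebra g k /\ lie_bracket k X = f i.
  have : orbit_tangent (compact_algebra g) X (f i).
    by rewrite fS /=; have [r er] := delta_mem _ f i; exists r.
  by case=> k gk ek; exists k.
have {fK} /fin_all_exists[K /all_and2[gK eK]] := fK.
have expand Z : complex_algebra g Z ->
    exists r : 'I_dO -> R, lie_bracket Z X = \sum_j (r j)%:C *: e j.
  move=> gZ; have : orbit_tangent (complex_algebra g) X (lie_bracket Z X).
    by exists Z.
  by rewrite eS => -[r _ <-]; exists r.
have fA i : exists r : 'I_dO -> R, f i = \sum_j (r j)%:C *: e j.
  by rewrite -eK; apply: expand; case: (gK i).
have {fA} /fin_all_exists[r er] := fA.
pose A : 'M[R]_(dG, dO) := \matrix_(i, j) r i j.
have freeA : row_free A.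
  apply: inj_row_free => v vA; apply/rowP => i; rewrite mxE.
  apply: (f_free (fun i => v 0 i)).
  under eq_bigr do rewrite er scaler_sumr; rewrite exchange_big big1 //= => j _.
  under eq_bigr do rewrite scalerA -rmorphM.
  rewrite -scaler_suml -rmorph_sum; move/rowP/(_ j): vA; rewrite !mxE => h.
  by under eq_bigr do rewrite -[r _ j](mxE matrix_key (fun i j => r i j));
    rewrite h rmorph0 scale0r.
have ec : \rank (A^C)%MS = c.
  by rewrite mxrank_compl (eqP freeA) edim addKn.
pose L := row_base (A^C)%MS.
pose E i := \sum_j (L (cast_ord (esym ec) i) j)%:C *: B j.
exists E => [i|H hH gH hZ hE]; first exact: complex_algebra_sum.
have key Z (s : 'I_dO -> R) : complex_algebra g Z ->
    lie_bracket Z X = \sum_j (s j)%:C *: e j ->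
    complex.Re (\tr (H *m Z)) = \sum_j s j * complex.Re (\tr (H *m B j)).
  move=> gZ eZ; pose Z' := Z - \sum_j (s j)%:C *: B j.
  have gZ' : complex_algebra g Z'.
    by apply: complex_algebraD => //; rewrite -scaleN1r; apply: complex_algebraZ;
      apply: complex_algebra_sum.
  have cZ' : Z' *m X = X *m Z'.
    apply/eqP; rewrite -subr_eq0; apply/eqP.
    change (lie_bracket Z' X = 0); rewrite lie_bracketBl lie_bracket_sum eZ.
    by under [X in _ - X]eq_bigr do rewrite eB; rewrite subrr.
  have := hZ _ gZ' cZ'; rewrite mulmxBr linearB /= => /eqP; rewrite subr_eq0.
  by move=> /eqP ->; rewrite Re_trace_comb.
pose l : 'cV[R]_dO := \col_j complex.Re (\tr (H *m B j)).
(* Hermitian and skew Hermitian matrices are orthogonal for Re tr. *)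
have Al : A *m l = 0.
  apply/colP => i; rewrite !mxE.
  have := key (K i) (r i); rewrite eK er => /(_ (gK i).1 erefl).
  rewrite trace_hermitian_skew // ?(gK i).2 // => e0.
  by apply: etrans (esym e0); apply: eq_bigr => j _; rewrite !mxE.
have Ll : L *m l = 0.
  apply/colP => i; rewrite mxE [RHS]mxE -[RHS](hE (cast_ord ec i)).
  by rewrite Re_trace_comb; apply: eq_bigr => j _; rewrite [l _ _]mxE cast_ordK.
have l0 : l = 0.
  have : (1%:M <= A + A^C)%MS by rewrite sub1mx addsmx_compl_full.
  move=> /sub_addsmxP[u e1].
  have /submxP[w ew] : (A^C <= L)%MS by rewrite eq_row_base.
  have Acl : A^C%MS *m l = 0 by rewrite ew -mulmxA Ll mulmx0.
  rewrite -[l]mul1mx e1 mulmxDl -[_ *m A *m l]mulmxA Al.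
  by rewrite -[_ *m A^C%MS *m l]mulmxA Acl !mulmx0 addr0.
have [s es] := expand H gH.
have := key H s gH es; rewrite big1 => [h|j _]; last first.
  by move/colP/(_ j): l0; rewrite !mxE => ->; rewrite mulr0.
apply: mxtrace_gram_eq0; rewrite hH; apply: Re_ge0_eq0 => //.
by rewrite -{1}hH mxtrace_gram_ge0.
Qed.

(** Normal directions form a complex space closed under adjoints, so the bound
    for Hermitian ones applies to M + M^* and to 'i times M - M^*. *)
Lemma codim_functionals c : compact_orbit_codim g X c ->
  exists2 E : 'I_c -> 'M[C]_N, (forall i, complex_algebra g (E i)) &
    forall M, normal_direction M -> (forall i, \tr (M *m E i) = 0) -> M = 0.
Proof.
move=> /codim_functionals_hermitian[E gE hE].
exists (fun i => E i + E i ^t*) => [i|M nM tM].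
  by apply: complex_algebraD => //; apply: complex_algebra_adjoint.
have tMa i : \tr (M ^t* *m (E i + E i ^t*)) = 0.
  rewrite -[M ^t* *m _]trmxCK mxtrace_adjoint adjointM trmxCK mxtrace_mulC.
  by rewrite adjointD trmxCK addrC tM conjC0.
have her H : H ^t* = H -> normal_direction H ->
    (forall i, \tr (H *m (E i + E i ^t*)) = 0) -> H = 0.
  move=> hH [gH nH] tH; apply: hE => // [Z gZ cZ|i]; first by case: (nH Z gZ cZ).
  apply: Re_eq0_sum; rewrite -mxtrace_adjoint adjointM hH.
  by rewrite [\tr (E i ^t* *m _)]mxtrace_mulC -mxtraceD -mulmxDr.
have nMa := normal_direction_adjoint nM.
have H1 : M + M ^t* = 0.
  apply: her; first by rewrite adjointD trmxCK addrC.
    exact: normal_directionD.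
  by move=> i; rewrite mulmxDl mxtraceD tM tMa addr0.
have H2 : 'i *: (M - M ^t*) = 0.
  apply: her.
  - by rewrite adjointZ adjointB trmxCK conjCi -scaleN1r -opprB scalerN scaleNr scale1r scaleNr opprK.
  - apply: normal_directionZ; rewrite -scaleN1r; apply: normal_directionD => //.
    exact: normal_directionZ.
  - by move=> i; rewrite -scalemxAl mxtraceZ mulmxBl linearB /= tM tMa subr0 mulr0.
have : (M + M ^t*) + (M - M ^t*) = 0.
  by rewrite H1 add0r; apply: (scalerI (neq0Ci _)); rewrite H2 scaler0.
rewrite addrACA subrr addr0 -mulr2n -scaler_nat => /eqP.
by rewrite scaler_eq0 pnatr_eq0 /= => /eqP.
Qed.

End Codimension.

End Forms.

(** * Normal directions in the presence of a bilinear form *)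

Section SkewIntertwining.
Variable C : numClosedFieldType.

(** The equation shows that Z maps the range of Q into itself; z is the matrix
    of the restriction. *)
Lemma skew_intertwine n r (Q : 'M[C]_(n, r)) (D : 'M[C]_r) (Z : 'M[C]_n) :
  isometry_mx Q -> D \in unitmx ->
  Z *m (Q *m D *m Q^T) = - (Q *m D *m Q^T *m Z^T) ->
  let z := Q ^t* *m Z *m Q in Z *m Q = Q *m z /\ z *m D = - (D *m z^T).
Proof.
move=> hQ uD cZ z; have QQc : Q^T *m Q^c = 1%:M by apply: isometry_conj.
have ZQ : Z *m Q = Q *m z.
  have [S eS] : exists S, Z *m Q = Q *m S.
    exists (- (D *m Q^T *m Z^T *m Q^c *m invmx D)).
    have := congr1 (fun A => A *m Q^c *m invmx D) cZ.
    rewrite -!mulmxA (mulmxA Q^T Q^c) QQc mul1mx mulmxV // mulmx1 => ->.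
    by rewrite mulNmx mulmxN -!mulmxA.
  by rewrite /z -mulmxA eS (mulmxA _ Q) hQ mul1mx.
split=> //; move: cZ; rewrite -[_ *m Q^T *m Z^T]mulmxA -trmx_mul !mulmxA ZQ trmx_mul.
move=> /(congr1 (fun A => Q ^t* *m A *m Q^c)).
by rewrite mulmxN mulNmx !mulmxA hQ !mul1mx -!(mulmxA _ Q^T) QQc !mulmx1.
Qed.

(** m is symmetric and z is skew for the bilinear form given by D. *)
Lemma trace_symmetric_skew n (D m z : 'M[C]_n) : D \in unitmx ->
  m *m D = D *m m^T -> z *m D = - (D *m z^T) -> \tr (m *m z) = 0.
Proof.
move=> uD cm cz; have : \tr (m *m z) = - \tr (m *m z).
  rewrite -{1}[z](mulmxK uD) cz mulNmx mulmxN linearN /= !mulmxA cm.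
  rewrite -!mulmxA mxtrace_mulC -!mulmxA mulVmx // mulmx1 -trmx_mul.
  by rewrite mxtrace_tr mxtrace_mulC.
by move=> /eqP; rewrite -addr_eq0 -mulr2n mulrn_eq0 /= => /eqP.
Qed.

Lemma trace_adjoint_eq0 n (m z : 'M[C]_n) :
  \tr (m ^t* *m z) = 0 -> \tr (m *m z ^t*) = 0.
Proof.
move=> h; rewrite -[m *m _]trmxCK mxtrace_adjoint adjointM trmxCK mxtrace_mulC.
by rewrite h conjC0.
Qed.

End SkewIntertwining.

Section FormAdjoint.
Variables (C : numClosedFieldType) (N : nat) (F : 'M[C]_N).

(** The adjoint with respect to the bilinear form F, for F unitary. *)
Definition fdag (M : 'M[C]_N) := F ^t* *m M^T *m F.

Lemma trace_compress r (Q : 'M[C]_(N, r)) (m : 'M[C]_r) (Z : 'M[C]_N) :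
  \tr (Q *m m *m Q ^t* *m Z) = \tr (m *m (Q ^t* *m Z *m Q)).
Proof. by rewrite -!mulmxA mxtrace_mulC -!mulmxA. Qed.

Lemma fdag_compress r (Q : 'M[C]_(N, r)) (m : 'M[C]_r) :
  fdag (Q *m m *m Q ^t*) = F ^t* *m Q^c *m m^T *m Q^T *m F.
Proof. by rewrite /fdag !trmx_mul map_trmx trmxK !mulmxA. Qed.

Variables (r : nat) (Q : 'M[C]_(N, r)) (D : 'M[C]_r) (Y : 'M[C]_N).
Hypotheses (hQ : isometry_mx Q) (uD : D \in unitmx) (eY : Y = Q *m D *m Q^T *m F).

Lemma kernel_fdag (m : 'M[C]_r) (v : 'cV[C]_N) :
  Y *m v = 0 -> fdag (Q *m m *m Q ^t*) *m v = 0.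
Proof.
move=> Yv; have h : Q^T *m F *m v = 0.
  have := congr1 (fun A => invmx D *m (Q ^t* *m A)) Yv.
  rewrite eY -!mulmxA (mulmxA _ Q) hQ mul1mx mulKmx // !mulmx0 => <-.
  by rewrite !mulmxA.
by rewrite fdag_compress -!mulmxA (mulmxA Q^T) h !mulmx0.
Qed.

(** For M = Q m Q^*, the product M Y is Q m D Q^T F, and M = fdag F M turns Y M
    into Q D m^T Q^T F. *)
Lemma commute_fdag (m : 'M[C]_r) : F *m F ^t* = 1%:M -> m *m D = D *m m^T ->
  Q *m m *m Q ^t* = fdag (Q *m m *m Q ^t*) ->
  (Q *m m *m Q ^t*) *m Y = Y *m (Q *m m *m Q ^t*).
Proof.
move=> FF' cm e; rewrite [in RHS]e fdag_compress eY !mulmxA.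
rewrite -(mulmxA _ F) FF' mulmx1 -(mulmxA _ Q^T Q^c) (isometry_conj hQ) mulmx1.
by rewrite -[_ *m Q ^t* *m Q]mulmxA hQ mulmx1 -(mulmxA Q m) cm mulmxA.
Qed.

End FormAdjoint.

Section FormCase.
Variables (R : realType) (N : nat).
Local Notation C := R[i].
Variables (g : classical_type R N) (F : 'M[C]_N).
Hypotheses (Hg : ambient_form g) (gF : form_of g = Some F).

Let FP := ambient_formE Hg gF.
Let sF : F^T = F \/ F^T = - F. Proof. by case: FP. Qed.
Let F'F : F ^t* *m F = 1%:M. Proof. by case: FP. Qed.
Let FF' : F *m F ^t* = 1%:M. Proof. by case: FP. Qed.

Lemma form_algebraP (B : 'M[C]_N) :
  complex_algebra g B <-> B^T *m F = - (F *m B).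
Proof.
have: complex_algebra g B <-> B^T *m F + F *m B = 0.
  by case: g gF => //= G [->].
by move=> ->; split=> [/eqP|->]; rewrite ?addNr // addr_eq0 => /eqP.
Qed.

Lemma fdag_algebra M : complex_algebra g (M - fdag F M).
Proof.
apply/form_algebraP; rewrite /fdag linearB /= !trmx_mul trmxK mulmxBl mulmxBr.
rewrite !mulmxA FF' mul1mx opprB; congr (_ - _).
have -> : (F ^t*)^T = F^c by rewrite map_trmx trmxK.
have hc : F^T *m M *m F^c = F *m M *m F ^t*.
  by case: sF => ->; rewrite ?map_mxN ?mulNmx ?mulmxN ?opprK.
by rewrite hc -(mulmxA _ (F ^t*)) F'F mulmx1.
Qed.

Lemma trace_fdag M Z : complex_algebra g Z -> \tr (fdag F M *m Z) = - \tr (M *m Z).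
Proof.
move=> /form_algebraP hZ; rewrite /fdag -!mulmxA -[F *m Z]opprK -hZ !mulmxN.
rewrite linearN /= mxtrace_mulC -!mulmxA FF' mulmx1 -trmx_mul mxtrace_tr.
by rewrite mxtrace_mulC.
Qed.

Section Compress.
Variables (r : nat) (Q : 'M[C]_(N, r)) (D : 'M[C]_r) (Y : 'M[C]_N).
Hypotheses (hQ : isometry_mx Q) (uD : D \in unitmx) (eY : Y = Q *m D *m Q^T *m F).

Lemma compress_intertwine Z : complex_algebra g Z -> Z *m Y = Y *m Z ->
  let z := Q ^t* *m Z *m Q in Z *m Q = Q *m z /\ z *m D = - (D *m z^T).
Proof.
move=> /form_algebraP hZ cZ; apply: skew_intertwine => //.
have hZ' : F *m Z *m F ^t* = - Z^T.
  by rewrite -[F *m Z]opprK -hZ mulNmx -mulmxA FF' mulmx1.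
have {1}-> : Q *m D *m Q^T = Y *m F ^t* by rewrite eY -(mulmxA _ F) FF' mulmx1.
by rewrite mulmxA cZ eY -(mulmxA _ F) -(mulmxA _ (F *m Z)) hZ' mulmxN.
Qed.

Variables (X : 'M[C]_N) (c : nat).
Hypotheses (hX : compact_orbit_codim g X c)
  (XY : forall Z : 'M[C]_N, Z *m X = X *m Z -> Z *m Y = Y *m Z).

(** For a matrix M, the difference M - fdag F M lies in g and pairs with g as 2
    M does.  Applied to M = Q m Q^*, this allows candidates that act on the
    range of the normal form only, without asking them to lie in g; what the
    functionals then force is that M equals its F-adjoint. *)
Lemma compressed_functionals : exists e : 'I_c -> 'M[C]_r,
  forall m : 'M[C]_r,
    (forall Z, complex_algebra g Z -> Z *m X = X *m Z ->
      \tr (m *m (Q ^t* *m Z *m Q)) = 0 /\ \tr (m *m (Q ^t* *m Z *m Q) ^t*) = 0) ->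
    (forall i, \tr (m *m e i) = 0) -> Q *m m *m Q ^t* = fdag F (Q *m m *m Q ^t*).
Proof.
have [E gE hE] := codim_functionals Hg hX.
have tr2 m Z : complex_algebra g Z ->
    \tr ((Q *m m *m Q ^t* - fdag F (Q *m m *m Q ^t*)) *m Z) =
    \tr (m *m (Q ^t* *m Z *m Q)) *+ 2.
  move=> gZ; rewrite mulmxBl linearB /= trace_fdag // opprK -mulr2n.
  by rewrite trace_compress.
exists (fun i => Q ^t* *m E i *m Q) => m hm he.
apply/eqP; rewrite -subr_eq0; apply/eqP/hE => [|i]; last first.
  by rewrite tr2 // he mul0rn.
split=> [|Z gZ cZ]; first exact: fdag_algebra.
have [h1] := hm Z gZ cZ; rewrite !adjointM trmxCK mulmxA => h2.
by rewrite (tr2 m Z gZ) (tr2 m (Z ^t*) (complex_algebra_adjoint Hg gZ)) h1 h2 mul0rn.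
Qed.

(** With more than c parameters t, some nonzero m = diag(phi t) satisfies the c
    equations.  Then M = Q m Q^* equals its F-adjoint; it commutes with Y and
    kills the kernel of Y, so for nilpotent Y it cannot have the nonzero
    eigenvalues that it visibly has.  The matrix Y will be X or its square. *)
Lemma diagonal_family_bound a k (phi : {linear 'rV[C]_a -> 'rV[C]_r}) :
  Y ^+ k = 0 -> injective phi ->
  (forall t, diag_mx (phi t) *m D = D *m diag_mx (phi t)) ->
  (forall t, (phi t)^c = phi (t^c)) -> (a <= c)%N.
Proof.
move=> Yk injphi cphi conjphi; rewrite leqNgt; apply/negP => lt.
have [e he] := compressed_functionals.
pose f (t : 'rV[C]_a) : 'rV[C]_c := \row_i \tr (diag_mx (phi t) *m e i).
have lf : linear f.
  move=> x t t'; apply/rowP => i; rewrite !mxE !linearP /= mulmxDl -scalemxAl.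
  by rewrite mxtraceD mxtraceZ.
have [|t t0 ft] := nontrivial_solution lf; first by rewrite !dim_matrix !mul1r.
pose m := diag_mx (phi t).
have sm : m^T = m by rewrite tr_diag_mx.
have cm : m *m D = D *m m^T by rewrite sm; apply: cphi.
have cma : m ^t* *m D = D *m (m ^t*)^T.
  by rewrite adjoint_diag tr_diag_mx conjphi; apply: cphi.
have eM : Q *m m *m Q ^t* = fdag F (Q *m m *m Q ^t*).
  apply: he => [Z gZ cZ|i]; last by move/rowP/(_ i): ft; rewrite !mxE.
  have [_ cz] := compress_intertwine gZ (XY cZ).
  split; first exact: (trace_symmetric_skew uD cm cz).
  exact/trace_adjoint_eq0/(trace_symmetric_skew uD cma cz).
have /rV0Pn[i ti] : phi t != 0.
  by apply: contra_neq t0 => h; apply: injphi; rewrite h linear0.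
have pN0 : Q *m delta_mx i 0 != 0 :> 'cV_N.
  apply/eqP => /(congr1 (mulmx (Q ^t*))); rewrite mulmxA hQ mul1mx mulmx0.
  by move/matrixP/(_ i 0)/eqP; rewrite !mxE !eqxx oner_eq0.
move/eqP: pN0; apply; apply: (@commuting_eigenvector _ _ Y (Q *m m *m Q ^t*) k _ (phi t 0 i)) => //.
- exact: (commute_fdag hQ eY FF' cm eM).
- by move=> v Yv; rewrite eM; apply: (kernel_fdag hQ uD eY).
rewrite -!mulmxA (mulmxA _ Q) hQ mul1mx scalemxAr; congr (_ *m _).
apply/matrixP => x y; rewrite mul_diag_mx !mxE.
by have [->|] := eqVneq x i; rewrite ?mulr0.
Qed.

End Compress.
End FormCase.

(** * Rank four in the orthogonal Lie algebra *)

Section Small.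
Variable C : numClosedFieldType.

Local Notation skew_unit := (skew_unit C).

Lemma antisym2E (A : 'M[C]_(1 + 1)) : A^T = - A ->
  A = A 0 (rshift 1 0) *: skew_unit 1.
Proof.
move=> aA; have := aA; rewrite -{1 2}[A]submxK tr_block_mx opp_block_mx.
move=> /eq_block_mx[/antisym_mx11 a11 a21 _ /antisym_mx11 a22].
have {}a21 : dlsubmx A = - (ursubmx A)^T by rewrite -linearN /= -a21 trmxK.
rewrite -{1}[A]submxK a11 a22 a21 scale_block_mx !scaler0 scalerN.
have -> : ursubmx A = (A 0 (rshift 1 0))%:M.
  by rewrite [ursubmx A]mx11_scalar !mxE; congr (A _ _)%:M; apply/val_inj.
by rewrite tr_scalar_mx scalemx1.
Qed.

(** Antisymmetric 4 by 4 matrices, parametrised by a space whose dimension 6 is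
    known by computation. *)
Definition antisym4 (v : 'rV[C]_2 * 'M[C]_2) : 'M[C]_((1 + 1) + (1 + 1)) :=
  block_mx (v.1 0 0 *: skew_unit 1) v.2 (- v.2^T) (v.1 0 1 *: skew_unit 1).

Lemma antisym4_linear : linear antisym4.
Proof.
move=> a [p q] [p' q']; rewrite /antisym4 /= (scale_block_mx a) add_block_mx !mxE.
by rewrite !scalerDl !scalerA linearD linearZ /= opprD -scalerN.
Qed.

Lemma tr_antisym4 v : (antisym4 v)^T = - antisym4 v.
Proof.
rewrite tr_block_mx opp_block_mx !linearZ /= !tr_skew_unit !scalerN linearN /=.
by rewrite trmxK opprK.
Qed.

Lemma scale_skew_unit_eq0 (a : C) : a *: skew_unit 1 = 0 -> a = 0.
Proof.
rewrite scale_block_mx => /(congr1 (@ursubmx _ 1 1 1 1)); rewrite block_mxKur.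
by move=> /matrixP/(_ 0 0); rewrite !mxE mulr1.
Qed.

Lemma antisym4_eq0 v : antisym4 v = 0 -> v = 0.
Proof.
case: v => p q; rewrite -[X in _ = X -> _](block_mx0 _ (1 + 1) (1 + 1) (1 + 1) (1 + 1)).
move=> /eq_block_mx[/= h1 -> _ h2].
congr (_, _); apply/rowP => j; rewrite [RHS]mxE.
have [->|->] : j = 0 \/ j = 1.
  by case: j => [[|[|//]] h]; [left | right]; apply/val_inj.
  exact: scale_skew_unit_eq0 h1.
exact: scale_skew_unit_eq0 h2.
Qed.

Lemma rank1_sym_eq0 n (x w : 'cV[C]_n) : w != 0 ->
  x *m w^T + w *m x^T = 0 -> x = 0.
Proof.
move=> /cV0Pn[i wi] /matrixP h.
have hij j k : x j 0 * w k 0 + w j 0 * x k 0 = 0.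
  by have := h j k; rewrite !mxE !big_ord1 !mxE.
have xi : x i 0 = 0.
  have := hij i i; rewrite mulrC -mulr2n => /eqP.
  by rewrite mulrn_eq0 /= mulf_eq0 (negPf wi) => /eqP.
apply/colP => j; rewrite mxE; apply/eqP; have := hij j i.
by rewrite xi mulr0 addr0 => /eqP; rewrite mulf_eq0 (negPf wi) orbF.
Qed.

(** Otherwise the antisymmetric matrix would be x w'^T, of rank one. *)
Lemma antisym4_rank1_inj (T : 'M[C]_((1 + 1) + (1 + 1))) (w x : 'cV[C]_((1 + 1) + (1 + 1))) v :
  T \in unitmx -> w != 0 -> antisym4 v *m T + x *m w^T = 0 -> (v, x) = 0.
Proof.
move=> uT w0 h; pose w' := - (w^T *m invmx T)^T.
have ea : antisym4 v = x *m w'^T.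
  rewrite -[LHS](mulmxK uT); move/eqP: h; rewrite addr_eq0 => /eqP ->.
  by rewrite linearN /= trmxK mulNmx mulmxN mulmxA.
have w'0 : w' != 0.
  apply: contra_neq w0 => /eqP; rewrite oppr_eq0 => /eqP h0; apply: trmx_inj.
  by rewrite -[w^T](mulmxKV uT) -[w^T *m _]trmxK h0 !trmx0 mul0mx.
have x0 : x = 0.
  apply: (rank1_sym_eq0 w'0); have := tr_antisym4 v.
  by rewrite ea trmx_mul trmxK => ->; rewrite subrr.
by rewrite (antisym4_eq0 (v := v)) ?x0 // ea x0 mul0mx.
Qed.

(** There are 6 + 4 + 6 + 4 = 20 unknowns, the pairs of an antisymmetric matrix
    and a vector; the equation for m counts for 16, isotropy for 1 and the
    traces for 2.  A nonzero solution has m <> 0 because the two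
    parametrisations of m are injective. *)
Lemma rank_one_solution (T : 'M[C]_((1 + 1) + (1 + 1))) (w : 'cV[C]_((1 + 1) + (1 + 1)))
    (e : 'I_2 -> 'M[C]_((1 + 1) + (1 + 1))) :
  T \in unitmx -> w != 0 ->
  exists (a a' : 'M[C]_((1 + 1) + (1 + 1))) (x x' : 'cV[C]_((1 + 1) + (1 + 1))),
    let m := a *m T + x *m w^T in
    [/\ a^T = - a, a'^T = - a', m = T ^t* *m a' + w^c *m x'^T,
        w^T *m m *m w^c = 0 & m != 0 /\ forall i, \tr (m *m e i) = 0].
Proof.
move=> uT w0.
pose U := (('rV[C]_2 * 'M[C]_2) * 'cV[C]_((1 + 1) + (1 + 1)))%type.
pose m (u : U) := antisym4 u.1 *m T + u.2 *m w^T.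
pose m' (u : U) := T ^t* *m antisym4 u.1 + w^c *m u.2^T.
pose f (u : U * U) : 'M[C]_4 * ('M[C]_1 * 'rV[C]_2) :=
  (m u.1 - m' u.2, (w^T *m m u.1 *m w^c, \row_i \tr (m u.1 *m e i))).
have lm : linear m.
  move=> k u u'; rewrite /m antisym4_linear !mulmxDl -!scalemxAl scalerDr.
  by rewrite addrACA.
have lm' : linear m'.
  move=> k u u'; rewrite /m' antisym4_linear.
  rewrite -[(k *: u + u').2]/(k *: u.2 + u'.2) [(_ + _)^T]linearP /= !mulmxDr -!scalemxAr.
  by rewrite scalerDr addrACA.
have lf : linear f.
  move=> k u u'; apply: (congr2 pair); last apply: (congr2 pair).
  - by rewrite [m _]lm [m' _]lm' /= scalerBr opprD addrACA.
  - by rewrite [m _]lm /= mulmxDr mulmxDl -scalemxAr -scalemxAl.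
  - apply/rowP => i; rewrite !mxE [m _]lm /= mulmxDl mxtraceD -scalemxAl mxtraceZ.
    by [].
have [|u u0 fu] := nontrivial_solution lf; first by [].
have [e1 [e2 e3]] : m u.1 = m' u.2 /\ w^T *m m u.1 *m w^c = 0 /\
    forall i, \tr (m u.1 *m e i) = 0.
  case: fu => /eqP; rewrite subr_eq0 => /eqP e1 e2 /rowP e3; do !split => //.
  by move=> i; have := e3 i; rewrite !mxE.
exists (antisym4 u.1.1), (antisym4 u.2.1), u.1.2, u.2.2.
split; rewrite ?tr_antisym4 //; split=> //; apply: contra_neq u0 => h.
have u1 : (u.1.1, u.1.2) = 0 by apply: (antisym4_rank1_inj uT w0).
have u2 : (u.2.1, u.2.2) = 0.
  have uTc : - T^c \in unitmx by rewrite -scaleN1r unitmxZ ?unitrN1 ?map_unitmx.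
  apply: (antisym4_rank1_inj (w := w^c) uTc).
    by apply: contra_neq w0 => wc; apply: (map_mx_inj (f := Num.conj)); rewrite wc map_mx0.
  have : m' u.2 = 0 by rewrite -e1.
  move=> /(congr1 trmx); rewrite linearD /= !trmx_mul trmxK trmx0 tr_antisym4.
  by rewrite mulNmx mulmxN !map_trmx trmxK.
by case: u u1 u2 {fu h e1 e2 e3} => [[u1 u2] [u3 u4]] /= -> ->.
Qed.

End Small.

Lemma rank_sandwich (C : fieldType) m n r (P : 'M[C]_(m, r)) (D : 'M[C]_r)
    (Q : 'M[C]_(r, n)) (L : 'M[C]_(r, m)) (S : 'M[C]_(n, r)) :
  D \in unitmx -> L *m P = 1%:M -> Q *m S = 1%:M -> \rank (P *m D *m Q) = r.
Proof.
move=> uD LP QS; apply/eqP; rewrite eqn_leq; apply/andP; split.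
  by apply: leq_trans (mxrankM_maxl _ _) _; apply: rank_leq_col.
have eD : D = L *m (P *m D *m Q) *m S.
  by rewrite !mulmxA LP mul1mx -mulmxA QS mulmx1.
rewrite -{1}(mxrank_unit uD) {1}eD.
by apply: leq_trans (mxrankM_maxl _ _) (mxrankM_maxr _ _).
Qed.

Section RankTwoSolution.
Variable C : numClosedFieldType.
Variables (D G : 'M[C]_(2 + 2)) (B : 'M[C]_(2 + 2, 2)) (s : 'rV[C]_2).
Hypotheses (uD : D \in unitmx) (aD : D^T = - D) (sG : G^T = G).
Hypotheses (hB : isometry_mx B) (s0 : positive_row s).
Hypothesis eB : D *m G *m D = B *m diag_mx s *m B^T.

Let T := invmx D.
Let aT : T^T = - T.
Proof.
by rewrite -[T^T](mulmxK uD) -[D in T^T *m D]opprK -aD mulmxN -trmx_mul mulmxV //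
  trmx1 mulNmx mul1mx.
Qed.

Let us : diag_mx s \in unitmx. Proof. exact: diag_unit. Qed.

Let eG : G = T *m B *m diag_mx s *m (B^T *m T).
Proof.
rewrite -[LHS](mulKmx uD) -[X in _ = X]mulmxA -!mulmxA; congr (_ *m _).
by rewrite -[LHS](mulmxK uD) eB -!mulmxA.
Qed.

(** The 2 by 2 matrix B^T T B is antisymmetric, hence zero or invertible, and
    diag(s) B^T T B is nilpotent. *)
Lemma nilpotent_isotropic k : (D *m G) ^+ k = 0 -> B^T *m T *m B = 0.
Proof.
move=> Nk; pose L := B^T *m T *m B.
have aL : L^T = - L by rewrite !trmx_mul trmxK aT mulNmx mulmxN mulmxA.
have eL := antisym2E (aL : (L : 'M_(1 + 1))^T = - L); set x := L _ _ in eL.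
have eN : D *m G = B *m diag_mx s *m B^T *m T by rewrite -eB mulmxK.
pose S := diag_mx s *m L.
have eNk j : diag_mx s *m (B^T *m T) *m (D *m G) ^+ j =
    S ^+ j *m (diag_mx s *m (B^T *m T)).
  elim: j => [|j IH]; first by rewrite !expr0 mulmx1 mul1mx.
  rewrite [in LHS]exprSr [in RHS]exprSr -[_ ^+ j * _]/(_ *m _) mulmxA IH.
  rewrite -[S ^+ j * S]/(S ^+ j *m S) -!mulmxA; congr (_ *m _).
  by rewrite /S /L eN -!mulmxA.
have Sk : S ^+ k = 0.
  have := eNk k; rewrite Nk mulmx0 => /(congr1 (fun A => A *m D *m B^c *m invmx (diag_mx s))).
  rewrite !mul0mx !mulmxA mulmxKV // -[_ *m B^T *m B^c]mulmxA isometry_conj //.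
  by rewrite mulmx1 mulmxK.
have [x0|xN0] := eqVneq x 0; first by rewrite -/L eL x0 scale0r.
have uL : L \in unitmx.
  suff /mulmx1_unit[] : L *m (- x^-1 *: skew_unit C 1) = 1%:M by [].
  rewrite eL -scalemxAl -scalemxAr (skew_unit_sq C 1) scalerN scaleNr opprK scalerA.
  by rewrite mulfV // scale1r.
have uS : S \is a GRing.unit by rewrite -[_ \is a _]/(S \in unitmx) unitmx_mul us.
by have := unitrX k uS; rewrite Sk unitr0.
Qed.

Hypothesis BTB : B^T *m T *m B = 0.

Let GB : G *m B = 0. Proof. by rewrite eG -!mulmxA (mulmxA B^T) BTB !mulmx0. Qed.

(** Here B spans half of the 4-dimensional space and G B = 0, so the range of
    G^* is the orthogonal complement of B; Takagi's normal form gives an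
    orthonormal basis. *)
Lemma rank_two_complement : exists K : 'M[C]_(2 + 2, 2),
  [/\ isometry_mx K, B ^t* *m K = 0 & B *m B ^t* + K *m K ^t* = 1%:M].
Proof.
have sGa : (G ^t*)^T = G ^t* by rewrite map_trmx trmxK -{1}sG.
have [r [K [d [hK d0 eK]]]] := takagi sGa.
have ud := diag_unit d0.
have r2 : r = 2.
  have <- : \rank (G ^t*) = r.
    by rewrite eK (rank_sandwich ud hK (isometry_conj hK)).
  rewrite mxrank_map mxrank_tr eG.
  apply: (@rank_sandwich _ _ _ _ _ _ _ (B ^t* *m D) (D *m B^c)) => //.
    by rewrite -!mulmxA (mulmxA D) mulmxV // mul1mx.
  by rewrite -!mulmxA (mulmxA T) mulVmx // mul1mx isometry_conj.
subst r; exists K.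
have BK : B ^t* *m K = 0.
  have : B ^t* *m G ^t* = 0 by rewrite -adjointM GB adjoint0.
  move=> /(congr1 (fun A => A *m K^c *m invmx (diag_mx d))).
  rewrite !mul0mx eK !mulmxA -[_ *m K^T *m K^c]mulmxA isometry_conj // mulmx1.
  by rewrite mulmxK.
split => //; have := isometry_row_mx hB hK BK.
by move=> /mulmx1C; rewrite adjoint_row_mx mul_row_col.
Qed.

(** The matrix M is a T applied after the projection onto B, where a is the
    antisymmetric form on the complement K of B.  Since K^T T K is itself a
    multiple of the standard form, M differs from a T by a multiple of the
    projection onto K, which makes its trace pairings computable. *)
Lemma rank_two_direction : exists (M : 'M[C]_(2 + 2)),
  [/\ M *m B != 0, B ^t* *m M = 0,
      (forall z, z *m D = - (D *m z^T) -> \tr (B ^t* *m z *m B) = 0 -> \tr (M *m z) = 0)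
    & (forall z y, z *m B = B *m y -> \tr (M ^t* *m z) = 0)].
Proof.
have [K [hK BK BBKK]] := rank_two_complement.
pose J := skew_unit C 1; pose a := K *m J *m K^T.
have aa : a^T = - a by rewrite !trmx_mul trmxK [J^T]tr_skew_unit mulNmx mulmxN mulmxA.
pose L := K^T *m T *m K.
have aL : L^T = - L by rewrite !trmx_mul trmxK aT mulNmx mulmxN mulmxA.
have eL := antisym2E (aL : (L : 'M_(1 + 1))^T = - L); set x := L _ _ in eL.
pose M := a *m T *m (B *m B ^t*).
have eM : M = a *m T + x *: (K *m K ^t*).
  rewrite /M; have -> : B *m B ^t* = 1%:M - K *m K ^t* by rewrite -BBKK addrK.
  rewrite mulmxBr mulmx1; congr (_ + _).
  have -> : a *m T *m (K *m K ^t*) = K *m (J *m L) *m K ^t* by rewrite /L !mulmxA.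
  by rewrite eL -scalemxAr (skew_unit_sq C 1) scalerN mulmxN mulNmx opprK -scalemxAr mulmx1 -scalemxAl.
exists M; split.
- apply: contraTneq isT => MB.
  have KTB : K^T *m T *m B = 0.
    have := congr1 (fun A => - J *m (K ^t* *m A)) MB.
    rewrite !mulmx0 /M /a -!mulmxA hB mulmx1 (mulmxA (K ^t*)) hK mul1mx.
    by rewrite mulNmx (mulmxA J J) [J *m J](skew_unit_sq C 1) mulNmx mul1mx opprK mulmxA.
  have : (row_mx B K)^T *m (T *m B) = 0.
    by rewrite tr_row_mx mul_col_mx !mulmxA BTB KTB col_mx0.
  move=> /(congr1 (mulmx (row_mx B K)^c)); rewrite mulmx0 map_row_mx tr_row_mx mulmxA.
  rewrite mul_row_col -[B^T]conj_adjoint -[K^T]conj_adjoint -!map_mxM -map_mxD BBKK.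
  rewrite map_mx1 mul1mx => /(congr1 (mulmx D)); rewrite mulKVmx // mulmx0 => B0.
  move/matrixP/(_ 0 0): hB; rewrite B0 mulmx0 !mxE => /eqP.
  by rewrite eq_sym oner_eq0.
- by rewrite /M /a !mulmxA BK !mul0mx.
- move=> z zD zB; rewrite eM mulmxDl mxtraceD -scalemxAl mxtraceZ.
  rewrite (trace_symmetric_skew uD _ zD); last first.
    by rewrite mulmxKV // trmx_mul aT aa mulNmx !mulmxN opprK mulmxA mulmxV // mul1mx.
  have -> : K *m K ^t* = 1%:M - B *m B ^t* by rewrite -BBKK addrC addKr.
  rewrite mulmxBl mul1mx linearB /= -[B *m _ *m z]mulmxA [\tr (B *m _)]mxtrace_mulC zB subr0.
  have := trace_symmetric_skew (m := 1%:M) uD _ zD; rewrite !mul1mx trmx1 mulmx1 => ->//.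
  by rewrite mulr0 addr0.
- move=> z y zB; rewrite /M /a !adjointM !trmxCK.
  rewrite -!mulmxA mxtrace_mulC -!mulmxA zB (mulmxA (K ^t*)).
  have -> : K ^t* *m B = 0 by rewrite -[B]trmxCK -adjointM BK adjoint0.
  by rewrite !(mul0mx, mulmx0) mxtrace0.
Qed.

End RankTwoSolution.

(** The middle factor of X^2 is D G D; z is skew for it as it is for D. *)
Lemma compressed_centraliser (C : numClosedFieldType) N r (X Z : 'M[C]_N)
    (Q : 'M[C]_(N, r)) (D G z : 'M[C]_r) :
  isometry_mx Q -> X *m Q = Q *m (D *m G) -> Z *m Q = Q *m z -> Z *m X = X *m Z ->
  z *m D = - (D *m z^T) -> z *m (D *m G *m D) = - (D *m G *m D *m z^T).
Proof.
move=> hQ XQ ZQ cZ zD; have zN : z *m (D *m G) = D *m G *m z.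
  have : Z *m X *m Q = X *m Z *m Q by rewrite cZ.
  rewrite -!mulmxA XQ ZQ !mulmxA ZQ XQ -!mulmxA => /(congr1 (mulmx (Q ^t*))).
  by rewrite !(mulmxA (Q ^t*)) hQ !mul1mx.
by rewrite (mulmxA z) zN -(mulmxA _ z) zD mulmxN (mulmxA _ D).
Qed.

Lemma fixed_compress (C : numClosedFieldType) N r (F : 'M[C]_N) (Q : 'M[C]_(N, r)) m :
  isometry_mx Q -> Q *m m *m Q ^t* = fdag F (Q *m m *m Q ^t*) ->
  m = (Q^T *m F *m Q) ^t* *m m^T *m (Q^T *m F *m Q).
Proof.
move=> hQ; rewrite fdag_compress => /(congr1 (fun A => Q ^t* *m A *m Q)).
rewrite !mulmxA hQ mul1mx -mulmxA hQ mulmx1 => {1}->.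
by rewrite !adjointM (trmxK Q) !mulmxA.
Qed.

Section NormalDirections.
Variables (C : numClosedFieldType) (k : nat) (D G : 'M[C]_(2 + 2)).
Hypotheses (uD : D \in unitmx) (aD : D^T = - D) (sG : G^T = G).
Hypothesis Gk : (D *m G) ^+ k = 0.
Let S := D *m G *m D.
Variable e : 'I_2 -> 'M[C]_(2 + 2).
Hypothesis he : forall m : 'M[C]_(2 + 2),
  (forall z, z *m D = - (D *m z^T) -> z *m S = - (S *m z^T) ->
     \tr (m *m z) = 0 /\ \tr (m *m z ^t*) = 0) ->
  (forall i, \tr (m *m e i) = 0) -> m = G ^t* *m m^T *m G.

(** If S has rank one, G is a multiple of w w^T, so that an m with m = G^* m^T
    G and w^T m w^c = 0 vanishes.  On the other hand z b = 0 for z skew for S,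
    and so a T + x w^T pairs to zero with z for all antisymmetric a and all x.
    The matrix m of rank_one_solution has this form together with its adjoint,
    and it is not zero. *)
Lemma normal_direction_rank_one (b : 'cV[C]_(2 + 2)) (s : C) : s != 0 -> isometry_mx b ->
  S = s *: (b *m b^T) -> False.
Proof.
move=> s0 hb eS; pose T := invmx D; pose w := T *m b.
have uT : T \in unitmx by rewrite unitmx_inv.
have b0 : b != 0 by apply: unit_vec_neq0.
have aT : T^T = - T.
  rewrite -[T^T](mulmxK uD) -[D in T^T *m D]opprK -aD mulmxN -trmx_mul mulmxV //.
  by rewrite trmx1 mulNmx mul1mx.
have w0 : w != 0 by apply: contra_neq b0 => h; rewrite -[b](mulKVmx uD) -/w h mulmx0.
have eG : G = - s *: (w *m w^T).
  have -> : G = T *m S *m T by rewrite /S -(mulmxA T) mulmxK // mulKmx.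
  rewrite eS -scalemxAr -scalemxAl scaleNr /w trmx_mul aT !mulmxN !mulmxA scalerN.
  by rewrite opprK.
have [a [a' [x [x' [aa aa' em wmw [m0 te]]]]]] := rank_one_solution e uT w0.
set m := a *m T + x *m w^T in em wmw m0 te.
case/eqP: m0.
have tr0 (c : 'M[C]_(2 + 2)) (y : 'cV[C]_(2 + 2)) z : c^T = - c ->
    z *m D = - (D *m z^T) -> z *m S = - (S *m z^T) ->
    \tr ((c *m T + y *m w^T) *m z) = 0.
  move=> ac zD zS; have zb : z *m b = 0.
    apply: (rank1_sym_eq0 b0); move: zS.
    rewrite eS -scalemxAr -scalemxAl -scalerN => /(scalerI s0) zS.
    by rewrite -mulmxA zS trmx_mul mulmxA addNr.
  have Tz : T *m z = - (z^T *m T).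
    by rewrite -[z in LHS](mulmxK uD) zD mulNmx mulmxN -mulmxA mulKmx.
  have wz : w^T *m z = 0.
    rewrite /w trmx_mul aT mulmxN mulNmx -mulmxA Tz mulmxN opprK mulmxA.
    by rewrite -trmx_mul zb trmx0 mul0mx.
  rewrite mulmxDl mxtraceD -(mulmxA y) wz mulmx0 mxtrace0 addr0.
  rewrite (trace_symmetric_skew uD _ zD) // mulmxKV // trmx_mul aT ac.
  by rewrite mulNmx !mulmxN opprK mulmxA mulmxV // mul1mx.
have fix_m : m = G ^t* *m m^T *m G.
  apply: he => // z zD zS; split; first exact: tr0.
  apply: trace_adjoint_eq0.
  have -> : m ^t* = a' ^t* *m T + x'^c *m w^T.
    by rewrite em adjointD !adjointM trmxCK adjointC trmxK.
  by apply: tr0 => //; rewrite map_trmx trmxK aa' map_mxN opprK.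
have wmw' : w ^t* *m m^T *m w = 0.
  by apply: trmx_inj; rewrite (trmx_mul _ w) (trmx_mul (w ^t*)) trmxK map_trmx trmxK mulmxA wmw trmx0.
have eGa : G ^t* = (- s)^* *: ((w^T) ^t* *m w ^t*).
  by rewrite eG adjointZ (adjointM w).
have -> : m = ((- s)^* * - s) *: ((w^T) ^t* *m (w ^t* *m m^T *m w) *m w^T).
  rewrite {1}fix_m eGa [X in _ *m X = _]eG -!scalemxAl -!scalemxAr scalerA.
  by rewrite !mulmxA.
by rewrite wmw' mulmx0 mul0mx scaler0.
Qed.

(** If S = D G D has rank two, the candidates m are B diag(u) B^* and the extra
    matrix M of rank_two_direction.  These are three parameters for two
    equations, while G B = 0 and m = G^* m^T G force B^* m = 0 and m B = 0. *)
Lemma normal_direction_rank_two (B : 'M[C]_(2 + 2, 2)) (s : 'rV[C]_2) : positive_row s ->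
  isometry_mx B -> S = B *m diag_mx s *m B^T -> False.
Proof.
move=> s0 hB eS; have us := diag_unit s0.
have BTB := nilpotent_isotropic uD aD hB s0 eS Gk.
have [M [MB BM trM trMa]] := rank_two_direction uD aD sG hB s0 eS BTB.
have GB : G *m B = 0.
  have -> : G = invmx D *m S *m invmx D.
    by rewrite /S -(mulmxA (invmx D)) mulmxK // mulKmx.
  by rewrite eS -!mulmxA (mulmxA B^T) BTB !mulmx0.
pose m (u : 'rV[C]_2 * 'M[C]_1) := B *m diag_mx u.1 *m B ^t* + u.2 0 0 *: M.
pose f u : 'rV[C]_2 := \row_i \tr (m u *m e i).
have lf : linear f.
  move=> a u v; apply/rowP => i; rewrite !mxE.
  have -> : m (a *: u + v) = a *: m u + m v.
    rewrite /m -[(a *: u + v).1]/(a *: u.1 + v.1) -[(a *: u + v).2]/(a *: u.2 + v.2).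
    rewrite linearP /= !mxE mulmxDr mulmxDl -scalemxAr -scalemxAl scalerDl scalerDr.
    by rewrite scalerA addrACA.
  by rewrite mulmxDl mxtraceD -scalemxAl mxtraceZ.
have [|u u0 fu] := nontrivial_solution lf; first by [].
have trB (t : 'M[C]_2) z y : z *m B = B *m y -> \tr (B *m t *m B ^t* *m z) = \tr (t *m y).
  move=> zB; rewrite -!mulmxA mxtrace_mulC -!mulmxA zB (mulmxA (B ^t*)) hB mul1mx.
  by [].
have tr0 (t : 'rV[C]_2) y : y *m diag_mx s = - (diag_mx s *m y^T) ->
    \tr (diag_mx t *m y) = 0.
  by move=> ys; apply: trace_symmetric_skew us _ ys; rewrite tr_diag_mx diag_mxC.
have fix_m : m u = G ^t* *m (m u)^T *m G.
  apply: he => [z zD zS|i]; last by move/rowP/(_ i): fu; rewrite !mxE.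
  rewrite eS in zS; have [zB ys] := skew_intertwine hB us zS.
  have zBt : \tr (B ^t* *m z *m B) = 0.
    by rewrite -[_ *m B]mul1mx -diag_const_mx tr0.
  split; last apply: trace_adjoint_eq0.
    by rewrite mulmxDl mxtraceD (trB _ _ _ zB) tr0 // -scalemxAl mxtraceZ trM // mulr0 addr0.
  rewrite adjointD !adjointM trmxCK adjointZ adjoint_diag mulmxA mulmxDl mxtraceD.
  by rewrite (trB _ _ _ zB) tr0 // -scalemxAl mxtraceZ (trMa _ _ zB) mulr0 addr0.
have Bm : B ^t* *m m u = 0.
  by rewrite fix_m !mulmxA -adjointM GB adjoint0 !mul0mx.
have mB : m u *m B = 0 by rewrite fix_m -(mulmxA _ G) GB mulmx0.
have u1 : u.1 = 0.
  have := congr1 (fun A => A *m B) Bm; rewrite mul0mx mulmxDr -scalemxAr BM scaler0 addr0.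
  rewrite -!mulmxA hB mulmx1 mulmxA hB mul1mx => /matrixP h.
  by apply/rowP => i; have := h i i; rewrite !mxE eqxx mulr1n.
case/eqP: u0; case: u u1 mB {fu fix_m Bm} => u1 u2 /= -> /eqP.
rewrite mulmxDl linear0 mulmx0 !mul0mx add0r -scalemxAl scaler_eq0 (negPf MB) orbF.
by move=> /eqP h; congr (_, _); rewrite [u2]mx11_scalar h raddf0.
Qed.

End NormalDirections.

Section OrthogonalRankFour.
Variables (R : realType) (N : nat).
Local Notation C := R[i].
Variables (g : classical_type R N) (F : 'M[C]_N).
Hypotheses (Hg : ambient_form g) (gF : form_of g = Some F) (sF : F^T = F).
Variables (X : 'M[C]_N) (k : nat) (Q : 'M[C]_(N, 2 + 2)) (D : 'M[C]_(2 + 2)).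
Hypotheses (Xk : X ^+ k = 0) (hQ : isometry_mx Q) (uD : D \in unitmx)
  (aD : D^T = - D) (eX : X = Q *m D *m Q^T *m F) (hX : compact_orbit_codim g X 2).

Let FF' : F *m F ^t* = 1%:M. Proof. by case: (ambient_formE Hg gF). Qed.
Let G := Q^T *m F *m Q.
Let S := D *m G *m D.
Let sG : G^T = G. Proof. by rewrite !trmx_mul trmxK sF mulmxA. Qed.
Let sS : S^T = S.
Proof.
by rewrite /S (trmx_mul _ D) (trmx_mul D G) sG aD mulNmx !mulmxN opprK mulmxA.
Qed.

Let eXX : X *m X = Q *m S *m Q^T *m F.
Proof. by rewrite /S /G eX !mulmxA. Qed.

Let XQ : X *m Q = Q *m (D *m G).
Proof. by rewrite /G eX !mulmxA. Qed.

Let Gk : (D *m G) ^+ k = 0. Proof. exact: compress_nilpotent hQ XQ Xk. Qed.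

(** By diagonal_family_bound applied to X^2, whose normal form is diagonal, X^2
    has rank at most two.  Ranks one and two are excluded separately. *)
Lemma orthogonal_rank_four_sq0 : X *m X = 0.
Proof.
have [q [B [s [hB s0 eS]]]] := takagi sS.
have us := diag_unit s0.
have eY : X *m X = Q *m B *m diag_mx s *m (Q *m B)^T *m F.
  by rewrite eXX eS trmx_mul !mulmxA.
have hQB : isometry_mx (Q *m B).
  by rewrite /isometry_mx adjointM -mulmxA (mulmxA (Q ^t*)) hQ mul1mx.
have Yk : (X *m X) ^+ k = 0.
  by rewrite -[X *m X]/(X ^+ 2) -exprM mulnC exprM Xk expr0n.
have q2 : (q <= 2)%N.
  apply: (diagonal_family_bound Hg gF hQB us eY hX _ Yk (phi := idfun)) => //.
  - by move=> Z cZ; rewrite mulmxA cZ -mulmxA cZ mulmxA.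
  - by move=> t; rewrite diag_mxC.
have [e he0] := compressed_functionals Hg gF Q hX.
have he : forall m : 'M[C]_(2 + 2),
    (forall z, z *m D = - (D *m z^T) -> z *m S = - (S *m z^T) ->
       \tr (m *m z) = 0 /\ \tr (m *m z ^t*) = 0) ->
    (forall i, \tr (m *m e i) = 0) -> m = G ^t* *m m^T *m G.
  move=> m hm te; apply: (fixed_compress hQ); apply: he0 te => Z gZ cZ.
  have [ZQ zD] := compress_intertwine Hg gF hQ uD eX gZ cZ.
  by apply: (hm _ zD); apply: compressed_centraliser hQ XQ ZQ cZ zD.
case: q B s hB s0 eS us eY hQB q2 => [|[|[|//]]] B s hB s0 eS us eY hQB _.
- by rewrite eXX eS [B]thinmx0 !mul0mx mulmx0 !mul0mx.
- exfalso; apply: (normal_direction_rank_one uD aD he (b := B) (s := s 0 0)) => //.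
    by rewrite gt_eqF.
  by rewrite -[LHS]/S eS [diag_mx s]mx11_scalar mxE mulr1n mul_mx_scalar scalemxAl.
- by case: (normal_direction_rank_two uD aD sG Gk he s0 hB eS).
Qed.

End OrthogonalRankFour.

(** * Rank two in the symplectic and special linear Lie algebras *)

Section Compression.
Variable C : numClosedFieldType.

(** Compressed to the range, the symplectic form is an antisymmetric matrix of
    size at most two, hence zero or invertible; nilpotency excludes the latter. *)
Lemma symplectic_rank_two_sq0 n r k (X F : 'M[C]_n) (Q : 'M[C]_(n, r)) (d : 'rV[C]_r) :
  F^T = - F -> isometry_mx Q -> positive_row d -> (r <= 2)%N ->
  X = Q *m diag_mx d *m Q^T *m F -> X ^+ k = 0 -> X *m X = 0.
Proof.
move=> aF hQ d0 r2 eX Xk; pose G := Q^T *m F *m Q.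
have aG : G^T = - G by rewrite !trmx_mul trmxK aF mulNmx mulmxN mulmxA.
suff G0 : G = 0.
  have -> : X *m X = Q *m diag_mx d *m G *m diag_mx d *m Q^T *m F.
    by rewrite /G eX !mulmxA.
  by rewrite G0 mulmx0 !mul0mx.
have Gk : (diag_mx d *m G) ^+ k = 0.
  by apply: (compress_nilpotent hQ _ Xk); rewrite /G eX !mulmxA.
have ud := diag_unit d0; clearbody G; clear eX.
case: r Q d hQ d0 r2 G aG Gk ud => [|[|[|//]]] Q d hQ d0 _ G aG Gk ud.
- by rewrite [G]flatmx0.
- exact: antisym_mx11.
have := antisym2E (aG : (G : 'M_(1 + 1))^T = - G); set x := G _ _ => eG.
have [x0|xN0] := eqVneq x 0; first by rewrite eG x0 scale0r.
have uG : G \in unitmx.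
  suff /mulmx1_unit[] : G *m (- x^-1 *: skew_unit C 1) = 1%:M by [].
  rewrite eG -scalemxAl -scalemxAr (skew_unit_sq C 1) scalerN scaleNr opprK scalerA.
  by rewrite mulfV // scale1r.
by have := nilpotent_not_unit Gk; rewrite unitmx_mul ud uG.
Qed.

(** A non-scalar 2 by 2 matrix has a cyclic vector. *)
Lemma commutant2 (z M : 'M[C]_2) : z *m M = M *m z -> ~~ is_scalar_mx M ->
  exists a b, z = a%:M + b *: M.
Proof.
move=> /matrixP cz nM.
have E i j : z i 0 * M 0 j + z i 1 * M 1 j = M i 0 * z 0 j + M i 1 * z 1 j.
  by have := cz i j; rewrite !mxE !big_ord_recl !big_ord0 !addr0 /= (_ : lift _ _ = 1) //;
    apply/val_inj.
have mk a b : z 0 0 = a + b * M 0 0 -> z 0 1 = b * M 0 1 -> z 1 0 = b * M 1 0 ->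
    z 1 1 = a + b * M 1 1 -> exists a b, z = a%:M + b *: M.
  move=> h00 h01 h10 h11; exists a, b; apply/matrixP => i j.
  have cs (l : 'I_2) : l = 0 \/ l = 1.
    by case: l => [[|[|//]] h]; [left | right]; apply/val_inj.
  by case: (cs i) => ->; case: (cs j) => ->; rewrite !mxE /= ?mulr1n ?mulr0n ?add0r.
have E00 := E 0 0; have E01 := E 0 1; have E10 := E 1 0.
have eqr (x y x' y' : C) : x' = y' -> x - y = x' - y' -> x = y.
  by move=> -> /eqP; rewrite subrr subr_eq0 => /eqP.
have [M01|M01] := eqVneq (M 0 1) 0; last first.
  pose b := z 0 1 / M 0 1; apply: (mk (z 0 0 - b * M 0 0) b); rewrite ?subrK //.
  - by rewrite /b divfK.
  - apply: (mulIf M01); rewrite /b mulrAC divfK //.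
    by apply: (eqr _ _ _ _ (esym E00)); ring.
  - apply: (mulIf M01); rewrite mulrDl mulrBl /b !(mulrAC _ (M _ _) (M 0 1)) divfK //.
    by apply: (eqr _ _ _ _ (esym E01)); ring.
have [M10|M10] := eqVneq (M 1 0) 0; last first.
  pose b := z 1 0 / M 1 0; apply: (mk (z 0 0 - b * M 0 0) b); rewrite ?subrK //.
  - apply: (mulIf M10); rewrite /b mulrAC divfK //.
    by apply: (eqr _ _ _ _ E00); ring.
  - by rewrite /b divfK.
  - apply: (mulIf M10); rewrite mulrDl mulrBl /b !(mulrAC _ (M _ _) (M 1 0)) divfK //.
    by apply: (eqr _ _ _ _ E10); ring.
have M0 : M 0 0 - M 1 1 != 0.
  apply: contra nM => /eqP/subr0_eq h; apply/is_scalar_mxP; exists (M 1 1).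
  apply/matrixP => i j; have cs (l : 'I_2) : l = 0 \/ l = 1.
    by case: l => [[|[|//]] h']; [left | right]; apply/val_inj.
  by case: (cs i) => ->; case: (cs j) => ->; rewrite !mxE /=.
pose b := (z 0 0 - z 1 1) / (M 0 0 - M 1 1).
have eb : b * (M 0 0 - M 1 1) = z 0 0 - z 1 1 by rewrite /b divfK.
move: E01 E10; rewrite M01 M10 !mulr0 !mul0r !add0r !addr0 => E01 E10.
apply: (mk (z 0 0 - b * M 0 0) b); rewrite ?subrK ?M01 ?M10 ?mulr0 //.
- by apply: (mulIf M0); rewrite mul0r; apply: (eqr _ _ _ _ (esym E01)); ring.
- by apply: (mulIf M0); rewrite mul0r; apply: (eqr _ _ _ _ E10); ring.
- by apply: (eqr _ _ _ _ eb); ring.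
Qed.

End Compression.

(** P m P^* acts on the range of X and Q n Q^* on that of X^*.  By
    special_linear_centraliser the pairs (z, z') contain the compressions of
    the centraliser of X, so that the trace identities make the difference of
    the two a normal direction. *)
Definition special_linear_directions (C : numClosedFieldType) N r c
    (P Q : 'M[C]_(N, r)) (d : 'rV[C]_r) (e f : 'I_c -> 'M[C]_r) : Prop :=
  forall m n : 'M[C]_r,
    (forall z z', z *m diag_mx d = diag_mx d *m z' ->
       z *m (diag_mx d *m (P ^t* *m Q) ^t*) = diag_mx d *m (P ^t* *m Q) ^t* *m z ->
       \tr (m *m z) = \tr (n *m z') /\ \tr (m *m z ^t*) = \tr (n *m z' ^t*)) ->
    (forall i, \tr (m *m e i) = \tr (n *m f i)) ->
    P *m m *m P ^t* = Q *m n *m Q ^t*.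

Section SpecialLinear.
Variables (C : numClosedFieldType) (N r k c : nat).
Variables (X : 'M[C]_N) (P Q : 'M[C]_(N, r)) (d : 'rV[C]_r).
Hypotheses (hP : isometry_mx P) (hQ : isometry_mx Q) (d0 : positive_row d).
Hypotheses (eX : X = P *m diag_mx d *m Q ^t*) (Xk : X ^+ k = 0).

Let D := diag_mx d.
Let uD : D \in unitmx. Proof. exact: diag_unit. Qed.
Let aD : D ^t* = D := adjoint_positive_diag d0.
Let G := P ^t* *m Q.
Let M := D *m G ^t*.
Let XP : X *m P = P *m M.
Proof. by rewrite /M /G adjointM trmxCK eX !mulmxA. Qed.
Let XQ : X *m Q = P *m D. Proof. by rewrite eX -mulmxA hQ mulmx1. Qed.

Lemma special_linear_centraliser Z : Z *m X = X *m Z ->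
  exists z z', [/\ Z *m P = P *m z, Q ^t* *m Z = z' *m Q ^t*,
                   z *m D = D *m z' & z *m M = M *m z].
Proof.
move=> cZ; pose z := D *m Q ^t* *m Z *m Q *m invmx D.
pose z' := invmx D *m P ^t* *m Z *m P *m D.
have ZP : Z *m P = P *m z.
  have eP : P = X *m Q *m invmx D by rewrite XQ mulmxK.
  by rewrite {1}eP !mulmxA cZ {1}eX ?mulmxA.
have QZ : Q ^t* *m Z = z' *m Q ^t*.
  have eQ : Q ^t* = invmx D *m P ^t* *m X.
    by rewrite eX !mulmxA -[_ *m P ^t* *m P]mulmxA hP mulmx1 mulVmx // mul1mx.
  by rewrite {1}eQ -(mulmxA _ X) -cZ {1}eX ?mulmxA.
clearbody z z'; exists z, z'; split=> //.
  have : P ^t* *m (Z *m X *m Q) = P ^t* *m (X *m Z *m Q) by rewrite cZ.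
  rewrite -[Z *m X *m Q]mulmxA XQ (mulmxA Z) ZP [in RHS]eX -[_ *m Q ^t* *m Z]mulmxA QZ.
  by rewrite -!mulmxA hQ mulmx1 !(mulmxA (P ^t*)) hP !mul1mx.
have : P ^t* *m (Z *m X *m P) = P ^t* *m (X *m Z *m P) by rewrite cZ.
rewrite -[Z *m X *m P]mulmxA XP (mulmxA Z) ZP -[X *m Z *m P]mulmxA ZP (mulmxA X) XP.
by rewrite -!(mulmxA P) !(mulmxA (P ^t*)) hP !mul1mx.
Qed.

(** For m = n = diag(t) the identities with the centraliser hold.  With more
    than c parameters, some t <> 0 makes P diag(t) P^* = Q diag(t) Q^*, which
    commutes with X and kills its kernel, although X is nilpotent. *)
Lemma special_linear_rank_bound (e f : 'I_c -> 'M[C]_r) :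
  special_linear_directions P Q d e f -> (r <= c)%N.
Proof.
move=> hef; rewrite leqNgt; apply/negP => lt.
pose h (t : 'rV[C]_r) : 'rV[C]_c :=
  \row_i (\tr (diag_mx t *m e i) - \tr (diag_mx t *m f i)).
have lh : linear h.
  move=> x t t'; apply/rowP => i; rewrite !mxE !linearP /= !mulmxDl -!scalemxAl.
  by rewrite !mxtraceD !mxtraceZ mulrBr opprD addrACA.
have [|t t0 ht] := nontrivial_solution lh; first by rewrite !dim_matrix !mul1r.
have eM : P *m diag_mx t *m P ^t* = Q *m diag_mx t *m Q ^t*.
  apply: hef => [z z' zD _|i]; last first.
    by move/rowP/(_ i): ht; rewrite !mxE => /eqP; rewrite subr_eq0 => /eqP.
  have cD : diag_mx t *m D = D *m diag_mx t by rewrite diag_mxC.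
  have zDa : D *m z ^t* = z' ^t* *m D by rewrite -{1}aD -adjointM zD adjointM aD.
  split.
    rewrite -[z](mulmxK uD) zD !mulmxA cD mxtrace_mulC !mulmxA mulVmx //.
    by rewrite mul1mx.
  rewrite -[z ^t*](mulKmx uD) zDa mxtrace_mulC -!mulmxA -cD !mulmxA mxtrace_mulC.
  by rewrite !mulmxA mulmxV // mul1mx mxtrace_mulC.
have /rV0Pn[i ti] := t0.
have pN0 : P *m delta_mx i 0 != 0 :> 'cV_N.
  apply/eqP => /(congr1 (mulmx (P ^t*))); rewrite mulmxA hP mul1mx mulmx0.
  by move/matrixP/(_ i 0)/eqP; rewrite !mxE !eqxx oner_eq0.
move/eqP: pN0; apply.
apply: (@commuting_eigenvector _ _ X (P *m diag_mx t *m P ^t*) k _ (t 0 i)) => //.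
- rewrite [in RHS]eM eX -!mulmxA (mulmxA _ P) hP mul1mx (mulmxA (Q ^t*)) hQ mul1mx.
  by rewrite !(mulmxA (diag_mx _)) diag_mxC.
- move=> v Xv; have Qv : Q ^t* *m v = 0.
    have := congr1 (fun A => invmx D *m (P ^t* *m A)) Xv.
    by rewrite eX -!mulmxA (mulmxA _ P) hP mul1mx mulKmx // !mulmx0.
  by rewrite eM -(mulmxA _ (Q ^t*)) Qv mulmx0.
rewrite -!mulmxA (mulmxA _ P) hP mul1mx scalemxAr; congr (_ *m _).
apply/matrixP => x y; rewrite mul_diag_mx !mxE.
by have [->|] := eqVneq x i; rewrite ?mulr0.
Qed.

End SpecialLinear.

(** If X^2 <> 0, the 2 by 2 matrix G = P^* Q has rank one, say p s p'^*.  The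
    eight unknowns of (m, n) are subject to six equations.  As M is not scalar,
    z is a combination of 1 and M, so three equations give the trace
    identities: tr m = tr n, one for M and one for M^*.  Two more are the
    functionals.  The last one is p^* m p = 0; since P m P^* = Q n Q^* gives m
    = G n G^*, a multiple of p p^*, it makes m and then n vanish. *)
Lemma special_linear_rank_two_sq0 (C : numClosedFieldType) N k (X : 'M[C]_N)
    (P Q : 'M[C]_(N, 2)) (d : 'rV[C]_2) (e f : 'I_2 -> 'M[C]_2) :
  isometry_mx P -> isometry_mx Q -> positive_row d ->
  X = P *m diag_mx d *m Q ^t* -> X ^+ k = 0 -> special_linear_directions P Q d e f -> X *m X = 0.
Proof.
move=> hP hQ d0 eX Xk hef; set D := diag_mx d in eX.
have uD : D \in unitmx by apply: diag_unit.
have aD : D ^t* = D := adjoint_positive_diag d0.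
pose G := P ^t* *m Q; pose M := D *m G ^t*.
have XP : X *m P = P *m M by rewrite /M /G adjointM trmxCK eX !mulmxA.
have Mk : M ^+ k = 0 by apply: compress_nilpotent hP XP Xk.
have [G0|GN0] := eqVneq G 0.
  have -> : X *m X = P *m (M *m D) *m Q ^t* by rewrite {2}eX 2!mulmxA XP !mulmxA.
  by rewrite /M G0 adjoint0 mulmx0 mul0mx mulmx0 mul0mx.
exfalso; have [q [p [p' [s [hp hp' s0 eG]]]]] := svd G.
have us := diag_unit s0.
have Gq : \rank G = q by rewrite eG (rank_sandwich us hp hp').
have q1 : q = 1%N.
  have : (q <= 2)%N by rewrite -Gq rank_leq_row.
  case: q p p' s hp hp' s0 eG us Gq => [|[|[|//]]] p p' s hp hp' s0 eG us Gq _ //.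
    by move: GN0; rewrite eG [p]thinmx0 !mul0mx eqxx.
  have uG : G \in unitmx by rewrite -row_full_unit -col_leq_rank Gq.
  have := nilpotent_not_unit Mk; rewrite /M unitmx_mul uD /= map_unitmx unitmx_tr.
  by rewrite uG.
clear Gq us; subst q.
pose V := ('M[C]_2 * 'M[C]_2)%type.
pose h1 (u : V) : C := \tr u.1 - \tr u.2.
pose h2 (u : V) : C := \tr ((u.1 - D *m u.2 *m invmx D) *m M).
pose h3 (u : V) : C := \tr ((u.1 - invmx D *m u.2 *m D) *m M ^t*).
pose h4 (u : V) : C := (p ^t* *m u.1 *m p) 0 0.
pose h5 (u : V) i : C := \tr (u.1 *m e i) - \tr (u.2 *m f i).
pose h (u : V) : 'rV[C]_((1 + 1) + (1 + 1)) * 'rV[C]_2 :=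
  (row_mx (row_mx (h1 u)%:M (h2 u)%:M) (row_mx (h3 u)%:M (h4 u)%:M), \row_i h5 u i).
have l1 a u v : h1 (a *: u + v) = a * h1 u + h1 v.
  by rewrite /h1 /= !mxtraceD !mxtraceZ mulrBr opprD addrACA.
have l2 a u v : h2 (a *: u + v) = a * h2 u + h2 v.
  rewrite /h2 -mxtraceZ -mxtraceD scalemxAl -mulmxDl; congr (\tr (_ *m _)).
  rewrite -[(a *: u + v).1]/(a *: u.1 + v.1) -[(a *: u + v).2]/(a *: u.2 + v.2).
  by rewrite mulmxDr mulmxDl -scalemxAr -scalemxAl scalerBr opprD addrACA.
have l3 a u v : h3 (a *: u + v) = a * h3 u + h3 v.
  rewrite /h3 -mxtraceZ -mxtraceD scalemxAl -mulmxDl; congr (\tr (_ *m _)).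
  rewrite -[(a *: u + v).1]/(a *: u.1 + v.1) -[(a *: u + v).2]/(a *: u.2 + v.2).
  by rewrite mulmxDr mulmxDl -scalemxAr -scalemxAl scalerBr opprD addrACA.
have l4 a u v : h4 (a *: u + v) = a * h4 u + h4 v.
  rewrite /h4 -[(a *: u + v).1]/(a *: u.1 + v.1).
  by rewrite mulmxDr mulmxDl -scalemxAr -scalemxAl !mxE.
have l5 i a u v : h5 (a *: u + v) i = a * h5 u i + h5 v i.
  rewrite /h5 /= !mulmxDl -!scalemxAl !mxtraceD !mxtraceZ mulrBr opprD.
  by rewrite addrACA.
have lh : linear h.
  move=> a u v.
  have -> : a *: h u + h v = (a *: (h u).1 + (h v).1, a *: (h u).2 + (h v).2) by [].
  congr (_, _); last by apply/rowP => i; rewrite !mxE l5.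
  rewrite l1 l2 l3 l4 /= !scale_row_mx !add_row_mx !scale_scalar_mx.
  by rewrite -!raddfD.
have [|u u0 hu] := nontrivial_solution lh; first by [].
have [e1 e2 e3 e4 e5] : [/\ h1 u = 0, h2 u = 0, h3 u = 0, h4 u = 0 & forall i, h5 u i = 0].
  have sc (x : C) : x%:M = 0 :> 'M_1 -> x = 0.
    by move=> /matrixP/(_ 0 0); rewrite !mxE mulr1n.
  case: hu => /eqP; rewrite !row_mx_eq0 => /andP[/andP[/eqP/sc a1 /eqP/sc a2]].
  move=> /andP[/eqP/sc a3 /eqP/sc a4] /rowP a5; split=> // i.
  by have := a5 i; rewrite !mxE.
have nM : ~~ is_scalar_mx M.
  apply/is_scalar_mxP => -[a eM].
  have [a0|aN0] := eqVneq a 0.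
    move: GN0; rewrite -[G]trmxCK -[G ^t*](mulKmx uD) -/M eM a0.
    by rewrite raddf0 mulmx0 adjoint0 eqxx.
  have := nilpotent_not_unit Mk; rewrite eM -scalemx1 unitmxZ ?unitfE //.
  by rewrite unitmx1.
have eq_mn : P *m u.1 *m P ^t* = Q *m u.2 *m Q ^t*.
  apply: hef => [z z' zD zM|i]; last by have := e5 i; rewrite /h5 => /eqP; rewrite subr_eq0 => /eqP.
  have [a [b ez]] := commutant2 zM nM.
  have ez' : z' = invmx D *m z *m D by rewrite -mulmxA zD mulKmx.
  have eza : z' ^t* = D *m z ^t* *m invmx D.
    by rewrite -(mulmxK uD (z' ^t*)) -{1}aD -adjointM -zD adjointM aD.
  move/subr0_eq: e1 => e1; move: e2 e3; rewrite /h2 /h3 !mulmxBl !(raddfB (@mxtrace C 2)).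
  move=> /subr0_eq e2 /subr0_eq e3; split.
    rewrite ez' mulmxA [RHS]mxtrace_mulC !mulmxA ez !mulmxDr !mxtraceD !mul_mx_scalar.
    rewrite -!scalemxAr !mxtraceZ e2 e1.
    by rewrite [\tr (D *m _ *m _)]mxtrace_mulC !mulmxA mulVmx // mul1mx.
  rewrite eza mulmxA [RHS]mxtrace_mulC !mulmxA ez adjointD adjointZ !mulmxDr !mxtraceD.
  rewrite tr_scalar_mx map_scalar_mx /= !mul_mx_scalar.
  rewrite -!scalemxAr !mxtraceZ e3 e1.
  by rewrite [\tr (invmx D *m _ *m _)]mxtrace_mulC !mulmxA mulmxV // mul1mx.
have u1 : u.1 = G *m u.2 *m G ^t*.
  have := congr1 (fun A => P ^t* *m A *m P) eq_mn.
  rewrite !mulmxA hP mul1mx -mulmxA hP mulmx1 => ->.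
  by rewrite /G adjointM trmxCK !mulmxA.
have u2 : u.2 = G ^t* *m u.1 *m G.
  have := congr1 (fun A => Q ^t* *m A *m Q) eq_mn.
  rewrite !mulmxA hQ mul1mx -[RHS]mulmxA hQ mulmx1 => <-.
  by rewrite /G adjointM trmxCK.
have p10 : p ^t* *m u.1 *m p = 0 by rewrite [LHS]mx11_scalar -/(h4 u) e4 raddf0.
have u10 : u.1 = 0.
  pose x := diag_mx s *m p' ^t* *m u.2 *m p' *m diag_mx s ^t*.
  have ux : u.1 = p *m x *m p ^t*.
    by rewrite u1 eG !adjointM trmxCK /x !mulmxA.
  clearbody x; move: p10; rewrite ux !mulmxA hp mul1mx -mulmxA hp mulmx1 => ->.
  by rewrite mulmx0 mul0mx.
case/eqP: u0; case: u u10 u2 {hu e1 e2 e3 e4 e5 eq_mn u1 p10} => a b /= -> ->.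
by rewrite mulmx0 mul0mx.
Qed.

Lemma special_linear_functionals (R : realType) N r c (X : 'M[R[i]]_N)
    (P Q : 'M[R[i]]_(N, r)) (d : 'rV[R[i]]_r) :
  isometry_mx P -> isometry_mx Q -> positive_row d -> X = P *m diag_mx d *m Q ^t* ->
  compact_orbit_codim Sl X c ->
  exists e f : 'I_c -> 'M[R[i]]_r, special_linear_directions P Q d e f.
Proof.
move=> hP hQ d0 eX hX.
have [E gE hE] := codim_functionals (g := Sl) I hX.
exists (fun i => P ^t* *m E i *m P), (fun i => Q ^t* *m E i *m Q) => m n hmn he.
have trE Z : \tr ((P *m m *m P ^t* - Q *m n *m Q ^t*) *m Z) =
    \tr (m *m (P ^t* *m Z *m P)) - \tr (n *m (Q ^t* *m Z *m Q)).
  by rewrite mulmxBl linearB /= !trace_compress.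
apply/eqP; rewrite -subr_eq0; apply/eqP/hE => [|i]; last by rewrite trE he subrr.
have zE Z z z' : Z *m P = P *m z -> Q ^t* *m Z = z' *m Q ^t* ->
    [/\ P ^t* *m Z *m P = z, Q ^t* *m Z *m Q = z',
        P ^t* *m Z ^t* *m P = z ^t* & Q ^t* *m Z ^t* *m Q = z' ^t*].
  move=> ZP QZ; have e1 : P ^t* *m Z *m P = z by rewrite -mulmxA ZP mulmxA hP mul1mx.
  have e2 : Q ^t* *m Z *m Q = z' by rewrite QZ -mulmxA hQ mulmx1.
  by split=> //; rewrite -?e1 -?e2 !adjointM trmxCK !mulmxA.
split=> [|Z _ cZ].
  have := trE 1%:M; rewrite mulmx1 => /= ->; rewrite !mulmx1 hP hQ.
  have [] := hmn 1%:M 1%:M; rewrite ?mul1mx ?mulmx1 // => -> _.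
  by rewrite subrr.
have [z [z' [ZP QZ zD zM]]] := special_linear_centraliser hP hQ d0 eX cZ; have [h1 h2] := hmn z z' zD zM.
have [e1 e2 e3 e4] := zE Z z z' ZP QZ.
by rewrite !trE e1 e2 e3 e4 h1 h2 !subrr.
Qed.

(** * Normal forms and types of codimension two *)

(** The middle factor of Youla's normal form. *)
Definition skew_diag (C : nzRingType) m (d : 'rV[C]_m) : 'M[C]_(m + m) :=
  block_mx 0 (- diag_mx d) (diag_mx d) 0.

Section NormalForms.
Variable C : numClosedFieldType.

Lemma tr_skew_diag m (d : 'rV[C]_m) : (skew_diag d)^T = - skew_diag d.
Proof.
by rewrite tr_block_mx opp_block_mx !trmx0 linearN /= !tr_diag_mx !oppr0 opprK.
Qed.

Lemma skew_diagE m (d : 'rV[C]_m) :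
  skew_diag d = - (skew_unit C m) *m diag_mx (row_mx d d).
Proof.
rewrite diag_mx_row mulNmx mulmx_block !mul0mx !mulmx0 !mulNmx !mul1mx !add0r !addr0.
by rewrite opp_block_mx !oppr0 opprK.
Qed.

Lemma skew_unit_unit m : skew_unit C m \in unitmx.
Proof.
by suff /mulmx1_unit[] : skew_unit C m *m (- skew_unit C m) = 1%:M;
  rewrite // mulmxN skew_unit_sq opprK.
Qed.

Lemma positive_row_mx2 m (d : 'rV[C]_m) : positive_row d -> positive_row (row_mx d d).
Proof.
by move=> d0 k; rewrite -[k]splitK; case: split => j /=; rewrite ?row_mxEl ?row_mxEr.
Qed.

Lemma skew_diag_unit m (d : 'rV[C]_m) : positive_row d -> skew_diag d \in unitmx.
Proof.
move=> d0; rewrite skew_diagE mulNmx -scaleN1r unitmxZ ?unitrN1 //.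
by rewrite unitmx_mul skew_unit_unit diag_unit //; apply: positive_row_mx2.
Qed.

Lemma skew_diag_comm m (d t : 'rV[C]_m) :
  diag_mx (row_mx t t) *m skew_diag d = skew_diag d *m diag_mx (row_mx t t).
Proof.
rewrite diag_mx_row !mulmx_block !mul0mx !mulmx0 !addr0 !add0r !mulmxN !mulNmx.
by rewrite diag_mxC.
Qed.

Variables (n : nat) (F X : 'M[C]_n).
Hypotheses (FF' : F *m F ^t* = 1%:M) (XF : X^T *m F + F *m X = 0).

Let F'F : F ^t* *m F = 1%:M. Proof. exact: mulmx1C. Qed.
Let uF : F \in unitmx. Proof. by case/mulmx1_unit: FF'. Qed.

Let trT : (X *m F ^t*)^T = - (F^c *m F *m X *m F ^t*).
Proof.
rewrite trmx_mul map_trmx trmxK -!mulmxA -mulmxN; congr (_ *m _).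
move/eqP: XF; rewrite addr_eq0 => /eqP h.
by rewrite mulmxA -[F *m X]opprK -h mulNmx opprK -mulmxA FF' mulmx1.
Qed.

(** X F^* is symmetric. *)
Lemma symplectic_normal_form : F^T = - F -> exists r (Q : 'M[C]_(n, r)) (d : 'rV[C]_r),
  [/\ isometry_mx Q, positive_row d, X = Q *m diag_mx d *m Q^T *m F & \rank X = r].
Proof.
move=> aF; have [|r [Q [d [hQ d0 eT]]]] := takagi (T := X *m F ^t*).
  rewrite trT; have -> : F^c = - F ^t* by rewrite aF map_mxN opprK.
  by rewrite !mulNmx opprK F'F mul1mx.
have eX : X = Q *m diag_mx d *m Q^T *m F by rewrite -eT -mulmxA F'F mulmx1.
exists r, Q, d; split=> //; rewrite eX mxrankMfree ?row_free_unit //.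
by rewrite (rank_sandwich (diag_unit d0) hQ (isometry_conj hQ)).
Qed.

(** X F^* is antisymmetric. *)
Lemma orthogonal_normal_form : F^T = F -> exists m (Q : 'M[C]_(n, m + m)) (d : 'rV[C]_m),
  [/\ isometry_mx Q, positive_row d, X = Q *m skew_diag d *m Q^T *m F &
      \rank X = (m + m)%N].
Proof.
move=> sF; have [|m [U [W [d [hQ d0 eT]]]]] := youla (T := X *m F ^t*).
  rewrite trT; have -> : F^c = F ^t* by rewrite sF.
  by rewrite F'F mul1mx.
have eX : X = row_mx U W *m skew_diag d *m (row_mx U W)^T *m F.
  rewrite mul_row_block !mulmx0 add0r addr0 tr_row_mx mul_row_col mulmxN mulNmx.
  by rewrite -eT -mulmxA F'F mulmx1.
exists m, (row_mx U W), d; split=> //; rewrite {1}eX mxrankMfree ?row_free_unit //.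
by rewrite (rank_sandwich (skew_diag_unit d0) hQ (isometry_conj hQ)).
Qed.

End NormalForms.

Section Classification.
Variables (R : realType) (N k : nat).
Local Notation C := R[i].
Variables (g : classical_type R N) (X : 'M[C]_N).
Hypotheses (Hg : ambient_form g) (gX : complex_algebra g X) (Xk : X ^+ k = 0).
Hypothesis hX : compact_orbit_codim g X 2.

(** In so the matrices diag(t, t) are symmetric for the middle factor of
    Youla's form, which bounds half of the rank; in sl and sp diagonal matrices
    bound the rank itself. *)
Lemma codim_two_type :
  match g with
  | So _ => (\rank X <= 4)%N /\ (X *m X = 0 \/ (\rank X <= 2)%N)
  | _ => (\rank X <= 2)%N /\ X *m X = 0
  end.
Proof.
case: g Hg gX hX => [|F|F] hg gY hY.
- have [r [P [Q [d [hP hQ d0 eX]]]]] := svd X.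
  have [e [f hef]] := special_linear_functionals hP hQ d0 eX hY.
  have r2 : (r <= 2)%N := special_linear_rank_bound hP hQ d0 eX Xk hef.
  have rX : \rank X = r by rewrite eX (rank_sandwich (diag_unit d0) hP hQ).
  rewrite rX; split=> //.
  case: r P Q d hP hQ d0 eX e f hef r2 rX =>
    [|[|[|//]]] P Q d hP hQ d0 eX e f hef _ _.
  + by rewrite eX [P]thinmx0 !mul0mx.
  + pose M := diag_mx d *m (P ^t* *m Q) ^t*.
    have XP : X *m P = P *m M by rewrite /M adjointM trmxCK eX !mulmxA.
    have /nilpotent_not_unit := compress_nilpotent hP XP Xk.
    rewrite [M]mx11_scalar -scalemx1 unitmxE detZ det1 mulr1 expr1 unitfE negbK.
    move=> /eqP M0; rewrite {2}eX 2!mulmxA XP [M]mx11_scalar M0 raddf0.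
    by rewrite mulmx0 !mul0mx.
  + exact: (special_linear_rank_two_sq0 hP hQ d0 eX Xk hef).
- have [_ F'F FF'] := ambient_formE hg erefl.
  have [sF _ _] := compatible_formE hg; rewrite expr0 scale1r in sF.
  have [m [Q [d [hQ d0 eX rX]]]] := orthogonal_normal_form FF' gY sF.
  have uD := skew_diag_unit d0.
  have m2 : (m <= 2)%N.
    pose phi (t : 'rV[C]_m) : 'rV[C]_(m + m) := row_mx t t.
    have lphi : linear phi by move=> a u v; rewrite /phi scale_row_mx add_row_mx.
    pose phiL := GRing.isLinear.Build C _ _ *:%R phi lphi.
    pose Phi : {linear 'rV[C]_m -> 'rV[C]_(m + m)} := HB.pack phi phiL.
    apply: (diagonal_family_bound hg erefl hQ uD eX hY (fun _ h => h) Xk (phi := Phi)).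
    + by move=> t t' /eq_row_mx[].
    + by move=> t; apply: skew_diag_comm.
    + by move=> t; rewrite map_row_mx.
  rewrite rX; split; first by lia.
  case: m Q d hQ d0 eX rX uD m2 => [|[|[|//]]] Q d hQ d0 eX rX uD _; [by right | by right |].
  left; apply: (orthogonal_rank_four_sq0 hg erefl sF Xk hQ uD _ eX hY).
  exact: tr_skew_diag.
- have [_ F'F FF'] := ambient_formE hg erefl.
  have [sF _ _] := compatible_formE hg; rewrite expr1 scaleN1r in sF.
  have [r [Q [d [hQ d0 eX rX]]]] := symplectic_normal_form FF' gY sF.
  have r2 : (r <= 2)%N.
    apply: (diagonal_family_bound hg erefl hQ (diag_unit d0) eX hY (fun _ h => h) Xk
      (phi := idfun)) => // t; exact: diag_mxC.
  by rewrite rX; split=> //; apply: (symplectic_rank_two_sq0 sF hQ d0 r2 eX Xk).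
Qed.

End Classification.

(** * Potential of elements of square zero *)

Lemma mulmx_dim0 (C : pzRingType) m n p (A : 'M[C]_(m, n)) (B : 'M[C]_(n, p)) :
  n = 0%N -> A *m B = 0.
Proof. by move=> n0; subst n; rewrite [A]thinmx0 mul0mx. Qed.

Lemma cV_dim0 (C : pzRingType) n (u v : 'cV[C]_n) : n = 0%N -> u = v.
Proof. by move=> n0; subst n; rewrite [u]flatmx0 [v]flatmx0. Qed.

(** The square of a a^* is a b b^* a^* = X X^* for X = a b, hence a a^* = P
    diag(d) P^*. *)
Lemma balanced_trace (C : numClosedFieldType) N m n (a : 'M[C]_(N, m)) (b : 'M[C]_(m, N))
    (P : 'M[C]_(N, n)) (d : 'rV[C]_n) :
  isometry_mx P -> positive_row d -> b *m b ^t* = a ^t* *m a ->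
  a *m b *m (a *m b) ^t* = P *m diag_mx d *m diag_mx d *m P ^t* ->
  \tr (a ^t* *m a) = \sum_i d 0 i.
Proof.
move=> hP d0 bb eXX; have [s s0 s2] := diag_sqrt d0.
have sa : (diag_mx s) ^t* = diag_mx s := adjoint_positive_diag s0.
have eS : a *m a ^t* = (P *m diag_mx s) *m (P *m diag_mx s) ^t*.
  apply: psd_sqrt_unique; rewrite adjointM sa !mulmxA -[_ *m P ^t* *m P]mulmxA hP.
  rewrite mulmx1 -(mulmxA P (diag_mx s)) -s2 -(mulmxA (P *m diag_mx d)) -s2 -eXX.
  by rewrite adjointM -!mulmxA (mulmxA b) bb !mulmxA.
rewrite mxtrace_mulC eS adjointM sa !mulmxA -(mulmxA P) -s2 mxtrace_mulC mulmxA hP.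
by rewrite mul1mx mxtrace_diag.
Qed.

Section Fibres.
Variables (R : realType) (N : nat).
Local Notation C := R[i].
Variables (A : 'M[C]_N) (g : classical_type R N).
Variable W : forall j : nat, 'M[C]_(vdim A j).
Implicit Types (X : 'M[C]_N) (p : quiver_rep A).

Lemma hk_potentialE k X (v : R) : (exists p, hk_fibre k g W X p) ->
  (forall p, hk_fibre k g W X p -> norm_sq k p = v) -> hk_potential k g W X = v.
Proof.
move=> [p hp] h; have : [set norm_sq k p | p in hk_fibre k g W X]%classic (norm_sq k p).
  by exists p.
by rewrite /hk_potential => /(xgetI 0) [q hq <-]; apply: h.
Qed.

(** A representation that lives on V_k, V_(k-1) and V_(k-2). *)
Definition short_rep (a0 : 'M[C]_(vdim A 0, vdim A 1)) (b0 : 'M[C]_(vdim A 1, vdim A 0))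
    (a1 : 'M[C]_(vdim A 1, vdim A 2)) (b1 : 'M[C]_(vdim A 2, vdim A 1)) :
  quiver_rep A :=
  QuiverRep (fun j => match j with 0%N => a0 | 1%N => a1 | _ => 0 end)
            (fun j => match j with 0%N => b0 | 1%N => b1 | _ => 0 end).

Lemma two_step_norm X p n (P : 'M[C]_(N, n)) (d : 'rV[C]_n) :
  A ^+ 2 = 0 -> hk_fibre 2 g W X p -> isometry_mx P -> positive_row d ->
  X *m X ^t* = P *m diag_mx d *m diag_mx d *m P ^t* ->
  norm_sq 2 p = complex.Re (\sum_i d 0 i) *+ 2.
Proof.
move=> A2 [_ /(_ 0%N erefl) [m1 m2] _ eX] hP d0 eXX.
have v2 : vdim A 2 = 0%N by rewrite /vdim A2 mxrank0.
move: m2; rewrite (mulmx_dim0 (alpha p 1) _ v2) (mulmx_dim0 ((beta p 1) ^t*) _ v2).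
rewrite subrr add0r => /subr0_eq m2; rewrite -eX in eXX.
have tra := balanced_trace hP d0 m2 eXX.
rewrite /norm_sq big_ord_recl big_ord0 addr0 m2 mxtraceD -tra ReD -mulr2n.
by [].
Qed.

Lemma two_step_fibre X a b :
  A ^+ 2 = 0 -> (forall a1 b1, flat_space 2 g W (short_rep a b a1 b1)) ->
  a *m b = X -> b *m a = 0 -> b *m b ^t* = a ^t* *m a ->
  (exists l, l *m a = 1%:M) -> (exists r, b *m r = 1%:M) ->
  exists p, hk_fibre 2 g W X p.
Proof.
move=> A2 flat ab ba m2 [l la] [r br]; exists (short_rep a b 0 0).
have v2 : vdim A 2 = 0%N by rewrite /vdim A2 mxrank0.
split=> // j jk.
  have -> : j = 0%N by lia.
  by rewrite /= ba !mul0mx trmx0 map_mx0 mul0mx m2 subr0 add0r subrr.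
have [->|->] /= : j = 0%N \/ j = 1%N by lia.
  split=> [u v /(congr1 (mulmx l))|w]; first by rewrite !mulmxA la !mul1mx.
  by exists (r *m w); rewrite mulmxA br mul1mx.
split=> [u v _|w]; first exact: cV_dim0.
by exists 0; apply: cV_dim0.
Qed.

End Fibres.

(** For two numbers y and z both sides of the equation are 4 y^2 z^2. *)
Lemma two_power_sums (R : realType) r (x : 'I_r -> R) :
  (r <= 2)%N -> (forall i, 0 <= x i) ->
  let s j := \sum_i x i ^+ j in
  0 <= s 1%N ^+ 2 - s 2%N /\ (s 1%N ^+ 2 - s 2%N) ^+ 2 = 2 * (s 2%N ^+ 2 - s 4%N).
Proof.
case: r x => [|[|[|//]]] x _ x0 s; rewrite {}/s.
- by rewrite !big_ord0 !expr0n /= !subrr !expr0n /= mulr0.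
- rewrite !big_ord_recl !big_ord0 !addr0 expr1; split; last by ring.
  by rewrite subrr lexx.
rewrite !big_ord_recl !big_ord0 !addr0 !expr1.
set y := x _; set z := x _; have y0 : 0 <= y by apply: x0.
have z0 : 0 <= z by apply: x0.
split; last by ring.
have -> : (y + z) ^+ 2 - (y ^+ 2 + z ^+ 2) = 2 * (y * z) by ring.
by rewrite !mulr_ge0.
Qed.

Lemma trace_commutator_sq (C : comPzRingType) N (A B : 'M[C]_N) :
  \tr ((A *m B - B *m A) *m (A *m B - B *m A)) =
  (\tr (A *m B *m (A *m B)) - \tr (A *m A *m (B *m B))) *+ 2.
Proof.
have e1 : \tr (B *m A *m (B *m A)) = \tr (A *m B *m (A *m B)).
  by rewrite -mulmxA mxtrace_mulC !mulmxA.
have e2 : \tr (A *m B *m (B *m A)) = \tr (A *m A *m (B *m B)).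
  by rewrite mulmxA mxtrace_mulC !mulmxA.
have e3 : \tr (B *m A *m (A *m B)) = \tr (A *m A *m (B *m B)).
  by rewrite -mulmxA mxtrace_mulC !mulmxA.
have sq (P Q : 'M[C]_N) : \tr ((P - Q) *m (P - Q)) =
    \tr (P *m P) - \tr (P *m Q) - (\tr (Q *m P) - \tr (Q *m Q)).
  by rewrite mulmxBl !mulmxBr !(raddfB (@mxtrace C N)).
rewrite sq [X in _ - X - _]e2 [X in _ - (X - _)]e3 [X in _ - (_ - X)]e1.
by ring.
Qed.

Lemma gram_power_traces (C : numClosedFieldType) N n (S : 'M[C]_N) (P : 'M[C]_(N, n))
    (d : 'rV[C]_n) : isometry_mx P -> S = P *m diag_mx d *m diag_mx d *m P ^t* ->
  \tr S = \sum_i d 0 i ^+ 2 /\ \tr (S *m S) = \sum_i d 0 i ^+ 4.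
Proof.
move=> hP eS; split.
  rewrite eS mxtrace_mulC !mulmxA hP mul1mx mulmx_diag mxtrace_diag.
  by apply: eq_bigr => i _; rewrite mxE expr2.
have -> : S *m S = P *m (diag_mx d *m diag_mx d *m (diag_mx d *m diag_mx d)) *m P ^t*.
  by rewrite eS !mulmxA -(mulmxA _ (P ^t*)) hP mulmx1.
rewrite mxtrace_mulC !mulmxA hP mul1mx !mulmx_diag mxtrace_diag.
by apply: eq_bigr => i _; rewrite !mxE !exprSr expr0 mul1r.
Qed.

Lemma c2_commutator (R : realType) N (X : 'M[R[i]]_N) : c2 X = complex.Re
  ((\tr (X *m X ^t* *m (X *m X ^t*)) - \tr (X *m X *m (X *m X) ^t*)) *+ 2).
Proof.
by rewrite /c2 /lie_bracket adjointB !adjointM trmxCK trace_commutator_sq.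
Qed.

Section Invariants.
Variables (R : realType) (N n : nat).
Local Notation C := R[i].
Variables (X : 'M[C]_N) (P : 'M[C]_(N, n)) (d : 'rV[C]_n).
Hypotheses (hP : isometry_mx P) (d0 : positive_row d).
Hypothesis eXX : X *m X ^t* = P *m diag_mx d *m diag_mx d *m P ^t*.

Lemma Re_power_sum j :
  complex.Re (\sum_i d 0 i ^+ j) = \sum_i complex.Re (d 0 i) ^+ j.
Proof.
rewrite Re_sum; apply: eq_bigr => i _.
have /RRe_real {1}<- : d 0 i \is Num.real by rewrite gtr0_real.
by rewrite -rmorphXn.
Qed.

Lemma positive_row_Re i : 0 <= complex.Re (d 0 i).
Proof. by have := ltW (d0 i); rewrite lecE => /andP[]. Qed.

Lemma c1E : c1 X = \sum_i complex.Re (d 0 i) ^+ 2.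
Proof. by have [e _] := gram_power_traces hP eXX; rewrite /c1 e Re_power_sum. Qed.

Lemma c2E : X *m X = 0 -> c2 X = 2 * \sum_i complex.Re (d 0 i) ^+ 4.
Proof.
move=> XX; have [_ e] := gram_power_traces hP eXX.
by rewrite c2_commutator XX mul0mx mxtrace0 subr0 e mulr2n ReD Re_power_sum // mulr_natl mulr2n.
Qed.

End Invariants.

Section TwoStep.
Variables (R : realType) (N : nat).
Local Notation C := R[i].
Variables (A : 'M[C]_N) (g : classical_type R N).
Variables (W : forall j : nat, 'M[C]_(vdim A j)) (X : 'M[C]_N).
Hypotheses (A2 : A ^+ 2 = 0) (XX : X *m X = 0).
Hypothesis fibre : exists p, hk_fibre 2 g W X p.

Lemma two_step_formula1 n (P : 'M[C]_(N, n)) (d : 'rV[C]_n) :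
  kappa g = 1 -> (n <= 2)%N -> isometry_mx P -> positive_row d ->
  X *m X ^t* = P *m diag_mx d *m diag_mx d *m P ^t* ->
  hk_potential 2 g W X ^+ 2 =
    4 * kappa g * c1 X + 4 * kappa g * Num.sqrt (2 * c1 X ^+ 2 - kappa g * c2 X).
Proof.
move=> -> n2 hP d0 eXX.
rewrite (hk_potentialE fibre (fun p hp => two_step_norm A2 hp hP d0 eXX)).
rewrite (c1E hP d0 eXX) (c2E hP d0 eXX XX).
have -> : complex.Re (\sum_i d 0 i) = \sum_i complex.Re (d 0 i) ^+ 1.
  by rewrite -Re_power_sum //; congr complex.Re; apply: eq_bigr => i _; rewrite expr1.
set s1 := \sum_i _ ^+ 1; set s2 := \sum_i _ ^+ 2; set s4 := \sum_i _ ^+ 4.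
have [h0 h] : 0 <= s1 ^+ 2 - s2 /\ (s1 ^+ 2 - s2) ^+ 2 = 2 * (s2 ^+ 2 - s4).
  exact: two_power_sums n2 (positive_row_Re d0).
have -> : 2 * s2 ^+ 2 - 1 * (2 * s4) = (s1 ^+ 2 - s2) ^+ 2 by rewrite h; ring.
rewrite sqrtr_sqr ger0_norm //; ring.
Qed.

Lemma two_step_formula2 m (P : 'M[C]_(N, m + m)) (e : 'rV[C]_m) :
  kappa g = 2 -> (m <= 2)%N -> isometry_mx P -> positive_row e ->
  let d := row_mx e e in
  X *m X ^t* = P *m diag_mx d *m diag_mx d *m P ^t* ->
  hk_potential 2 g W X ^+ 2 =
    4 * kappa g * c1 X + 4 * kappa g * Num.sqrt (2 * c1 X ^+ 2 - kappa g * c2 X).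
Proof.
move=> -> m2 hP e0 d eXX; have d0 : positive_row d := positive_row_mx2 e0.
rewrite (hk_potentialE fibre (fun p hp => two_step_norm A2 hp hP d0 eXX)).
rewrite (c1E hP d0 eXX) (c2E hP d0 eXX XX).
have dbl j : \sum_i complex.Re (d 0 i) ^+ j = 2 * \sum_i complex.Re (e 0 i) ^+ j.
  rewrite big_split_ord /= mulr_natl mulr2n; congr (_ + _); apply: eq_bigr => i _.
    by rewrite row_mxEl.
  by rewrite row_mxEr.
have -> : complex.Re (\sum_i d 0 i) = 2 * \sum_i complex.Re (e 0 i) ^+ 1.
  by rewrite -dbl -Re_power_sum //; congr complex.Re; apply: eq_bigr => i _; rewrite expr1.
rewrite !dbl.
set s1 := \sum_i _ ^+ 1; set s2 := \sum_i _ ^+ 2; set s4 := \sum_i _ ^+ 4.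
have [h0 h] : 0 <= s1 ^+ 2 - s2 /\ (s1 ^+ 2 - s2) ^+ 2 = 2 * (s2 ^+ 2 - s4).
  exact: two_power_sums m2 (positive_row_Re e0).
have -> : 2 * (2 * s2) ^+ 2 - 2 * (2 * (2 * s4)) = (2 * (s1 ^+ 2 - s2)) ^+ 2.
  by rewrite [in RHS]exprMn h; ring.
rewrite sqrtr_sqr ger0_norm ?mulr_ge0 //; ring.
Qed.

End TwoStep.

(** X^2 = P D (P^T F P) D P^T F with D invertible. *)
Lemma square_zero_isotropic (C : numClosedFieldType) N r (F X : 'M[C]_N)
    (P : 'M[C]_(N, r)) (D : 'M[C]_r) :
  F *m F ^t* = 1%:M -> isometry_mx P -> D \in unitmx ->
  X = P *m D *m P^T *m F -> X *m X = 0 -> P^T *m F *m P = 0.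
Proof.
move=> FF' hP uD eX XX; have PPc := isometry_conj hP.
have : P ^t* *m (X *m X) *m (F ^t* *m P^c) = 0 by rewrite XX mulmx0 mul0mx.
rewrite {2}eX !mulmxA -(mulmxA _ F) FF' mulmx1 -(mulmxA _ P^T P^c) PPc mulmx1.
rewrite eX !mulmxA hP mul1mx => h.
have := congr1 (fun B => invmx D *m B *m invmx D) h.
by rewrite mulmx0 mul0mx mulmxA mulmxK // -!mulmxA mulKmx.
Qed.

Section FormFibre.
Variables (C : numClosedFieldType) (N n r : nat) (F X : 'M[C]_N) (P : 'M[C]_(N, r)) (s : 'rV[C]_r).
Variables (K : 'M[C]_r) (V : 'M[C]_(n, r)) (Wf : 'M[C]_n).
Hypotheses (FF' : F *m F ^t* = 1%:M) (hP : isometry_mx P) (s0 : positive_row s).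
Hypotheses (KK : K ^t* *m K = 1%:M) (Ks : K *m diag_mx s = diag_mx s *m K).
Hypotheses (V1 : V ^t* *m V = 1%:M) (V2 : V *m V ^t* = 1%:M).
Hypothesis eW : V^T *m Wf *m V = K.
Hypothesis eX : X = P *m K ^t* *m diag_mx s *m diag_mx s *m P^T *m F.

Let a := P *m diag_mx s *m V ^t*.

(** V is an orthonormal basis in which the form Wf has the matrix K. *)
Lemma adapted_form_inverse : invmx Wf = V *m K ^t* *m V^T.
Proof.
have KK' : K *m K ^t* = 1%:M by apply: mulmx1C.
have V2c : V^c *m V^T = 1%:M by rewrite -[V^T]conj_adjoint -map_mxM V2 map_mx1.
have eWf : Wf = V^c *m K *m V ^t*.
  by rewrite -eW !mulmxA V2c mul1mx -mulmxA V2 mulmx1.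
have e : Wf *m (V *m K ^t* *m V^T) = 1%:M.
  rewrite eWf !mulmxA -[_ *m V ^t* *m V]mulmxA V1 mulmx1 -[_ *m K *m K ^t*]mulmxA KK'.
  by rewrite mulmx1.
have [uW _] := mulmx1_unit e.
by rewrite -[LHS]mulmx1 -e mulKmx.
Qed.

Let b := invmx Wf *m a^T *m F.

Lemma adapted_form_adjoint : b = V *m K ^t* *m diag_mx s *m P^T *m F.
Proof.
have V1c : V^T *m V^c = 1%:M by rewrite -[V^T]conj_adjoint -map_mxM V1 map_mx1.
rewrite /b adapted_form_inverse /a !trmx_mul tr_diag_mx map_trmx trmxK !mulmxA.
by rewrite -[_ *m V^T *m V^c]mulmxA V1c mulmx1.
Qed.

Let sa : (diag_mx s) ^t* = diag_mx s := adjoint_positive_diag s0.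

Let Kas : K ^t* *m diag_mx s = diag_mx s *m K ^t*.
Proof. by rewrite -{1}sa -adjointM -Ks adjointM sa. Qed.

Lemma adapted_mul : a *m b = X.
Proof.
rewrite adapted_form_adjoint eX /a !mulmxA -[_ *m V ^t* *m V]mulmxA V1 mulmx1.
by rewrite -[P *m _ *m K ^t*]mulmxA -Kas !mulmxA.
Qed.

Lemma adapted_balance : b *m b ^t* = a ^t* *m a.
Proof.
have KK' : K *m K ^t* = 1%:M by apply: mulmx1C.
have PPc : P^T *m P^c = 1%:M by apply: isometry_conj.
have eb : b ^t* = F ^t* *m P^c *m (diag_mx s *m K *m V ^t*).
  rewrite adapted_form_adjoint !adjointM (trmxCK K) sa (trmxK P).
  by rewrite !mulmxA.
have -> : b *m b ^t* = V *m (K ^t* *m diag_mx s) *m (diag_mx s *m K *m V ^t*).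
  rewrite eb adapted_form_adjoint !mulmxA -(mulmxA _ F (F ^t*)) FF' mulmx1.
  by rewrite -(mulmxA _ P^T P^c) PPc mulmx1.
rewrite -Ks Kas -!mulmxA (mulmxA (K ^t*) K) KK mul1mx /a !adjointM trmxCK sa.
by rewrite -!mulmxA (mulmxA (P ^t*)) hP mul1mx.
Qed.

Lemma adapted_left_inverse : exists l, l *m a = 1%:M.
Proof.
exists (V *m invmx (diag_mx s) *m P ^t*); rewrite /a -!mulmxA (mulmxA (P ^t*)) hP.
by rewrite mul1mx mulKmx ?diag_unit.
Qed.

Lemma adapted_right_inverse : exists l, b *m l = 1%:M.
Proof.
exists (F ^t* *m P^c *m invmx (diag_mx s) *m K *m V ^t*).
rewrite adapted_form_adjoint -!mulmxA (mulmxA F) FF' mul1mx (mulmxA P^T) isometry_conj //.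
by rewrite mul1mx mulKVmx ?diag_unit // (mulmxA _ K) KK mul1mx.
Qed.

Lemma adapted_isotropic : X *m X = 0 -> b *m a = 0.
Proof.
move=> XX; have KK' : K *m K ^t* = 1%:M by apply: mulmx1C.
have [_ uK] := mulmx1_unit KK'; have us := diag_unit s0.
have uD : K ^t* *m (diag_mx s *m diag_mx s) \in unitmx by rewrite !unitmx_mul uK us.
have eX' : X = P *m (K ^t* *m (diag_mx s *m diag_mx s)) *m P^T *m F.
  by rewrite eX !mulmxA.
have PFP := square_zero_isotropic FF' hP uD eX' XX.
have -> : b *m a = V *m K ^t* *m diag_mx s *m (P^T *m F *m P) *m diag_mx s *m V ^t*.
  by rewrite adapted_form_adjoint /a !mulmxA.
by rewrite PFP mulmx0 !mul0mx.
Qed.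

Lemma adapted_gram :
  X *m X ^t* = P *m (diag_mx s *m diag_mx s) *m (diag_mx s *m diag_mx s) *m P ^t*.
Proof.
have PPc : P^T *m P^c = 1%:M by apply: isometry_conj.
have eXa : X ^t* = F ^t* *m P^c *m (diag_mx s *m diag_mx s *m K *m P ^t*).
  by rewrite eX !adjointM (trmxCK K) sa (trmxK P) !mulmxA.
have -> : X *m X ^t* =
    P *m (K ^t* *m diag_mx s) *m diag_mx s *m (diag_mx s *m diag_mx s *m K *m P ^t*).
  rewrite eXa eX !mulmxA -(mulmxA _ F (F ^t*)) FF' mulmx1.
  by rewrite -(mulmxA _ P^T P^c) PPc mulmx1.
rewrite Kas !mulmxA -(mulmxA _ (K ^t*)) Kas !mulmxA -(mulmxA _ (K ^t*)) Kas !mulmxA.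
by rewrite -(mulmxA _ (K ^t*)) Kas !mulmxA -(mulmxA _ (K ^t*)) KK mulmx1.
Qed.

End FormFibre.

Lemma square_zero_factor (C : numClosedFieldType) N n r (X : 'M[C]_N)
    (P Q : 'M[C]_(N, r)) (d : 'rV[C]_r) :
  n = r -> isometry_mx P -> isometry_mx Q -> positive_row d ->
  X = P *m diag_mx d *m Q ^t* -> X *m X = 0 ->
  exists (a : 'M[C]_(N, n)) (b : 'M[C]_(n, N)),
    [/\ a *m b = X, b *m a = 0, b *m b ^t* = a ^t* *m a &
        (exists l, l *m a = 1%:M) /\ (exists l, b *m l = 1%:M)].
Proof.
move=> -> hP hQ d0 eX XX; have ud := diag_unit d0.
have [s s0 ed] := diag_sqrt d0; have us := diag_unit s0.
have sa : (diag_mx s) ^t* = diag_mx s := adjoint_positive_diag s0.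
have QP : Q ^t* *m P = 0.
  have : invmx (diag_mx d) *m P ^t* *m (X *m X) *m Q *m invmx (diag_mx d) = 0.
    by rewrite XX mulmx0 !mul0mx.
  rewrite eX !mulmxA -(mulmxA _ (P ^t*)) hP mulmx1 mulVmx // mul1mx.
  by rewrite -(mulmxA _ (Q ^t*) Q) hQ mulmx1 mulmxK.
exists (P *m diag_mx s), (diag_mx s *m Q ^t*); split.
- by rewrite eX ed !mulmxA.
- by rewrite !mulmxA -(mulmxA _ (Q ^t*)) QP mulmx0 mul0mx.
- rewrite !adjointM trmxCK sa !mulmxA -(mulmxA _ (Q ^t*)) hQ mulmx1.
  by rewrite -(mulmxA _ (P ^t*)) hP mulmx1.
split.
  exists (invmx (diag_mx s) *m P ^t*).
  by rewrite !mulmxA -(mulmxA _ (P ^t*)) hP mulmx1 mulVmx.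
exists (Q *m invmx (diag_mx s)).
by rewrite !mulmxA -(mulmxA _ (Q ^t*)) hQ mulmx1 mulmxV.
Qed.

Section TwoStepExistence.
Variables (R : realType) (N : nat).
Local Notation C := R[i].
Variables (A X : 'M[C]_N) (g : classical_type R N).
Variable W : forall j : nat, 'M[C]_(vdim A j).
Hypotheses (A2 : A ^+ 2 = 0) (XX : X *m X = 0).

(** The map a is the square root of the normal form of X, written in the basis
    V of V_(k-1) in which the form of that space is K: the identity for sp and
    the standard symplectic matrix for so. *)
Lemma form_two_step_fibre r F (P : 'M[C]_(N, r)) (s : 'rV[C]_r) (K : 'M[C]_r)
    (V : 'M[C]_(vdim A 1, r)) :
  form_of g = Some F -> W 0%N = F -> F *m F ^t* = 1%:M ->
  isometry_mx P -> positive_row s ->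
  K ^t* *m K = 1%:M -> K *m diag_mx s = diag_mx s *m K ->
  V ^t* *m V = 1%:M -> V *m V ^t* = 1%:M -> V^T *m W 1 *m V = K ->
  X = P *m K ^t* *m diag_mx s *m diag_mx s *m P^T *m F ->
  exists p, hk_fibre 2 g W X p.
Proof.
move=> gF W0 FF' hP s0 KK Ks V1 V2 eW eX.
apply: (@two_step_fibre _ _ _ _ _ _ (P *m diag_mx s *m V ^t*)
  (dagger (W 1) F (P *m diag_mx s *m V ^t*)) A2) => //.
- move=> a1 b1; case: g gF => [|F'|F'] //= [eF] [|j] //= _;
  by rewrite -W0.
- exact: (adapted_mul s0 KK Ks V1 V2 eW eX).
- exact: (adapted_isotropic FF' hP s0 KK V1 V2 eW eX XX).
- exact: (adapted_balance FF' hP s0 KK Ks V1 V2 eW).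
- exact: (adapted_left_inverse hP s0 V2).
- exact: (adapted_right_inverse FF' hP s0 KK V1 V2 eW).
Qed.

Lemma special_linear_two_step_fibre r (P Q : 'M[C]_(N, r)) (d : 'rV[C]_r) :
  g = Sl -> vdim A 1 = r -> isometry_mx P -> isometry_mx Q -> positive_row d ->
  X = P *m diag_mx d *m Q ^t* -> exists p, hk_fibre 2 g W X p.
Proof.
move=> gS er hP hQ d0 eX.
have [a [b [ab ba bb [la rb]]]] := square_zero_factor er hP hQ d0 eX XX.
by apply: (two_step_fibre A2 _ ab ba bb la rb); rewrite gS.
Qed.

End TwoStepExistence.

(** * Norm of three-step representations *)

Section Adjugate.
Variable C : numClosedFieldType.

(** For 2 by 2 matrices the adjugate tr M - M is the adjoint for the standard
    skew form. *)
Lemma skew_unit_adjugate (M : 'M[C]_(1 + 1)) :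
  M^T *m skew_unit C 1 = skew_unit C 1 *m ((\tr M)%:M - M).
Proof.
rewrite -[M]submxK mxtrace_block tr_block_mx (scalar_mx_block 1 1) opp_block_mx.
rewrite add_block_mx !mulmx_block !mulmx0 !mul0mx !mulmxN !mulNmx !mulmx1 !mul1mx.
rewrite !add0r !addr0 (mx11_scalar (ulsubmx M)) (mx11_scalar (dlsubmx M)).
rewrite (mx11_scalar (ursubmx M)) (mx11_scalar (drsubmx M)) !tr_scalar_mx.
by rewrite !mxtrace_scalar !mulr1n raddfD /= opprK addrK [X in X - _]addrC addrK.
Qed.

Lemma antisym2_adjugate (K M : 'M[C]_(1 + 1)) : K^T = - K -> K \in unitmx ->
  invmx K *m M^T *m K = (\tr M)%:M - M.
Proof.
move=> aK uK; have eK := antisym2E aK; set x := K _ _ in eK.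
rewrite -[RHS](mulKmx uK) -mulmxA; congr (_ *m _).
by rewrite eK -scalemxAr skew_unit_adjugate scalemxAl.
Qed.

End Adjugate.

Section ThreeStepValues.
Variables (R : realType) (N : nat).
Local Notation C := R[i].

Lemma invmx_isometry n (U : 'M[C]_n) : U ^t* *m U = 1%:M -> invmx U = U ^t*.
Proof.
move=> UU; have [_ uU] := mulmx1_unit UU.
by rewrite -[LHS]mul1mx -UU mulmxK.
Qed.

Lemma balance_solve n (G K : 'M[C]_n) (e c : C) :
  K - (e%:M - K) + ((e + c *+ 2)%:M - G) - G = 0 -> G = K + c%:M.
Proof.
have eqr (x y x' y' : C) : x' = y' -> x - y = x' - y' -> x = y.
  by move=> -> /eqP; rewrite subrr subr_eq0 => /eqP.
have two0 : (2 : C) != 0 by rewrite pnatr_eq0.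
move=> /matrixP mom; apply/matrixP => i j; move: (mom i j).
rewrite !mxE; case: (i == j); rewrite ?mulr1n ?mulr0n => h;
  by apply: (mulfI two0); apply: (eqr _ _ _ _ (esym h)); ring.
Qed.

Lemma complement_shift n (K : 'M[C]_n) (e c : C) :
  (e + c *+ 2)%:M - (K + c%:M) = (e + c)%:M - K.
Proof. by apply/matrixP => i j; rewrite !mxE; case: (i == j); rewrite ?mulr1n ?mulr0n; ring. Qed.

Lemma shifted_projection_mul n (K : 'M[C]_n) (e c : C) : K *m K = e *: K ->
  (K + c%:M) *m ((e + c)%:M - K) = (c * (e + c))%:M.
Proof.
move=> KK; rewrite mulmxBr !mulmxDl KK !mul_mx_scalar !mul_scalar_mx.
by apply/matrixP => i j; rewrite !mxE; case: (i == j); rewrite ?mulr1n ?mulr0n; ring.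
Qed.

(** With G = a^* a and K = a1 a1^*, the adjugate rule gives b b^* = tr G - G
    and b1^* b1 = e - K, so that the moment map equation reads 2 G = 2 K + (tr
    G - e), that is G = K + c.  Since K K = e K, all traces are polynomials in
    e and c. *)
Lemma three_step_traces n1 n2 (F : 'M[C]_N) (W1 : 'M[C]_n1) (W2 : 'M[C]_n2)
    (a : 'M[C]_(N, n1)) (a1 : 'M[C]_(n1, n2)) :
  F *m F ^t* = 1%:M -> W1^T = - W1 -> W1 ^t* *m W1 = 1%:M -> W2 ^t* *m W2 = 1%:M ->
  n1 = 2%N -> n2 = 1%N ->
  let b := dagger W1 F a in let b1 := dagger W2 W1 a1 in let X := a *m b in
  a1 *m b1 = b *m a ->
  a1 *m a1 ^t* - b1 ^t* *m b1 + b *m b ^t* - a ^t* *m a = 0 ->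
  b1 *m a1 = 0 -> b1 *m b1 ^t* = a1 ^t* *m a1 ->
  let e := \tr (a1 ^t* *m a1) in let c := (\tr (a ^t* *m a) - e) / 2 in
  [/\ \tr (X *m X ^t*) = (c * (e + c)) *+ 2,
      \tr (X *m X ^t* *m (X *m X ^t*)) = (c * (e + c)) ^+ 2 *+ 2,
      \tr (X *m X *m (X *m X) ^t*) = (e * (e + c)) ^+ 2 &
      \tr (a ^t* *m a + b *m b ^t*) + \tr (a1 ^t* *m a1 + b1 *m b1 ^t*) = 4 * (e + c)].
Proof.
move=> FF' aW1 W1W1 W2W2 n12 n21 b b1 X ab1 mom ba1 bal e c; subst n1 n2.
have uW1 : W1 \in unitmx by case/mulmx1_unit: W1W1.
have iW1 := invmx_isometry W1W1.
have W2W2' : W2 *m W2 ^t* = 1%:M by apply: mulmx1C.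
pose G := a ^t* *m a; pose K := a1 *m a1 ^t*; pose t := \tr G.
have eb : b = W1 ^t* *m a^T *m F by rewrite /b /dagger iW1.
have eb1 : b1 = W2 ^t* *m a1^T *m W1 by rewrite /b1 /dagger (invmx_isometry W2W2).
have H1 : b *m b ^t* = t%:M - G.
  have GT : G^T = a^T *m a^c by rewrite /G trmx_mul map_trmx trmxK.
  rewrite -(antisym2_adjugate (G : 'M_(1 + 1)) aW1 uW1) iW1 GT eb !adjointM trmxCK !mulmxA.
  by rewrite -(mulmxA _ F) FF' mulmx1 (trmxK a).
have H2 : b1 ^t* *m b1 = e%:M - K.
  have KT : K^T = a1^c *m a1^T by rewrite /K trmx_mul map_trmx trmxK.
  have -> : e = \tr K by rewrite /e mxtrace_mulC.
  rewrite -(antisym2_adjugate (K : 'M_(1 + 1)) aW1 uW1) iW1 KT eb1 !adjointM trmxCK (trmxK a1).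
  by rewrite !mulmxA -(mulmxA _ W2) W2W2' mulmx1.
clearbody b b1.
have ee : a1 ^t* *m a1 = e%:M by rewrite /e [a1 ^t* *m a1]mx11_scalar mxtrace_scalar.
have two0 : (2 : C) != 0 by rewrite pnatr_eq0.
have et : t = e + c *+ 2.
  by rewrite /c -/G -/t -[X in _ = _ + X]mulr_natr divfK // addrC subrK.
have eG : G = K + c%:M.
  by apply: (@balance_solve _ _ _ e); move: mom; rewrite H1 H2 -/K -/G et.
have KK : K *m K = e *: K.
  by rewrite /K mulmxA -(mulmxA a1) ee mul_mx_scalar -scalemxAl.
have eH : b *m b ^t* = (e + c)%:M - K by rewrite H1 et eG complement_shift.
have GH : G *m (b *m b ^t*) = (c * (e + c))%:M.
  by rewrite eH eG shifted_projection_mul.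
have trK : \tr K = e by rewrite mxtrace_mulC.
split.
- rewrite /X adjointM !mulmxA mxtrace_mulC !mulmxA -/G -mulmxA GH mxtrace_scalar.
  by [].
- have -> : \tr (X *m X ^t* *m (X *m X ^t*)) = \tr (G *m (b *m b ^t*) *m (G *m (b *m b ^t*))).
    by rewrite /X /G adjointM !mulmxA mxtrace_mulC !mulmxA.
  by rewrite GH -scalar_mxM -expr2 mxtrace_scalar.
- have XX : X *m X = a *m a1 *m b1 *m b.
    by rewrite /X !mulmxA -(mulmxA a b a) -ab1 !mulmxA.
  have -> : \tr (X *m X *m (X *m X) ^t*) =
      \tr ((a1 ^t* *m G *m a1) *m (b1 *m (b *m b ^t*) *m b1 ^t*)).
    by rewrite XX /G !adjointM !mulmxA -[LHS]mxtrace_mulC !mulmxA mxtrace_mulC !mulmxA.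
  have -> : a1 ^t* *m G *m a1 = (e * (e + c))%:M.
    rewrite eG mulmxDr mulmxDl /K mulmxA ee -mulmxA ee -scalar_mxM.
    by rewrite mul_mx_scalar -scalemxAl ee scale_scalar_mx -raddfD /=; congr _%:M; ring.
  have -> : b1 *m (b *m b ^t*) *m b1 ^t* = (e * (e + c))%:M.
    rewrite eH mulmxBr mulmxBl /K mulmxA ba1 !mul0mx subr0 mul_mx_scalar -scalemxAl.
    by rewrite bal ee scale_scalar_mx mulrC.
  by rewrite -scalar_mxM mxtrace_scalar mulr1n expr2.
- rewrite bal -/G eH !mxtraceD linearN /= trK mxtrace_scalar -/t et -/e.
  by ring.
Qed.

End ThreeStepValues.

Section ThreeStepPotential.
Variables (R : realType) (N : nat).
Local Notation C := R[i].
Variables (A F : 'M[C]_N) (W : forall j : nat, 'M[C]_(vdim A j)).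
Hypotheses (FF' : F *m F ^t* = 1%:M) (W0 : W 0 = F).
Hypotheses (W1 : compatible_form true (W 1)) (W2 : compatible_form false (W 2)).
Hypotheses (A3 : A ^+ 3 = 0) (rA1 : vdim A 1 = 2%N) (rA2 : vdim A 2 = 1%N).

(** Put r = e + c.  By the traces the norm is 4 r, c_1 = 2 c r, and the
    radicand is the square of 2 e r. *)
Lemma three_step_norm X p : hk_fibre 3 (So F) W X p ->
  norm_sq 3 p ^+ 2 = 8 * c1 X + 8 * Num.sqrt (2 * c1 X ^+ 2 - 2 * c2 X).
Proof.
move=> [flat mom _ eX].
have [m1 m2] := mom 0%N isT; have [m3 m4] := mom 1%N isT.
have v3 : vdim A 3 = 0%N by rewrite /vdim A3 mxrank0.
have f0 := flat 0%N isT; have f1 := flat 1%N isT; rewrite W0 in f0.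
rewrite (mulmx_dim0 _ _ v3) in m3.
rewrite (mulmx_dim0 _ _ v3) (mulmx_dim0 _ (beta p 2) v3) subrr add0r in m4.
move/subr0_eq: m4 => m4; move/esym: m3 => m3.
have [aW1 W1W1 _] := compatible_formE W1; rewrite expr1 scaleN1r in aW1.
have [_ W2W2 _] := compatible_formE W2.
rewrite f1 in m1 m2 m3 m4; rewrite f0 in m1 m2.
have [t1 t2 t3 t4] := three_step_traces FF' aW1 W1W1 W2W2 rA1 rA2 m1 m2 m3 m4.
have eX' : X = alpha p 0 *m dagger (W 1) F (alpha p 0) by rewrite -eX /psi f0.
have -> : norm_sq 3 p = complex.Re
    (\tr ((alpha p 0) ^t* *m alpha p 0 + beta p 0 *m (beta p 0) ^t*) +
     \tr ((alpha p 1) ^t* *m alpha p 1 + beta p 1 *m (beta p 1) ^t*)).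
  by rewrite /norm_sq !big_ord_recl big_ord0 addr0.
rewrite f0 f1 t4 /c1 c2_commutator.
move: t1 t2 t3 t4; rewrite -eX' => -> -> -> _.
set e := \tr _; set t := \tr _.
have e0 : 0 <= e by apply: mxtrace_gram_ge0.
have t0 : 0 <= t by apply: mxtrace_gram_ge0.
clearbody e t.
have /RRe_real ee : e \is Num.real by apply: ger0_real.
have /RRe_real et : t \is Num.real by apply: ger0_real.
move: (complex.Re e) (complex.Re t) ee et => x y ee et; rewrite -ee -et in e0 t0 *.
rewrite !ler0c in e0 t0.
have -> : (y%:C - x%:C) / 2 = ((y - x) / 2)%:C.
  by rewrite rmorphM rmorphB fmorphV rmorph_nat.
have -> : 4 * (x%:C + ((y - x) / 2)%:C) = (4 * (x + (y - x) / 2))%:C.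
  by rewrite [RHS]rmorphM rmorph_nat [in RHS]rmorphD.
rewrite -!rmorphD -!rmorphM -!rmorphXn -!rmorphMn -!rmorphB -!rmorphMn /=.
set r := x + (y - x) / 2; set u := (y - x) / 2.
have r0 : 0 <= r by rewrite /r; lra.
have -> : 2 * (u * r *+ 2) ^+ 2 - 2 * (((u * r) ^+ 2 *+ 2 - (x * r) ^+ 2) *+ 2) =
    (2 * (x * r)) ^+ 2 by ring.
rewrite sqrtr_sqr ger0_norm; last by rewrite !mulr_ge0.
have -> : x = r - u by rewrite /r addrK.
by ring.
Qed.

End ThreeStepPotential.

(** * Existence of three-step representations *)

Section Rotation.
Variable C : numClosedFieldType.
Local Notation J := (skew_unit C 1).

(** Rotating the plane by a special unitary matrix keeps the skew form and
    sends b to a coordinate vector. *)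
Lemma skew_rotation (b : 'cV[C]_(1 + 1)) : unit_vec b ->
  let Z := row_mx (J *m b) (b^c) in
  [/\ isometry_mx Z, Z *m J *m Z^T = J & b^T *m Z = row_mx 0 1%:M].
Proof.
move=> hb Z; have bbc : b^T *m b^c = 1%:M by apply: isometry_conj.
have bJb (x : 'cV[C]_(1 + 1)) : x^T *m J *m x = 0 by apply/antisym_quadric/tr_skew_unit.
split.
- apply: isometry_row_mx.
  + rewrite /isometry_mx adjointM adjoint_skew_unit mulmxN mulNmx.
    by rewrite -mulmxA (mulmxA J) skew_unit_sq mulNmx mul1mx mulmxN opprK.
  + by rewrite /isometry_mx adjointC.
  + by rewrite adjointM adjoint_skew_unit mulmxN mulNmx -map_trmx bJb oppr0.
- have e : Z *m J = row_mx (- b^c) (J *m b).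
    by rewrite /Z mul_row_block !mulmx0 mulmx1 add0r addr0 mulmxN mulmx1.
  have eb : (b *m b ^t*)^T = b^c *m b^T by rewrite trmx_mul map_trmx trmxK.
  have := skew_unit_adjugate (b *m b ^t*); rewrite eb mxtrace_mulC.
  have -> : b ^t* *m b = 1%:M by [].
  rewrite mxtrace1 mulmxBr mulmx1 => h.
  rewrite e tr_row_mx mul_row_col trmx_mul tr_skew_unit mulmxN mulmxN mulNmx opprK.
  by rewrite mulmxA h -map_trmx mulmxA subrK.
by rewrite mul_mx_row mulmxA bJb bbc.
Qed.

(** Youla's form of a rank two element of so(N) is determined up to special
    unitary changes of the plane.  The symmetric form compressed to the plane
    has rank one: rank zero would give X^2 = 0, and rank two would contradict
    nilpotency. *)
Lemma three_step_normal_form N k (F X : 'M[C]_N) (Q : 'M[C]_(N, 1 + 1)) (d : 'rV[C]_1) :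
  F^T = F -> F *m F ^t* = 1%:M -> isometry_mx Q -> positive_row d ->
  X = Q *m skew_diag d *m Q^T *m F -> X ^+ k = 0 -> X *m X <> 0 ->
  exists (P : 'M[C]_(N, 1 + 1)) (s t : C),
    [/\ isometry_mx P, 0 < s, 0 < t, X = s *: (P *m J ^t* *m P^T *m F) &
        P^T *m F *m P = t *: block_mx 0 0 0 1%:M].
Proof.
move=> sF FF' hQ d0 eX Xk XX.
pose G := Q^T *m F *m Q.
have sG : G^T = G by rewrite /G !trmx_mul sF trmxK mulmxA.
have XQ : X *m Q = Q *m (skew_diag d *m G) by rewrite eX /G !mulmxA.
have Mk := compress_nilpotent hQ XQ Xk.
have eG : G = Q^T *m F *m Q by [].
clearbody G.
have [q [b [e [hb e0 eGb]]]] := takagi sG.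
have rG : \rank G = q by rewrite eGb (rank_sandwich (diag_unit e0) hb (isometry_conj hb)).
have q2 : (q <= 2)%N by rewrite -rG rank_leq_row.
have [q0|[q1|q22]] : q = 0%N \/ (q = 1%N \/ q = 2%N) by lia.
- case: XX; have /eqP G0 : G == 0 by rewrite -mxrank_eq0 rG q0.
  have -> : X *m X = X *m Q *m skew_diag d *m Q^T *m F by rewrite {2}eX !mulmxA.
  by rewrite XQ G0 !mulmx0 !mul0mx.
- move: b e hb e0 eGb {rG q2}; rewrite q1 => b e hb e0 eGb.
  have [] := skew_rotation hb; set Z := row_mx _ _; clearbody Z => hZ ZJ bZ.
  exists (Q *m Z), (d 0 0), (e 0 0).
  have ed : skew_diag d = d 0 0 *: J ^t*.
    rewrite skew_diagE adjoint_skew_unit.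
    have -> : row_mx d d = const_mx (d 0 0).
      by rewrite -row_mx_const; congr row_mx; apply/matrixP => i j; rewrite !ord1 mxE.
    by rewrite diag_const_mx mul_mx_scalar.
  split=> //.
  + by rewrite /isometry_mx adjointM mulmxA -(mulmxA _ (Q ^t*)) hQ mulmx1.
  + rewrite eX ed -scalemxAr -!scalemxAl; congr (_ *: _).
    rewrite trmx_mul adjoint_skew_unit mulmxN !mulNmx !mulmxA.
    by rewrite -{1}ZJ !mulmxA mulmxN !mulNmx.
  + rewrite trmx_mul !mulmxA -(mulmxA _ Q^T) -(mulmxA _ _ Q) -eG eGb.
    have -> : diag_mx e = (e 0 0)%:M by rewrite [diag_mx e]mx11_scalar !mxE mulr1n.
    have ebZ : Z^T *m b = (row_mx 0 1%:M)^T by rewrite -bZ trmx_mul trmxK.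
    rewrite !mulmxA ebZ mul_mx_scalar -!scalemxAl -mulmxA bZ tr_row_mx mul_col_row.
    by rewrite trmx0 trmx1 !mulmx0 !mul0mx mulmx1.
have uG : G \in unitmx by rewrite -row_full_unit -col_leq_rank rG q22.
have := nilpotent_not_unit Mk.
by rewrite unitmx_mul (skew_diag_unit d0) uG.
Qed.

End Rotation.

(** Products of 2 by 2 matrices are reduced to equations between entries. *)
Definition mx22 (C : pzRingType) (x y z w : C) : 'M[C]_(1 + 1) :=
  block_mx x%:M y%:M z%:M w%:M.

Lemma mx22_mul (C : pzRingType) (x y z w x' y' z' w' : C) :
  mx22 x y z w *m mx22 x' y' z' w' =
  mx22 (x * x' + y * z') (x * y' + y * w') (z * x' + w * z') (z * y' + w * w').
Proof. by rewrite /mx22 mulmx_block -!scalar_mxM -!raddfD. Qed.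

Lemma mx22_scale (C : pzRingType) (c x y z w : C) :
  c *: mx22 x y z w = mx22 (c * x) (c * y) (c * z) (c * w).
Proof. by rewrite /mx22 scale_block_mx !scale_scalar_mx. Qed.

Lemma mx22_add (C : pzRingType) (x y z w x' y' z' w' : C) :
  mx22 x y z w + mx22 x' y' z' w' = mx22 (x + x') (y + y') (z + z') (w + w').
Proof. by rewrite /mx22 add_block_mx -!raddfD. Qed.

Lemma mx22_opp (C : pzRingType) (x y z w : C) :
  - mx22 x y z w = mx22 (- x) (- y) (- z) (- w).
Proof. by rewrite /mx22 opp_block_mx -!raddfN. Qed.

Lemma mx22_0 (C : pzRingType) : mx22 0 0 0 0 = 0 :> 'M[C]_(1 + 1).
Proof. by rewrite /mx22 raddf0 block_mx0. Qed.

(** With tau = sqrt(1 + t): y = sqrt(s / tau), x = tau y and c = 'i sqrt(t) y. *)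
Lemma three_step_scalars (C : numClosedFieldType) (s t : C) : 0 < s -> 0 < t ->
  exists x y c : C, [/\ 0 < x, 0 < y & c != 0] /\
    [/\ x * y = s, c * c = - (t * y ^+ 2) & x ^+ 2 = c^* * c + y ^+ 2].
Proof.
move=> s0 t0.
pose tau := sqrtC (1 + t); have tau0 : 0 < tau by rewrite sqrtC_gt0 addr_gt0.
have tau2 : tau ^+ 2 = 1 + t by rewrite sqrtCK.
pose y := sqrtC (s / tau); have y0 : 0 < y by rewrite sqrtC_gt0 divr_gt0.
have y2 : tau * y ^+ 2 = s by rewrite sqrtCK mulrC divfK // gt_eqF.
pose x := tau * y; have x0 : 0 < x by rewrite mulr_gt0.
pose w := sqrtC t * y; have w0 : 0 < w by apply: mulr_gt0 => //; rewrite sqrtC_gt0.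
pose c := 'i * w; have cc : c^* * c = w ^+ 2.
  by rewrite /c rmorphM /= conjCi geC0_conj ?ltW // mulrACA -expr2 mulNr -expr2 sqrCi opprK mul1r.
have c2 : c * c = - (t * y ^+ 2).
  by rewrite /c mulrACA -expr2 sqrCi mulN1r -expr2 exprMn sqrtCK.
have cN : c != 0 by rewrite mulf_neq0 ?neq0Ci // gt_eqF.
have w2 : w ^+ 2 = t * y ^+ 2 by rewrite exprMn sqrtCK.
have x2 : x ^+ 2 = w ^+ 2 + y ^+ 2.
  by rewrite w2 exprMn tau2 mulrDl mul1r addrC.
have xy : x * y = s by rewrite -y2 /x -mulrA.
by exists x, y, c; rewrite cc; split; split.
Qed.

Section ThreeStepFibre.
Variables (C : numClosedFieldType) (N n1 n2 : nat).
Local Notation J := (skew_unit C 1).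
Variables (F X : 'M[C]_N) (W1 : 'M[C]_n1) (W2 : 'M[C]_n2).
Variables (P : 'M[C]_(N, 1 + 1)) (V : 'M[C]_(n1, 1 + 1)) (U : 'M[C]_(n2, 1)) (s t : C).
Hypotheses (FF' : F *m F ^t* = 1%:M) (hP : isometry_mx P).
Hypotheses (V1 : V ^t* *m V = 1%:M) (V2 : V *m V ^t* = 1%:M) (eW1 : V^T *m W1 *m V = J).
Hypotheses (U1 : U ^t* *m U = 1%:M) (U2 : U *m U ^t* = 1%:M) (eW2 : U^T *m W2 *m U = 1%:M).
Hypotheses (s0 : 0 < s) (t0 : 0 < t).
Hypothesis eX : X = s *: (P *m J ^t* *m P^T *m F).
Hypothesis eG : P^T *m F *m P = t *: block_mx 0 0 0 1%:M.

Let f1 : 'cV[C]_(1 + 1) := col_mx 1%:M 0.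
Let f2 : 'cV[C]_(1 + 1) := col_mx 0 1%:M.

(** The map a is diagonal from V to P, and a1 sends the basis vector of the
    line to a multiple of the first vector of V, since b a = a1 b1 must be the
    multiple of f1 f2^T that the form on P dictates.  The three equations on x,
    y and c are a b = X, a1 b1 = b a and the balance of the moment map. *)
Lemma three_step_data : exists (a : 'M[C]_(N, n1)) (a1 : 'M[C]_(n1, n2)),
  let b := invmx W1 *m a^T *m F in let b1 := invmx W2 *m a1^T *m W1 in
  [/\ a *m b = X, a1 *m b1 = b *m a,
      a1 *m a1 ^t* - b1 ^t* *m b1 + b *m b ^t* - a ^t* *m a = 0,
      b1 *m a1 = 0 & b1 *m b1 ^t* = a1 ^t* *m a1] /\
  [/\ exists l, l *m a = 1%:M, exists l, b *m l = 1%:M,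
      exists l, l *m a1 = 1%:M & exists l, b1 *m l = 1%:M].
Proof.
have [x [y [c [[x0 y0 cN] [xy c2 x2]]]]] := three_step_scalars s0 t0.
pose d := row_mx (const_mx x) (const_mx y) : 'rV[C]_(1 + 1).
have d0 : positive_row d.
  by move=> i; rewrite /d; case: (split_ordP i) => j ->; rewrite ?row_mxEl ?row_mxEr !mxE.
have ud := diag_unit d0.
have J1 : J ^t* *m J = 1%:M by rewrite adjoint_skew_unit mulNmx skew_unit_sq opprK.
have I1 : (1%:M : 'M[C]_1) ^t* *m 1%:M = 1%:M by rewrite trmx1 map_mx1 mulmx1.
pose a := P *m diag_mx d *m V ^t*.
pose a1 := V *m f1 *m diag_mx (const_mx c) *m U ^t*.
exists a, a1.
have eb : invmx W1 *m a^T *m F = _ := adapted_form_adjoint F P d J1 V1 V2 eW1.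
have eb1 : invmx W2 *m a1^T *m W1 = _ := adapted_form_adjoint W1 (V *m f1) (const_mx c) I1 U1 U2 eW2.
have ed : diag_mx d = mx22 x 0 0 y.
  by rewrite /mx22 raddf0 diag_mx_row !diag_const_mx.
have eJ : J = mx22 0 1 (- 1) 0 by rewrite /mx22 raddf0 raddfN.
have eJ' : J ^t* = mx22 0 (- 1) 1 0 by rewrite adjoint_skew_unit eJ mx22_opp oppr0 opprK.
have eE : block_mx 0 0 0 1%:M = mx22 0 0 0 1 :> 'M[C]_(1 + 1) by rewrite /mx22 raddf0.
have e11 : f1 *m f1^T = mx22 1 0 0 0.
  by rewrite /mx22 raddf0 tr_col_mx mul_col_row trmx0 trmx1 !mulmx0 !mul0mx mulmx1.
have e22 : f2 *m f2^T = mx22 0 0 0 1.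
  by rewrite /mx22 raddf0 tr_col_mx mul_col_row trmx0 trmx1 !mulmx0 !mul0mx mulmx1.
have e12 : f1 *m f2^T = mx22 0 1 0 0.
  by rewrite /mx22 raddf0 tr_col_mx mul_col_row trmx0 trmx1 !mulmx0 !mul0mx mulmx1.
have aD : (diag_mx d) ^t* = diag_mx d := adjoint_positive_diag d0.
have DJD : diag_mx d *m J ^t* *m diag_mx d = s *: J ^t*.
  by rewrite eJ' ed !mx22_mul mx22_scale -xy; congr mx22; ring.
have JED : J ^t* *m diag_mx d *m (t *: block_mx 0 0 0 1%:M) *m diag_mx d = (c * c) *: (f1 *m f2^T).
  by rewrite eE e12 eJ' ed !(mx22_scale, mx22_mul) c2; congr mx22; ring.
have bal : c^* * c *: (f1 *m f1^T) - c^* * c *: (f2 *m f2^T) +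
    J ^t* *m diag_mx d *m diag_mx d *m J - diag_mx d *m diag_mx d = 0.
  rewrite e11 e22 eJ' eJ ed !mx22_scale !mx22_mul !mx22_opp !mx22_add -mx22_0.
  by congr mx22; ring: x2.
have VW : V^T *m W1 = J *m V ^t* by rewrite -eW1 -[RHS]mulmxA V2 mulmx1.
have fJ : f1^T *m J = f2^T.
  rewrite /f1 /f2 !tr_col_mx mul_row_block !mulmx0 trmx0 !mul0mx trmx1 mulmx1 add0r addr0.
  by [].
have f12 : f2^T *m f1 = 0 by rewrite tr_col_mx mul_row_col trmx0 mul0mx mulmx0 addr0.
have f11 : f1^T *m f1 = 1%:M.
  by rewrite tr_col_mx mul_row_col trmx0 trmx1 mul0mx mulmx1 addr0.
have f22 : f2^T *m f2 = 1%:M.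
  by rewrite tr_col_mx mul_row_col trmx0 trmx1 mul0mx mulmx1 add0r.
have {}eb1 : invmx W2 *m a1^T *m W1 = c *: (U *m f2^T *m V ^t*).
  rewrite eb1 trmx1 map_mx1 mulmx1 diag_const_mx mul_mx_scalar -!scalemxAl trmx_mul.
  by rewrite -!mulmxA VW (mulmxA f1^T) fJ.
have ea1 : a1 = c *: (V *m f1 *m U ^t*).
  by rewrite /a1 diag_const_mx mul_mx_scalar -!scalemxAl.
rewrite /= eb eb1 ea1.
have f1a : f1 ^t* = f1^T.
  by rewrite /f1 tr_col_mx map_row_mx trmx0 trmx1 map_mx0 map_mx1.
have f2c : f2^c = f2 by rewrite /f2 map_col_mx map_mx0 map_mx1.
clearbody a1 f1 f2; clear ea1 eb1 eE e11 e22 e12 eb.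
have a1a : (c *: (V *m f1 *m U ^t*)) ^t* = c^* *: (U *m f1^T *m V ^t*).
  by rewrite adjointZ (adjointM _ (U ^t*)) (adjointM V) (trmxCK U) f1a mulmxA.
have b1a : (c *: (U *m f2^T *m V ^t*)) ^t* = c^* *: (V *m f2 *m U ^t*).
  by rewrite adjointZ (adjointM _ (V ^t*)) (adjointM U) (trmxCK V) trmxK f2c mulmxA.
have aa : a ^t* *m a = V *m (diag_mx d *m diag_mx d) *m V ^t*.
  rewrite /a (adjointM _ (V ^t*)) (adjointM P) (trmxCK V) aD !mulmxA.
  by rewrite -(mulmxA _ (P ^t*)) hP mulmx1.
have bb : V *m J ^t* *m diag_mx d *m P^T *m F *m (V *m J ^t* *m diag_mx d *m P^T *m F) ^t* =
    V *m (J ^t* *m diag_mx d *m diag_mx d *m J) *m V ^t*.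
  rewrite !adjointM !trmxCK aD (trmxK P) !mulmxA -(mulmxA _ F) FF' mulmx1.
  by rewrite -(mulmxA _ P^T P^c) (isometry_conj hP) mulmx1.
have combine (K1 K2 K3 K4 : 'M[C]_(1 + 1)) :
    V *m K1 *m V ^t* - V *m K2 *m V ^t* + V *m K3 *m V ^t* - V *m K4 *m V ^t* =
    V *m (K1 - K2 + K3 - K4) *m V ^t*.
  rewrite mulmxBr mulmxDr mulmxBr mulmxBl mulmxDl mulmxBl.
  by [].
split; split.
- rewrite eX /a !mulmxA -(mulmxA _ (V ^t*)) V1 mulmx1.
  rewrite -(mulmxA P) -(mulmxA P) DJD -scalemxAr -!scalemxAl.
  by [].
- have -> : V *m J ^t* *m diag_mx d *m P^T *m F *m a =
      V *m (J ^t* *m diag_mx d *m (P^T *m F *m P) *m diag_mx d) *m V ^t*.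
    by rewrite /a !mulmxA.
  rewrite eG JED -!scalemxAl -!scalemxAr -scalemxAl !scalerA !mulmxA.
  by rewrite -(mulmxA _ (U ^t*)) U1 mulmx1 .
- rewrite a1a b1a aa bb.
  have -> : c *: (V *m f1 *m U ^t*) *m (c^* *: (U *m f1^T *m V ^t*)) =
      V *m (c^* * c *: (f1 *m f1^T)) *m V ^t*.
    rewrite -!scalemxAl -!scalemxAr -!scalemxAl !scalerA (mulrC c) !mulmxA.
    by rewrite -(mulmxA _ (U ^t*)) U1 mulmx1.
  have -> : c^* *: (V *m f2 *m U ^t*) *m (c *: (U *m f2^T *m V ^t*)) =
      V *m (c^* * c *: (f2 *m f2^T)) *m V ^t*.
    rewrite -!scalemxAl -!scalemxAr -!scalemxAl !scalerA !mulmxA.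
    by rewrite -(mulmxA _ (U ^t*)) U1 mulmx1.
  by rewrite combine bal mulmx0 mul0mx.
- rewrite -!scalemxAl -!scalemxAr !mulmxA -(mulmxA _ (V ^t*)) V1 mulmx1.
  by rewrite -(mulmxA _ f2^T) f12 mulmx0 mul0mx !scaler0.
- rewrite a1a b1a -!scalemxAl -!scalemxAr !scalerA (mulrC c) !mulmxA.
  rewrite -!(mulmxA _ (V ^t*)) V1 !mulmx1 -(mulmxA U) f22 mulmx1 -(mulmxA U) f11 mulmx1.
  by [].
- exists (V *m invmx (diag_mx d) *m P ^t*).
  rewrite /a !mulmxA -(mulmxA _ (P ^t*)) hP mulmx1 -(mulmxA _ _ (diag_mx d)) mulVmx //.
  by rewrite mulmx1.
- exists (F ^t* *m P^c *m invmx (diag_mx d) *m J *m V ^t*).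
  rewrite !mulmxA -(mulmxA _ F) FF' mulmx1 -(mulmxA _ P^T P^c) (isometry_conj hP) mulmx1.
  by rewrite mulmxK // -(mulmxA V) J1 mulmx1.
- exists (c^-1 *: (U *m f1^T *m V ^t*)).
  rewrite -!scalemxAl -!scalemxAr !scalerA mulVf // scale1r !mulmxA.
  by rewrite -(mulmxA _ (V ^t*)) V1 mulmx1 -(mulmxA U) f11 mulmx1.
- exists (c^-1 *: (V *m f2 *m U ^t*)).
  rewrite -!scalemxAl -!scalemxAr !scalerA mulfV // scale1r !mulmxA.
  by rewrite -(mulmxA _ (V ^t*)) V1 mulmx1 -(mulmxA U) f22 mulmx1.
Qed.

End ThreeStepFibre.

Section AdaptedBases.
Variable R : realType.
Local Notation C := R[i].

(** The basis in the definition of compatibility has the right size because it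
    is orthonormal. *)
Lemma skew_form_basis n m (Wf : 'M[C]_n) : compatible_form true Wf -> n = (m + m)%N ->
  exists V : 'M[C]_(n, m + m),
    [/\ V ^t* *m V = 1%:M, V *m V ^t* = 1%:M & V^T *m Wf *m V = skew_unit C m].
Proof.
move=> [m' [V [[V1 V2] eV]]] nm.
have e : m' = m by have := mulmx1_min V1; have := mulmx1_min V2; lia.
by subst m'; exists V.
Qed.

Lemma symmetric_form_basis n m (Wf : 'M[C]_n) : compatible_form false Wf -> n = m ->
  exists V : 'M[C]_(n, m),
    [/\ V ^t* *m V = 1%:M, V *m V ^t* = 1%:M & V^T *m Wf *m V = 1%:M].
Proof. by move=> [V [[V1 V2] eV]] <-; exists V. Qed.

End AdaptedBases.

Section ThreeStepExistence.
Variables (R : realType) (N k : nat).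
Local Notation C := R[i].
Variables (A F X : 'M[C]_N) (W : forall j : nat, 'M[C]_(vdim A j)).
Hypotheses (sF : F^T = F) (FF' : F *m F ^t* = 1%:M) (W0 : W 0 = F).
Hypotheses (W1 : compatible_form true (W 1)) (W2 : compatible_form false (W 2)).
Hypotheses (A3 : A ^+ 3 = 0) (rA1 : vdim A 1 = 2%N) (rA2 : vdim A 2 = 1%N).

Lemma three_step_fibre (Q : 'M[C]_(N, 1 + 1)) (d : 'rV[C]_1) :
  isometry_mx Q -> positive_row d -> X = Q *m skew_diag d *m Q^T *m F ->
  X ^+ k = 0 -> X *m X <> 0 -> exists p, hk_fibre 3 (So F) W X p.
Proof.
move=> hQ d0 eX Xk XX.
have [P [s [t [hP s0 t0 eX' eG]]]] := three_step_normal_form sF FF' hQ d0 eX Xk XX.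
have [V [V1 V2 eW1]] := skew_form_basis W1 (rA1 : _ = (1 + 1)%N).
have [U [U1 U2 eW2]] := symmetric_form_basis W2 rA2.
have [a [a1 [[ab ab1 bal ba1 bal1] [[l la] [m bm] [l1 la1] [m1 bm1]]]]] :=
  three_step_data FF' hP V1 V2 eW1 U1 U2 eW2 s0 t0 eX' eG.
have v3 : vdim A 3 = 0%N by rewrite /vdim A3 mxrank0.
exists (short_rep (A := A) a (dagger (W 1) F a) a1 (dagger (W 2) (W 1) a1)).
split=> //.
- move=> [|[|j]] //= _; exact: (congr1 (fun G => dagger (W 1) G a) (esym W0)).
- move=> [|[|j]] //= _.
  rewrite ba1 !mul0mx; split=> //.
  by rewrite trmx0 map_mx0 mul0mx subr0 add0r bal1 subrr.
move=> [|[|[|j]]] //= _.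
- split=> [u v /(congr1 (mulmx l))|w]; first by rewrite !mulmxA la !mul1mx.
  by exists (m *m w); rewrite mulmxA bm mul1mx.
- split=> [u v /(congr1 (mulmx l1))|w]; first by rewrite !mulmxA la1 !mul1mx.
  by exists (m1 *m w); rewrite mulmxA bm1 mul1mx.
split=> [u v _|w]; first exact: cV_dim0.
by exists 0; apply: cV_dim0.
Qed.

End ThreeStepExistence.

(** * Orbits and the potential *)

Section Orbit.
Variables (R : realType) (N : nat).
Local Notation C := R[i].
Variable g : classical_type R N.
Hypothesis Hg : ambient_form g.
Implicit Types A B X : 'M[C]_N.

Lemma complex_group_unit B : complex_group g B -> B \in unitmx.
Proof.
have h F : F ^t* *m F = 1%:M -> B^T *m F *m B = F -> B \in unitmx.
  move=> FF eF; have : F ^t* *m B^T *m F *m B = 1%:M by rewrite -!mulmxA (mulmxA B^T) eF.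
  by case/mulmx1_unit.
case: g Hg => [|F|F] hF /=; first by rewrite unitmxE => ->; rewrite unitr1.
  by case=> eF _; have [_ FF _] := compatible_formE hF; apply: h FF eF.
by move=> eF; have [_ FF _] := compatible_formE hF; apply: h FF eF.
Qed.

Lemma adjoint_orbitP A X : adjoint_orbit g A X ->
  exists2 B, complex_group g B /\ B \in unitmx & X = B *m A *m invmx B.
Proof. by move=> [B gB <-]; exists B => //; split=> //; apply: complex_group_unit. Qed.

Lemma adjoint_orbit_algebra A X :
  complex_algebra g A -> adjoint_orbit g A X -> complex_algebra g X.
Proof.
move=> gA /adjoint_orbitP[B [gB uB] ->].
have h F : B^T *m F *m B = F -> A^T *m F + F *m A = 0 ->
    (B *m A *m invmx B)^T *m F + F *m (B *m A *m invmx B) = 0.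
  move=> eF eA; have uBT : B^T \in unitmx by rewrite unitmx_tr.
  have e1 : B^T *m F = F *m invmx B by rewrite -{2}eF mulmxK.
  have e2 : F *m B = invmx B^T *m F by rewrite -{2}eF -!mulmxA mulKmx.
  rewrite !trmx_mul trmx_inv !mulmxA -(mulmxA _ B^T) e1 e2 !mulmxA -mulmxDl.
  by rewrite -!mulmxA -mulmxDr eA mulmx0 mul0mx.
case: g gA gB => [|F|F] /= gA gB; last exact: h.
  by rewrite mxtrace_mulC mulmxA mulVmx // mul1mx.
by case: gB => eF _; apply: h.
Qed.

Lemma adjoint_orbit_rank A X j : adjoint_orbit g A X -> \rank (X ^+ j) = \rank (A ^+ j).
Proof.
move=> /adjoint_orbitP[B [_ uB] ->].
have -> : (B *m A *m invmx B) ^+ j = B *m A ^+ j *m invmx B.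
  elim: j => [|j IH]; first by rewrite !expr0 mulmx1 mulmxV.
  by rewrite !mulmx_expS IH !mulmxA mulmxKV.
rewrite mxrankMfree ?row_free_unit ?unitmx_inv //.
have fB : row_full B by rewrite row_full_unit.
by rewrite (eqmxMfull (A ^+ j) fB).
Qed.

Lemma adjoint_orbit_pow0 A X j : adjoint_orbit g A X -> X ^+ j = 0 <-> A ^+ j = 0.
Proof.
move=> /(adjoint_orbit_rank j) e; split=> h; apply/eqP; rewrite -mxrank_eq0.
  by rewrite -e h mxrank0.
by rewrite e h mxrank0.
Qed.

(** The bound holds at one point of the orbit, and rank and vanishing of the
    square are constant on it. *)
Lemma orbit_type A k : complex_algebra g A -> A ^+ k = 0 ->
  cohomogeneity g (adjoint_orbit g A) 2 ->
  match g with
  | So _ => (\rank A <= 4)%N /\ (A *m A = 0 \/ (\rank A <= 2)%N)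
  | _ => (\rank A <= 2)%N /\ A *m A = 0
  end.
Proof.
move=> gA Ak [[X OX hX] _].
have gX := adjoint_orbit_algebra gA OX.
have Xk : X ^+ k = 0 by apply/(adjoint_orbit_pow0 k OX).
have := adjoint_orbit_rank 1 OX; have := adjoint_orbit_pow0 2 OX; rewrite !expr1 !expr2.
move=> [sq _] <-; have := codim_two_type Hg gX Xk hX.
case: g => [|F|F]; first by case=> -> /sq.
  by case=> -> [/sq|] h; split=> //; [left|right].
by case=> -> /sq.
Qed.

End Orbit.

Section Potential.
Variables (R : realType) (N : nat).
Local Notation C := R[i].
Variable g : classical_type R N.
Variables (A X : 'M[C]_N) (W : forall j : nat, 'M[C]_(vdim A j)).
Hypotheses (Hg : ambient_form g) (gX : complex_algebra g X).

Let formula k := hk_potential k g W X ^+ 2 =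
    4 * kappa g * c1 X + 4 * kappa g * Num.sqrt (2 * c1 X ^+ 2 - kappa g * c2 X).

(** The norm is an empty sum. *)
Lemma one_step_formula : X = 0 -> formula 1.
Proof.
move=> X0; rewrite /formula.
have -> : hk_potential 1 g W X = 0.
  rewrite /hk_potential; case: xgetP => // _ _ [p _ <-].
  by rewrite /norm_sq big_ord0.
have -> : c1 X = 0 by rewrite /c1 X0 mul0mx mxtrace0.
have -> : c2 X = 0 by rewrite /c2 /lie_bracket X0 mul0mx mulmx0 subr0 mul0mx mxtrace0.
by rewrite !expr0n /= !mulr0 subr0 sqrtr0 mulr0 addr0.
Qed.

Lemma special_linear_two_step : g = Sl -> A ^+ 2 = 0 -> X *m X = 0 ->
  \rank X = vdim A 1 -> (\rank X <= 2)%N -> formula 2.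
Proof.
move=> gS A2 XX eA r2; have [r [P [Q [d [hP hQ d0 eX]]]]] := svd X.
have rX : \rank X = r.
  by rewrite eX (rank_sandwich (diag_unit d0) hP hQ).
apply: (two_step_formula1 A2 XX _ _ _ hP d0).
- by apply: (special_linear_two_step_fibre _ A2 XX gS _ hP hQ d0 eX); rewrite -eA rX.
- by rewrite gS.
- by rewrite -rX.
rewrite eX !adjointM trmxCK (adjoint_positive_diag d0) !mulmxA.
by rewrite -(mulmxA _ (Q ^t*)) hQ mulmx1.
Qed.

Lemma symplectic_two_step F : g = Sp F -> W 0%N = F -> compatible_form false (W 1) ->
  A ^+ 2 = 0 -> X *m X = 0 ->
  \rank X = vdim A 1 -> (\rank X <= 2)%N -> formula 2.
Proof.
move=> gS W0 W1 A2 XX eA r2.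
have gF : form_of g = Some F by rewrite gS.
have [sF _ FF'] : [/\ F^T = - F, F ^t* *m F = 1%:M & F *m F ^t* = 1%:M].
  by have := Hg; rewrite gS => /compatible_formE; rewrite expr1 scaleN1r.
have XF : X^T *m F + F *m X = 0 by have := gX; rewrite gS.
have [r [P [d [hP d0 eX rX]]]] := symplectic_normal_form FF' XF sF.
have [V [V1 V2 eW]] : exists V : 'M[C]_(vdim A 1, r),
    [/\ V ^t* *m V = 1%:M, V *m V ^t* = 1%:M & V^T *m W 1 *m V = 1%:M].
  by apply: symmetric_form_basis W1 _; rewrite -eA.
have [s s0 ed] := diag_sqrt d0.
have KK : (1%:M : 'M[C]_r) ^t* *m 1%:M = 1%:M by rewrite trmx1 map_mx1 mulmx1.
have Ks : 1%:M *m diag_mx s = diag_mx s *m 1%:M by rewrite mul1mx mulmx1.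
have eX' : X = P *m (1%:M) ^t* *m diag_mx s *m diag_mx s *m P^T *m F.
  by rewrite eX ed trmx1 map_mx1 mulmx1 !mulmxA.
apply: (two_step_formula1 A2 XX _ _ _ hP d0).
- exact: (form_two_step_fibre A2 XX gF W0 FF' hP s0 KK Ks V1 V2 eW eX').
- by rewrite gS.
- by rewrite -rX.
by rewrite (adapted_gram FF' hP s0 KK Ks eX') ed.
Qed.

Lemma orthogonal_two_step F : g = So F -> W 0%N = F -> compatible_form true (W 1) ->
  A ^+ 2 = 0 -> X *m X = 0 ->
  \rank X = vdim A 1 -> (\rank X <= 4)%N -> formula 2.
Proof.
move=> gS W0 W1 A2 XX eA r4.
have gF : form_of g = Some F by rewrite gS.
have [sF _ FF'] : [/\ F^T = F, F ^t* *m F = 1%:M & F *m F ^t* = 1%:M].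
  by have := Hg; rewrite gS => /compatible_formE; rewrite expr0 scale1r.
have XF : X^T *m F + F *m X = 0 by have := gX; rewrite gS.
have [m [P [d [hP d0 eX rX]]]] := orthogonal_normal_form FF' XF sF.
have [V [V1 V2 eW]] := skew_form_basis W1 (etrans (esym eA) rX).
have [t t0 et] := diag_sqrt d0.
pose s := row_mx t t; have s0 : positive_row s := positive_row_mx2 t0.
have ed : diag_mx (row_mx d d) = diag_mx s *m diag_mx s.
  by rewrite !diag_mx_row mulmx_block !mulmx0 !mul0mx !addr0 !add0r -et.
have KK : (skew_unit C m) ^t* *m skew_unit C m = 1%:M.
  by rewrite adjoint_skew_unit mulNmx skew_unit_sq opprK.
have Ks : skew_unit C m *m diag_mx s = diag_mx s *m skew_unit C m.
  have := skew_diag_comm (const_mx 1) t; rewrite skew_diagE.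
  by rewrite row_mx_const diag_const_mx mulmx1 mulmxN mulNmx => /oppr_inj.
have eX' : X = P *m (skew_unit C m) ^t* *m diag_mx s *m diag_mx s *m P^T *m F.
  by rewrite eX skew_diagE ed adjoint_skew_unit !mulmxA.
clearbody s.
apply: (two_step_formula2 A2 XX _ _ _ hP d0).
- exact: (form_two_step_fibre A2 XX gF W0 FF' hP s0 KK Ks V1 V2 eW eX').
- by rewrite gS.
- by move: r4; rewrite rX; lia.
by rewrite (adapted_gram FF' hP s0 KK Ks eX') ed.
Qed.

End Potential.

(** In the normal form, X^2 factors through the compressed form on the plane,
    which has rank one, and X^3 contains E J E = 0. *)
Lemma orthogonal_rank_two (C : numClosedFieldType) N k (F X : 'M[C]_N) :
  F^T = F -> F *m F ^t* = 1%:M -> X^T *m F + F *m X = 0 -> X ^+ k = 0 ->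
  (\rank X <= 2)%N -> X *m X <> 0 ->
  [/\ exists (Q : 'M[C]_(N, 1 + 1)) (d : 'rV[C]_1),
        [/\ isometry_mx Q, positive_row d & X = Q *m skew_diag d *m Q^T *m F],
      \rank X = 2%N, \rank (X ^+ 2) = 1%N & X ^+ 3 = 0].
Proof.
move=> sF FF' XF Xk r2 XX.
have [m [Q [d [hQ d0 eX rX]]]] := orthogonal_normal_form FF' XF sF.
have m1 : m = 1%N.
  case: m Q d hQ d0 eX rX => [|[|m]] Q d hQ d0 eX rX //.
    by case: XX; have /eqP -> : X == 0; rewrite ?mul0mx // -mxrank_eq0 rX.
  by move: r2; rewrite rX; lia.
subst m.
have [P [s [t [hP s0 t0 eX' eG]]]] := three_step_normal_form sF FF' hQ d0 eX Xk XX.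
split=> //; first by exists Q, d.
  have e2 : X *m X = s *: (P *m (skew_unit C 1) ^t*) *m (t *: block_mx 0 0 0 1%:M) *m
      (s *: ((skew_unit C 1) ^t* *m P^T *m F)).
    by rewrite -eG eX' -!(scalemxAl, scalemxAr) !mulmxA.
  apply/eqP; rewrite eqn_leq lt0n mxrank_eq0; apply/andP; split; last by apply/eqP.
  rewrite expr2 [X * X]e2.
  apply: leq_trans (mxrankM_maxl _ _) _; apply: leq_trans (mxrankM_maxr _ _) _.
  rewrite mxrank_scale_nz ?gt_eqF // rank_diag_block_mx mxrank0 add0n.
  exact: rank_leq_row.
have e3 : X *m X *m X = s *: (P *m (skew_unit C 1) ^t*) *m
    (t *: block_mx 0 0 0 1%:M *m (s *: (skew_unit C 1) ^t*) *m (t *: block_mx 0 0 0 1%:M)) *m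
    (s *: ((skew_unit C 1) ^t* *m P^T *m F)).
  by rewrite -eG eX' -!(scalemxAl, scalemxAr) !mulmxA.
rewrite exprSr expr2 [_ * X]e3.
pose E : 'M[C]_(1 + 1) := block_mx 0 0 0 1%:M.
have EJE : E *m (skew_unit C 1) ^t* *m E = 0.
  rewrite adjoint_skew_unit /skew_unit opp_block_mx !mulmx_block.
  by rewrite !(mulmx0, mul0mx, addr0, add0r, oppr0) block_mx0.
have -> : t *: block_mx 0 0 0 1%:M *m (s *: (skew_unit C 1) ^t*) *m
    (t *: block_mx 0 0 0 1%:M) = t *: (s *: (t *: (E *m (skew_unit C 1) ^t* *m E))).
  by rewrite -!(scalemxAl, scalemxAr) !scalerA; congr (_ *: _); ring.
by rewrite EJE !scaler0 mulmx0 mul0mx.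
Qed.

Section ThreeStepPotential.
Variables (R : realType) (N k : nat).
Local Notation C := R[i].
Variables (F A X : 'M[C]_N) (W : forall j : nat, 'M[C]_(vdim A j)).
Hypotheses (Hg : ambient_form (So F)) (gX : complex_algebra (So F) X).
Hypotheses (W0 : W 0%N = F).
Hypotheses (W1 : compatible_form true (W 1)) (W2 : compatible_form false (W 2)).

Lemma orthogonal_three_step : A ^+ 3 = 0 -> X ^+ 3 = 0 -> X *m X <> 0 ->
  \rank X = vdim A 1 -> \rank (X ^+ 2) = vdim A 2 -> (\rank X <= 2)%N ->
  hk_potential 3 (So F) W X ^+ 2 =
    4 * kappa (So F) * c1 X
    + 4 * kappa (So F) * Num.sqrt (2 * c1 X ^+ 2 - kappa (So F) * c2 X).
Proof.
move=> A3 X3 XX e1 e2 r2.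
have [sF _ FF'] := compatible_formE Hg; rewrite expr0 scale1r in sF.
have [[Q [d [hQ d0 eX]]] rX1 rX2 _] := orthogonal_rank_two sF FF' gX X3 r2 XX.
have rA1 : vdim A 1 = 2%N by rewrite -e1.
have rA2 : vdim A 2 = 1%N by rewrite -e2.
have [p hp] := three_step_fibre sF FF' W0 W1 W2 A3 rA1 rA2 hQ d0 eX X3 XX.
have : [set norm_sq 3 p | p in hk_fibre 3 (So F) W X]%classic (norm_sq 3 p) by exists p.
rewrite /hk_potential => /(xgetI 0)[q hq <-].
rewrite (three_step_norm FF' W0 W1 W2 A3 rA1 rA2 hq).
have -> : 4 * kappa (So F) = 8 :> R by rewrite /kappa; ring.
by [].
Qed.

End ThreeStepPotential.

Theorem theorem4p1 (R : realType) (N : nat) (g : classical_type R N)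
    (A : 'M[R[i]]_N) (k : nat) (W : forall j : nat, 'M[R[i]]_(vdim A j))
    (Hg : ambient_form g)
    (HA : complex_algebra g A)
    (Hk : nilpotency_degree A k)
    (HW : quiver_forms k g W)
    (Hcoh : cohomogeneity g (adjoint_orbit g A) 2)
    (X : 'M[R[i]]_N)
    (HX : adjoint_orbit g A X) :
  hk_potential k g W X ^+ 2 =
    4 * kappa g * c1 X
    + 4 * kappa g * Num.sqrt (2 * c1 X ^+ 2 - kappa g * c2 X).
Proof.
have [Ak Ak1] := Hk.
have gX := adjoint_orbit_algebra Hg HA HX.
have typ := orbit_type Hg HA Ak Hcoh.
have rX : \rank X = \rank A by have := adjoint_orbit_rank Hg 1 HX; rewrite !expr1.
have rA1 : vdim A 1 = \rank A by rewrite /vdim expr1.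
have X2 : A *m A = 0 -> X *m X = 0.
  by have := adjoint_orbit_pow0 Hg 2 HX; rewrite !expr2 => -[_].
have [A2|A2N] := eqVneq (A *m A) 0.
  have {}X2 := X2 A2; have A2' : A ^+ 2 = 0 by rewrite expr2.
  case: k Hk HW Ak Ak1 {typ} (typ) => [|[|[|k]]] _ HW Ak Ak1 typ //=.
  - apply: one_step_formula.
    by apply/(adjoint_orbit_pow0 Hg 1 HX : X ^+ 1 = 0 <-> A ^+ 1 = 0).
  - case: g Hg HW gX typ {HA HX Hcoh} => [|F|F] Hg HW gX [r24 _].
    + by apply: special_linear_two_step; rewrite ?rX ?rA1.
    + case: HW => W0 W1; have {}W1 := W1 1%N isT.
      by apply: (orthogonal_two_step Hg gX erefl W0); rewrite ?rX ?rA1.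
    + case: HW => W0 W1; have {}W1 := W1 1%N isT.
      by apply: (symplectic_two_step Hg gX erefl W0); rewrite ?rX ?rA1.
  by case: Ak1; rewrite -[k.+2]addn2 exprD A2' mulr0.
case: g Hg HW typ gX HA HX {Hcoh} => [|F|F] Hg HW typ gX HA HX;
  try by case: typ => _ A2; rewrite A2 eqxx in A2N.
have r2 : (\rank A <= 2)%N by case: typ => _ [A2|//]; rewrite A2 eqxx in A2N.
have [sF _ FF'] := compatible_formE Hg; rewrite expr0 scale1r in sF.
have [_ _ _ A3] := orthogonal_rank_two sF FF' HA Ak r2 (elimN eqP A2N).
(* Only so(N) and rank two are left, where the cube of A vanishes. *)
have k3 : k = 3%N.
  case: k Ak Ak1 {Hk HW} => [|[|[|[|k]]]] Ak Ak1 //.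
  - by rewrite expr1 in Ak; move: A2N; rewrite Ak mul0mx eqxx.
  - by rewrite expr2 in Ak; move: A2N; rewrite [A *m A]Ak eqxx.
  by case: Ak1; rewrite -[k.+3]addn3 exprD A3 mulr0.
subst k; case: HW => W0 Wj.
apply: (orthogonal_three_step Hg gX W0 (Wj 1%N isT) (Wj 2%N isT) A3).
- exact/(adjoint_orbit_pow0 Hg 3 HX).
- have := adjoint_orbit_pow0 Hg 2 HX; rewrite !expr2 => -[h _] /h e.
  by move: A2N; rewrite -[A *m A]/(A * A) e eqxx.
- by rewrite rX.
- exact: adjoint_orbit_rank HX.
by rewrite rX.
Qed.
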